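(* If Rohrlich's conjecture is true, then the Membership Problem and the Threshold Problem for hypergeometric sequences with rational parameters are both decidable.
   Context: A hypergeometric sequence with rational parameters is a sequence $\langle u_n\rangle_{n=0}^\infty$ of rationals satisfying $p(n)u_n=q(n)u_{n-1}$ for $n\geq1$, where $p,q\in\mathbb{Q}[x]$ split completely over $\mathbb{Q}$ and $p$ has no non-negative integer zeros; it is given by $p,q,u_0$. The Membership Problem asks, given such a sequence and $t\in\mathbb{Q}$, whether $u_n=t$ for some $n\in\mathbb{N}$. The Threshold Problem asks, given such a sequence and $t\in\mathbb{Q}$, whether $u_n\geq t$ for all $n\in\mathbb{N}$. Rohrlich's conjecture: any multiplicative relation of the form $\pi^{b/2}\prod_{a\in\mathbb{Q}}\Gamma(a)^{m_a}\in\overline{\mathbb{Q}}$ (finitely many nonzero $m_a$), with $b,m_a\in\mathbb{Z}$, is a consequence of the standard relations of the Gamma function: translation $\Gamma(x+1)=x\Gamma(x)$, reflection $\Gamma(x)\Gamma(1-x)=\pi/\sin(\pi x)$, and multiplication $\prod_{k=0}^{n-1}\Gamma(x+\tfrac{k}{n})=(2\pi)^{(n-1)/2}n^{1/2-nx}\Gamma(nx)$. *)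

(* Defs.v *)
From mathcomp Require Import all_boot all_order all_algebra.
From mathcomp Require Import all_classical all_reals all_analysis.
Set Implicit Arguments.
Unset Strict Implicit.
Unset Printing Implicit Defensive.
Import Order.TTheory GRing.Theory Num.Theory.
Local Open Scope ring_scope.

(* Kleene's partial recursive functions.  Programs are untyped with respect to
   arity; a program applied to too few arguments has no value.  In RPrim and
   RMin the recursion (resp. search) variable is the first argument. *)

Inductive program : Type :=
| RZero
| RSucc
| RProj of nat
| RComp of program & seq program
| RPrim of program & program
| RMin of program.

(* [eval f v y]: on input [v], the program [f] halts with output [y]. *)
Inductive eval : program -> seq nat -> nat -> Prop :=
| eval_zero v : eval RZero v 0%N
| eval_succ x v : eval RSucc (x :: v) x.+1
| eval_proj i v : (i < size v)%N -> eval (RProj i) v (nth 0%N v i)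
| eval_comp f gs v w y : evals gs v w -> eval f w y -> eval (RComp f gs) v y
| eval_prim0 f g v y : eval f v y -> eval (RPrim f g) (0%N :: v) y
| eval_primS f g n v r y :
    eval (RPrim f g) (n :: v) r -> eval g (n :: r :: v) y ->
    eval (RPrim f g) (n.+1 :: v) y
| eval_min f n v (h : nat -> nat) :
    (forall i, (i < n)%N -> eval f (i :: v) (h i).+1) ->
    eval f (n :: v) 0%N -> eval (RMin f) v n
with evals : seq program -> seq nat -> seq nat -> Prop :=
| evals_nil v : evals [::] v [::]
| evals_cons g gs v y w :
    eval g v y -> evals gs v w -> evals (g :: gs) v (y :: w).

Record decision_problem : Type := DecisionProblem {
  instance : Type;
  encode : instance -> nat;
  holds : instance -> Prop
}.

Definition decidable_problem (P : decision_problem) : Prop :=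
  exists f : program, forall x : instance P,
    exists2 answer : bool,
      eval f [:: encode x] (nat_of_bool answer) & answer <-> holds x.

Definition splits (p : {poly rat}) : Prop :=
  exists s : seq rat, p = lead_coef p *: \prod_(a <- s) ('X - a%:P).

Record hypergeometric : Type := Hypergeometric {
  hg_p : {poly rat};
  hg_q : {poly rat};
  hg_u0 : rat;
  hg_p_splits : splits hg_p;
  hg_q_splits : splits hg_q;
  hg_p_neq0 : forall n : nat, hg_p.[n%:R] != 0
}.

Definition is_sequence_of (h : hypergeometric) (u : nat -> rat) : Prop :=
  u 0%N = hg_u0 h /\
  forall n : nat, (1 <= n)%N ->
    (hg_p h).[n%:R] * u n = (hg_q h).[n%:R] * u n.-1.

Lemma is_sequence_of_unique (h : hypergeometric) :
  exists! u : nat -> rat, is_sequence_of h u.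
Proof.
pose F := fix F n : rat := if n is m.+1 then
  (hg_q h).[m.+1%:R] * F m / (hg_p h).[m.+1%:R] else hg_u0 h.
exists F; split.
  split=> // -[//|n] _ /=; rewrite mulrC divfK //; exact: hg_p_neq0.
move=> u [u0 uS]; apply/funext; elim=> [|n IHn] /=; first by rewrite u0.
have pn0 := hg_p_neq0 h n.+1.
by apply: (mulfI pn0); rewrite uS //= mulrC divfK // IHn.
Qed.

(* Polynomials are presented to a program by their lists of coefficients, and
   rationals by their reduced numerator and denominator. *)

Definition int_code (z : int) : nat :=
  match z with Posz n => n.*2 | Negz n => n.*2.+1 end.

Definition rat_code (r : rat) : nat :=
  CodeSeq.code [:: int_code (numq r); int_code (denq r)].

Definition poly_code (p : {poly rat}) : nat :=
  CodeSeq.code [seq rat_code c | c <- polyseq p].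

Definition hypergeometric_code (x : hypergeometric * rat) : nat :=
  CodeSeq.code [:: poly_code (hg_p x.1); poly_code (hg_q x.1);
                   rat_code (hg_u0 x.1); rat_code x.2].

Definition membership_problem : decision_problem :=
  {| instance := hypergeometric * rat;
     encode := hypergeometric_code;
     holds := fun x => exists2 u : nat -> rat,
       is_sequence_of x.1 u & exists n : nat, u n = x.2 |}.

Definition threshold_problem : decision_problem :=
  {| instance := hypergeometric * rat;
     encode := hypergeometric_code;
     holds := fun x => exists2 u : nat -> rat,
       is_sequence_of x.1 u & forall n : nat, u n >= x.2 |}.

Definition Gamma_integral (R : realType) (x : R) : R :=
  \int[@lebesgue_measure R]_(t in `]0%R, +oo[%classic)
    (t `^ (x - 1) * expR (- t)).

(* For [x <= 0] this is the continuation through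
   Gamma(x) = Gamma(x + k) / (x (x + 1) ... (x + k - 1)), with [k] least such
   that [0 < x + k].  At the poles 0, -1, -2, ... the value is meaningless. *)
Definition Gamma (R : realType) (x : R) : R :=
  let k := if 0 < x then 0%N else (Num.truncn (- x)).+1 in
  Gamma_integral (x + k%:R) / \prod_(i < k) (x + i%:R).

Definition gamma_pole (a : rat) : bool := (a \is a Num.int) && (a <= 0).

Definition gamma_monomial (R : realType) (b : int) (m : rat -> int) : R :=
  pi `^ (b%:~R / 2) * \big[*%R/1]_(a \in [set: rat]) Gamma (ratr a : R) ^ m a.

Definition delta (a : rat) : rat -> int := fun x => (x == a)%:R.

(* [gamma_consequence b m]: the relation asserting that
   pi^(b/2) * prod_a Gamma(a)^(m a) is algebraic follows from the standard
   relations, read at rational arguments and modulo algebraic factors (which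
   is why x, sin(pi x), 2^((n-1)/2) and n^(1/2-nx) do not show up).
   - [gc_one] is Gamma(1) = 1; it comes out of translation and reflection only
     after removing a singularity, Gamma(1+x)Gamma(1-x) = pi x / sin(pi x) at
     x = 0, and not from their instances at rational points.
   - [gc_root] is needed: if a power of a number is algebraic then so is the
     number, and some algebraic Gamma monomials are obtained from the standard
     relations only after extracting a square root. *)
Inductive gamma_consequence : int -> (rat -> int) -> Prop :=
| gc_translation (a : rat) :
    ~~ gamma_pole a ->
    gamma_consequence 0 (delta (a + 1) - delta a)
| gc_reflection (a : rat) :
    a \isn't a Num.int ->
    gamma_consequence (- 2) (delta a + delta (1 - a))
| gc_multiplication (n : nat) (a : rat) :
    (0 < n)%N -> ~~ gamma_pole (n%:R * a) ->
    gamma_consequence (1 - n%:Z)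
      (\sum_(k < n) delta (a + k%:R / n%:R) - delta (n%:R * a))
| gc_one : gamma_consequence 0 (delta 1)
| gc_mul (b b' : int) (m m' : rat -> int) :
    gamma_consequence b m -> gamma_consequence b' m' ->
    gamma_consequence (b + b') (m + m')
| gc_inv (b : int) (m : rat -> int) :
    gamma_consequence b m -> gamma_consequence (- b) (- m)
| gc_root (n : nat) (b : int) (m : rat -> int) :
    (0 < n)%N -> gamma_consequence (b *+ n) (m *+ n) ->
    gamma_consequence b m.

Definition rohrlich_conjecture (R : realType) : Prop :=
  forall (b : int) (m : rat -> int),
    finite_set [set a | m a != 0] ->
    (forall a : rat, gamma_pole a -> m a = 0) ->
    algebraicOver (ratr : rat -> R) (gamma_monomial R b m) ->
    gamma_consequence b m.

(* Main.v *)
Require Import Defs.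
From mathcomp Require Import all_boot all_order all_algebra.
From mathcomp Require Import all_classical all_reals all_analysis.
From mathcomp Require Import measurable_realfun.
From mathcomp Require Import ring lra zify.
From mathcomp Require Import algC cyclotomic.
From mathcomp.real_closed Require Import complex.
Set Implicit Arguments.
Unset Strict Implicit.
Unset Printing Implicit Defensive.
Import Order.TTheory GRing.Theory Num.Theory.
Import numFieldNormedType.Exports.
Local Open Scope classical_set_scope.
Local Open Scope ring_scope.

(** Both problems and their complements are semi-decided by searching for a
    certificate.  The squares y_n = u_n^2 satisfy y_n / y_(n-1) = q(n)^2 / p(n)^2,
    hence are eventually constant or strictly monotone; replacing (p, q, u_0, t)
    by (q, p, 1/u_0, 1/t) if necessary, they decrease.  If y_n tends to a limit
    different from t^2, a finite computation shows on which side of t^2 the tail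
    of the sequence lies.

    The remaining case is that the limit equals t^2, which then forces u_n^2 > t^2
    for all large n.  By Euler's limit formula the limit is u_0^2 times the square
    of a quotient of products of values Gamma(1 - b) by values Gamma(1 - a), over
    the rational roots b of p and a of q.  If it equals t^2, this quotient is
    rational, and Rohrlich's conjecture derives that fact from the standard
    relations.  Such a derivation can be found by search, and checked: it expresses
    a power of the quotient as an explicit element of a cyclotomic field
    Q(zeta_N), and comparing this element with a rational number amounts to a
    divisibility by the cyclotomic polynomial of order N.  Conversely a successful
    check proves that the limit is t^2, since the standard relations hold. *)

(** * Recursive functions *)

(** The obstacle is equality of the limit with t^2: approximation can refute it but never confirm
    it, so the confirming certificate has to be algebraic. Squares serve twice: monotonicity becomes
    the sign of the single polynomial p^2 - q^2, and the ratio of leading coefficients, which may be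
    -1 and keep u_n from converging, disappears. Two features of the relations stand in the way of a
    check. Powers of pi must cancel: the constant of a multiplication relation is divided out by the
    instance at 1/n, which leaves pi in the reflections only, and their numbers on the two sides are
    required to agree. Radicals must disappear: with all arguments in (1/N)Z, the 2N-th power of
    n^(1-na) is an integral power of n, and even powers of sin(pi a) lie in Q(zeta_N). Hence the
    exponent 2KN, where K absorbs the roots extracted in a derivation; it can be undone because
    squares are nonnegative. Treated apart are t = 0, which has no inverse, sequences that reach 0,
    and p^2 = q^2. The threshold problem needs in addition the eventual sign of u_n. *)

Section Programs.
Local Open Scope nat_scope.
Implicit Types (F G H : seq nat -> nat) (k n : nat) (v : seq nat).

Definition recursive k F :=
  exists p : program, forall v, size v = k -> Defs.eval p v (F v).

Definition recursive1 (f : nat -> nat) := recursive 1 (fun v => f (nth 0 v 0)).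
Definition recursive2 (f : nat -> nat -> nat) :=
  recursive 2 (fun v => f (nth 0 v 0) (nth 0 v 1)).
Definition recursive3 (f : nat -> nat -> nat -> nat) :=
  recursive 3 (fun v => f (nth 0 v 0) (nth 0 v 1) (nth 0 v 2)).

Lemma recursive_ext k F G : (forall v, size v = k -> F v = G v) ->
  recursive k F -> recursive k G.
Proof. by move=> FG [p hp]; exists p => v sv; rewrite -FG//; exact: hp. Qed.

Lemma recursive_zero k : recursive k (fun=> 0).
Proof. by exists RZero => v _; constructor. Qed.

Lemma recursive_proj k i : i < k -> recursive k (fun v => nth 0 v i).
Proof. by move=> ik; exists (RProj i) => v sv; constructor; rewrite sv. Qed.

Lemma recursive1_id : recursive1 id.
Proof. exact: recursive_proj. Qed.

Lemma recursive_succ k F : recursive k F -> recursive k (fun v => (F v).+1).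
Proof.
move=> [p hp]; exists (RComp RSucc [:: p]) => v sv.
apply: (@eval_comp _ _ _ [:: F v]); last by constructor.
by apply: evals_cons; [exact: hp|exact: evals_nil].
Qed.

Lemma recursive_const k c : recursive k (fun=> c).
Proof.
by elim: c => [|c IH]; [exact: recursive_zero|exact: (recursive_succ IH)].
Qed.

Lemma recursive_comp1 (f : nat -> nat) k F :
  recursive1 f -> recursive k F -> recursive k (fun v => f (F v)).
Proof.
move=> [p hp] [q hq]; exists (RComp p [:: q]) => v sv.
apply: (@eval_comp _ _ _ [:: F v]); last first.
  exact: (hp [:: F v]).
by apply: evals_cons; [exact: hq|exact: evals_nil].
Qed.

Lemma recursive_comp2 (f : nat -> nat -> nat) k F G :
  recursive2 f -> recursive k F -> recursive k G ->
  recursive k (fun v => f (F v) (G v)).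
Proof.
move=> [p hp] [q hq] [r hr]; exists (RComp p [:: q; r]) => v sv.
apply: (@eval_comp _ _ _ [:: F v; G v]); last exact: (hp [:: F v; G v]).
apply: evals_cons; first exact: hq.
by apply: evals_cons; [exact: hr|exact: evals_nil].
Qed.

Lemma recursive_rec0 (a : nat) (g : nat -> nat -> nat) : recursive2 g ->
  recursive1 (nat_rect (fun=> nat) a g).
Proof.
move=> [q hq]; have [p hp] := recursive_const 0 a.
exists (RPrim p q) => -[|n [|//]]//= _; elim: n => [|n IH] /=.
  by constructor; exact: hp.
by apply: (eval_primS IH); exact: (hq [:: n; _]).
Qed.

Lemma recursive_rec1 (f : nat -> nat) (g : nat -> nat -> nat -> nat) :
  recursive1 f -> recursive3 g ->
  recursive2 (fun n x => nat_rect (fun=> nat) (f x) (fun m r => g m r x) n).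
Proof.
move=> [p hp] [q hq]; exists (RPrim p q) => -[|n [|x [|//]]]//= _.
elim: n => [|n IH] /=; first by constructor; exact: (hp [:: x]).
by apply: (eval_primS IH); exact: (hq [:: n; _; x]).
Qed.

Lemma recursive2_flip f : recursive2 f -> recursive2 (fun x y => f y x).
Proof. by move=> hf; apply: (recursive_comp2 hf); exact: recursive_proj. Qed.

Lemma recursive_add : recursive2 addn.
Proof.
have h : recursive3 (fun _ r _ => r.+1).
  by apply: recursive_succ; exact: (@recursive_proj 3 1).
have := recursive_rec1 recursive1_id h.
apply: recursive_ext => -[|n [|x [|//]]]//= _; rewrite addnC.
by elim: n => [|n /= ->]; rewrite ?addn0 ?addnS.
Qed.

Lemma recursive_mul : recursive2 muln.
Proof.
have h : recursive3 (fun _ r x => r + x).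
  by apply: (recursive_comp2 recursive_add); exact: recursive_proj.
have := @recursive_rec1 (fun=> 0) _ (recursive_zero 1) h.
apply: recursive_ext => -[|n [|x [|//]]]//= _.
by elim: n => [//|n /= ->]; rewrite mulSn addnC.
Qed.

Lemma recursive_pred : recursive1 predn.
Proof.
have h : recursive2 (fun m _ => m) by exact: recursive_proj.
have := recursive_rec0 0 h.
by apply: recursive_ext => -[|[|n] [|//]].
Qed.

Lemma recursive_sub : recursive2 subn.
Proof.
have h : recursive3 (fun _ r _ => r.-1).
  by apply: (recursive_comp1 recursive_pred); exact: recursive_proj.
have := recursive2_flip (recursive_rec1 recursive1_id h).
apply: recursive_ext => -[|x [|n [|//]]]//= _.
by elim: n => [|n /= ->]; rewrite ?subn0 ?subnS.
Qed.

Lemma recursive_exp2 : recursive1 (expn 2).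
Proof.
have h : recursive2 (fun _ r => r + r).
  by apply: (recursive_comp2 recursive_add); exact: recursive_proj.
have := recursive_rec0 1 h.
apply: recursive_ext => -[|n [|//]]//= _.
by elim: n => [//|n /= ->]; rewrite expnS mul2n addnn.
Qed.

Lemma recursive_odd : recursive1 (fun n => odd n).
Proof.
have h : recursive2 (fun _ r => 1 - r).
  apply: (recursive_comp2 recursive_sub); first exact: recursive_const.
  exact: recursive_proj.
have := recursive_rec0 0 h.
apply: recursive_ext => -[|n [|//]]//= _.
by elim: n => [//|n /= ->]; case: (odd n).
Qed.

Lemma recursive_half : recursive1 half.
Proof.
have h : recursive2 (fun m r => odd m + r).
  apply: (recursive_comp2 recursive_add); last exact: recursive_proj.
  by apply: (recursive_comp1 recursive_odd); exact: recursive_proj.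
have := recursive_rec0 0 h.
apply: recursive_ext => -[|n [|//]]//= _.
by elim: n => [//|n /= ->]; rewrite uphalf_half.
Qed.

Lemma recursive_iter (g : nat -> nat) : recursive1 g ->
  recursive2 (fun n x => iter n g x).
Proof.
move=> hg; have h : recursive3 (fun _ r _ => g r).
  by apply: (recursive_comp1 hg); exact: recursive_proj.
have := recursive_rec1 recursive1_id h.
by apply: recursive_ext => -[|n [|x [|//]]].
Qed.

(* The codes of [CodeSeq.code] are used as S-expressions: [cell a b] is the
   code of a list with head [a] and with tail coded by [b]. *)
Definition cell a b := 2 ^ a * b.*2.+1.
Definition car c := head 0 (CodeSeq.decode c).
Definition cdr c := CodeSeq.code (behead (CodeSeq.decode c)).

Lemma decode_cell a b : CodeSeq.decode (cell a b) = a :: CodeSeq.decode b.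
Proof. by rewrite -{1}(CodeSeq.decodeK b) -[RHS]CodeSeq.codeK. Qed.

Lemma car_cell a b : car (cell a b) = a.
Proof. by rewrite /car decode_cell. Qed.

Lemma cdr_cell a b : cdr (cell a b) = b.
Proof. by rewrite /cdr decode_cell/= CodeSeq.decodeK. Qed.

Lemma cell_car_cdr c : 0 < c -> c = cell (car c) (cdr c).
Proof.
move=> c0; rewrite -[LHS]CodeSeq.decodeK /car /cdr.
case e : (CodeSeq.decode c) => [|a s]//.
by move: c0; rewrite -(CodeSeq.decodeK c) e.
Qed.

Lemma cell_gt0 a b : 0 < cell a b.
Proof. by rewrite /cell muln_gt0 expn_gt0. Qed.

Lemma iter_half_cell a b k : k <= a -> iter k half (cell a b) = cell (a - k) b.
Proof.
elim: k => [|k IH] ka; first by rewrite subn0.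
rewrite iterS IH ?(ltnW ka)// /cell.
have -> : a - k = (a - k.+1).+1 by rewrite -subSn// subSS.
by rewrite expnS -mulnA mul2n doubleK.
Qed.

Lemma odd_cell a b : odd (cell a b) = (a == 0).
Proof. by rewrite /cell oddM oddX /= odd_double andbT orbF. Qed.

Lemma recursive_cell : recursive2 cell.
Proof.
apply: (recursive_comp2 recursive_mul).
  by apply: (recursive_comp1 recursive_exp2); exact: recursive_proj.
apply: recursive_succ; rewrite (_ : (fun v => _) = fun v => nth 0 v 1 + nth 0 v 1).
  by apply: (recursive_comp2 recursive_add); exact: recursive_proj.
by apply/funext => v; rewrite addnn.
Qed.

Lemma recursive_car : recursive1 car.
Proof.
(* The head is the 2-adic valuation of c, found by searching for the first k at which c halved k
   times is odd; the second factor vanishes at c = 0, so that the search stops there at 0. *)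
have [p hp] : recursive2 (fun k c => (1 - odd (iter k half c)) * (1 - (1 - c))).
  apply: (recursive_comp2 recursive_mul).
    apply: (recursive_comp2 recursive_sub); first exact: recursive_const.
    apply: (recursive_comp1 recursive_odd).
    by apply: (recursive_comp2 (recursive_iter recursive_half)); exact: recursive_proj.
  apply: (recursive_comp2 recursive_sub); first exact: recursive_const.
  apply: (recursive_comp2 recursive_sub); first exact: recursive_const.
  exact: recursive_proj.
exists (RMin p) => -[|c [|//]]//= _.
case: (posnP c) => [->|c0].
  by apply: (@eval_min _ _ _ (fun=> 0)) => //; exact: (hp [:: 0; 0]).
have [a [b ->]] : exists a b, c = cell a b.
  by exists (car c), (cdr c); exact: cell_car_cdr.
rewrite car_cell; have cab : 1 - cell a b = 0 by apply/eqP; exact: cell_gt0.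
apply: (@eval_min _ _ _ (fun=> 0)) => [i ia|].
  have := hp [:: i; cell a b] erefl.
  by rewrite /= iter_half_cell ?(ltnW ia)// odd_cell subn_eq0 leqNgt ia cab.
have := hp [:: a; cell a b] erefl.
by rewrite /= iter_half_cell// odd_cell subnn.
Qed.

(** After [car c] halvings a nonzero c has become 2b + 1, and one more halving leaves the tail b. *)
Lemma recursive_cdr : recursive1 cdr.
Proof.
have h : recursive1 (fun c => half (iter (car c) half c)).
  apply: (recursive_comp1 recursive_half).
  apply: (recursive_comp2 (recursive_iter recursive_half)); last exact: recursive_proj.
  by apply: (recursive_comp1 recursive_car); exact: recursive_proj.
apply: recursive_ext h => -[|c [|//]]//= _.
case: (posnP c) => [->//|c0].
rewrite {2}(cell_car_cdr c0) iter_half_cell// subnn /cell mul1n.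
by rewrite -[LHS]/(uphalf _) uphalf_double.
Qed.

Lemma recursive1_iter (g : nat -> nat) (n a : nat -> nat) :
  recursive1 g -> recursive1 n -> recursive1 a ->
  recursive1 (fun c => iter (n c) g (a c)).
Proof. by move=> hg hn ha; exact: (recursive_comp2 (recursive_iter hg)). Qed.

End Programs.

(** * Computable functions on coded types *)

(* Every natural number is the code of some value, and a value may have many
   codes: a computable function is one realized by a recursive function on codes. *)
Class code (T : Type) := Code {
  dc : nat -> T;
  ec : T -> nat;
  ecK : forall x, dc (ec x) = x }.

Definition computable {A B : Type} {cA : code A} {cB : code B} (f : A -> B) :=
  exists2 g : nat -> nat, recursive1 g & forall n, dc (g n) = f (dc n).

Section RecursiveClosure.
Local Open Scope nat_scope.
Variable k : nat.
Implicit Types F G : seq nat -> nat.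

Lemma recursiveD F G : recursive k F -> recursive k G ->
  recursive k (fun v => F v + G v).
Proof. exact: (recursive_comp2 recursive_add). Qed.

Lemma recursiveM F G : recursive k F -> recursive k G ->
  recursive k (fun v => F v * G v).
Proof. exact: (recursive_comp2 recursive_mul). Qed.

Lemma recursiveB F G : recursive k F -> recursive k G ->
  recursive k (fun v => F v - G v).
Proof. exact: (recursive_comp2 recursive_sub). Qed.

Lemma recursiveCell F G : recursive k F -> recursive k G ->
  recursive k (fun v => cell (F v) (G v)).
Proof. exact: (recursive_comp2 recursive_cell). Qed.

Lemma recursiveCar F : recursive k F -> recursive k (fun v => car (F v)).
Proof. exact: (recursive_comp1 recursive_car). Qed.

Lemma recursiveCdr F : recursive k F -> recursive k (fun v => cdr (F v)).
Proof. exact: (recursive_comp1 recursive_cdr). Qed.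

Lemma recursiveOdd F : recursive k F -> recursive k (fun v => odd (F v)).
Proof. exact: (recursive_comp1 recursive_odd). Qed.

Lemma recursiveHalf F : recursive k F -> recursive k (fun v => (F v)./2).
Proof. exact: (recursive_comp1 recursive_half). Qed.

End RecursiveClosure.

Ltac recursive_tac := rewrite ?/recursive1 ?/recursive2; repeat first
  [ assumption
  | apply: recursiveCell | apply: recursiveCar | apply: recursiveCdr
  | apply: recursiveD | apply: recursiveM | apply: recursiveB
  | apply: recursiveOdd | apply: recursiveHalf
  | apply: recursive_succ
  | by apply: recursive_proj
  | exact: recursive_const
  | match goal with h : recursive1 _ |- _ => apply: (recursive_comp1 h) end ].

Section Codes.
Local Open Scope nat_scope.

Definition nz n := 1 - (1 - n).

Lemma nzE n : nz n = (n != 0).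
Proof. by case: n. Qed.

#[export] Instance code_nat : code nat := @Code nat id id (fun=> erefl).

Lemma ecK_bool (b : bool) : (nat_of_bool b != 0) = b.
Proof. by case: b. Qed.
#[export] Instance code_bool : code bool :=
  {| dc := fun n => n != 0; ec := nat_of_bool; ecK := ecK_bool |}.

Lemma ecK_pair (A B : Type) {cA : code A} {cB : code B} (x : A * B) :
  (fun n => (dc (car n) : A, dc (cdr n) : B)) (cell (ec x.1) (ec x.2)) = x.
Proof. by case: x => a b; rewrite car_cell cdr_cell !ecK. Qed.
#[export] Instance code_pair A B {cA : code A} {cB : code B} : code (A * B) :=
  {| dc := fun n => (dc (car n), dc (cdr n)); ec := fun x => cell (ec x.1) (ec x.2);
     ecK := @ecK_pair A B cA cB |}.

Lemma ecK_seq (A : Type) {cA : code A} (s : seq A) :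
  (fun n => [seq (dc i : A) | i <- CodeSeq.decode n]) (CodeSeq.code (map ec s)) = s.
Proof. rewrite /= CodeSeq.codeK -[RHS]map_id -map_comp.
by apply: eq_map => x /=; exact: ecK. Qed.
#[export] Instance code_seq A {cA : code A} : code (seq A) :=
  {| dc := fun n => map dc (CodeSeq.decode n); ec := fun s => CodeSeq.code (map ec s);
     ecK := @ecK_seq A cA |}.

Lemma dc_pair (A B : Type) {cA : code A} {cB : code B} n :
  dc n = (dc (car n), dc (cdr n)) :> A * B.
Proof. by []. Qed.

Lemma dc_cons (A : Type) {cA : code A} a n :
  dc (cell a n) = (dc a : A) :: dc n.
Proof. by rewrite /dc/= decode_cell. Qed.

Section Closure.
Variables (X : Type) (cX : code X).

Lemma computable_id : computable (@id X).
Proof. by exists id => //; exact: recursive1_id. Qed.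

Lemma computable_cst (A : Type) {cA : code A} (a : A) : computable (fun _ : X => a).
Proof. by exists (fun=> ec a) => [|n]; [exact: recursive_const|rewrite ecK]. Qed.

Lemma computable_comp (A B : Type) {cA : code A} {cB : code B}
  (g : A -> B) (f : X -> A) :
  computable g -> computable f -> computable (fun x => g (f x)).
Proof.
move=> [h rh hP] [k rk kP]; exists (fun n => h (k n)).
  exact: (recursive_comp1 rh).
by move=> n; rewrite hP kP.
Qed.

Lemma computable_op1 (A B : Type) {cA : code A} {cB : code B} (op : A -> B)
  (g : nat -> nat) : recursive1 g -> (forall n, dc (g n) = op (dc n)) ->
  forall f : X -> A, computable f -> computable (fun x => op (f x)).
Proof. by move=> rg gP f; apply: computable_comp; exists g. Qed.

Lemma computable_op2 (A B C : Type) {cA : code A} {cB : code B} {cC : code C}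
  (op : A -> B -> C) (g : nat -> nat -> nat) : recursive2 g ->
  (forall m n, dc (g m n) = op (dc m) (dc n)) ->
  forall (f1 : X -> A) (f2 : X -> B), computable f1 -> computable f2 ->
  computable (fun x => op (f1 x) (f2 x)).
Proof.
move=> rg gP f1 f2 [h rh hP] [k rk kP]; exists (fun n => g (h n) (k n)).
  exact: (recursive_comp2 rg).
by move=> n; rewrite gP hP kP.
Qed.

Lemma computable_pair (A B : Type) {cA : code A} {cB : code B}
  (f : X -> A) (g : X -> B) :
  computable f -> computable g -> computable (fun x => (f x, g x)).
Proof.
apply: (computable_op2 (g := cell)); first exact: recursive_cell.
by move=> m n; rewrite dc_pair car_cell cdr_cell.
Qed.

Lemma computable_fst (A B : Type) {cA : code A} {cB : code B} (f : X -> A * B) :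
  computable f -> computable (fun x => (f x).1).
Proof. by apply: (computable_op1 (g := car)) => //; exact: recursive_car. Qed.

Lemma computable_snd (A B : Type) {cA : code A} {cB : code B} (f : X -> A * B) :
  computable f -> computable (fun x => (f x).2).
Proof. by apply: (computable_op1 (g := cdr)) => //; exact: recursive_cdr. Qed.

Lemma computable_if (A : Type) {cA : code A} (b : X -> bool) (f g : X -> A) :
  computable b -> computable f -> computable g ->
  computable (fun x => if b x then f x else g x).
Proof.
move=> [k rk kP] [h rh hP] [l rl lP].
exists (fun n => nz (k n) * h n + (1 - k n) * l n).
  by rewrite /nz; recursive_tac.
move=> n; rewrite nzE -kP -hP -lP /dc/=; case: (k n) => [|i] /=.
  by rewrite mul0n add0n mul1n.
by rewrite mul1n mul0n addn0.
Qed.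

Lemma computable_iter (A : Type) {cA : code A} (F : X -> A -> A) (n : X -> nat) (a : X -> A) :
  computable (fun p : X * A => F p.1 p.2) -> computable n -> computable a ->
  computable (fun x => iter (n x) (F x) (a x)).
Proof.
move=> [h rh hP] [k rk kP] [l rl lP].
(* The iterated function has no parameter, so the state carries the code of x beside the current
   value. *)
pose step st := cell (car st) (h st).
have rstep : recursive1 step by rewrite /step; recursive_tac.
exists (fun c => cdr (iter (k c) step (cell c (l c)))).
  have ra : recursive1 (fun c => cell c (l c)) by recursive_tac.
  exact: (recursiveCdr (recursive1_iter rstep rk ra)).
move=> c; rewrite -kP -lP.
have [e1 e2] : car (iter (k c) step (cell c (l c))) = c /\
    dc (cdr (iter (k c) step (cell c (l c)))) =
    iter (k c) (F (dc c)) (dc (l c)).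
  elim: (k c) => [|i [IH1 IH2]]; first by rewrite /= car_cell cdr_cell.
  by rewrite !iterS /step car_cell cdr_cell IH1 hP dc_pair IH1 IH2.
by rewrite e2.
Qed.

(** Lets a fold run for as many steps as the code of its list, a bound available without computing
    the length. *)
Lemma size_decode c : size (CodeSeq.decode c) <= c.
Proof.
rewrite -{2}(CodeSeq.decodeK c); elim: (CodeSeq.decode c) => [//|a s IH] /=.
apply: (@leq_trans (CodeSeq.code s).*2.+1).
  by rewrite ltnS -addnn (leq_trans IH)// leq_addr.
by rewrite leq_pmull// expn_gt0.
Qed.

Lemma computable_foldl (A E : Type) {cA : code A} {cE : code E}
  (F : X -> A -> E -> A) (s : X -> seq E) (a : X -> A) :
  computable (fun p : X * (A * E) => F p.1 p.2.1 p.2.2) ->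
  computable s -> computable a -> computable (fun x => foldl (F x) (a x) (s x)).
Proof.
move=> [h rh hP] [k rk kP] [l rl lP].
pose step st := nz (cdr (cdr st)) * cell (car st)
    (cell (h (cell (car st) (cell (car (cdr st)) (car (cdr (cdr st))))))
          (cdr (cdr (cdr st)))) + (1 - cdr (cdr st)) * st.
have rstep : recursive1 step by rewrite /step /nz; recursive_tac.
exists (fun c => car (cdr (iter (k c) step (cell c (cell (l c) (k c)))))).
  have ra : recursive1 (fun c => cell c (cell (l c) (k c))).
    by recursive_tac.
  exact: (recursiveCar (recursiveCdr (recursive1_iter rstep rk ra))).
move=> c; rewrite -kP -lP.
have step0 u v : step (cell u (cell v 0)) = cell u (cell v 0).
  by rewrite /step !cdr_cell mul0n add0n subn0 mul1n.
have stepS u v w r : step (cell u (cell v (cell w r))) =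
    cell u (cell (h (cell u (cell v w))) r).
  rewrite /step !cdr_cell !car_cell nzE -lt0n cell_gt0 mul1n.
  by rewrite (eqP (cell_gt0 w r : 1 - _ == 0)) mul0n addn0.
have gen i v r : size (CodeSeq.decode r) <= i ->
    dc (car (cdr (iter i step (cell c (cell v r))))) =
    foldl (F (dc c)) (dc v) (dc r).
  elim: i v r => [|i IH] v r.
    rewrite leqn0 size_eq0 => /eqP e.
    by rewrite /= cdr_cell car_cell {2}/dc/= e.
  case: (posnP r) => [-> _|r0].
    rewrite (_ : iter i.+1 step _ = cell c (cell v 0)) ?cdr_cell ?car_cell//.
    by elim: i.+1 => // j /= ->; rewrite step0.
  rewrite (cell_car_cdr r0); move: (car r) (cdr r) => w q.
  rewrite decode_cell /= ltnS => /IH {}IH.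
  by rewrite -iterS iterSr stepS IH decode_cell/= hP !dc_pair !(car_cell, cdr_cell).
exact/gen/size_decode.
Qed.

Lemma computable_succ (f : X -> nat) : computable f -> computable (fun x => (f x).+1).
Proof.
apply: (computable_op1 (g := S)) => //; recursive_tac.
Qed.

Lemma computable_addn (f g : X -> nat) :
  computable f -> computable g -> computable (fun x => f x + g x).
Proof. by apply: (computable_op2 (g := addn)) => //; exact: recursive_add. Qed.

Lemma computable_muln (f g : X -> nat) :
  computable f -> computable g -> computable (fun x => f x * g x).
Proof. by apply: (computable_op2 (g := muln)) => //; exact: recursive_mul. Qed.

Lemma computable_subn (f g : X -> nat) :
  computable f -> computable g -> computable (fun x => f x - g x).
Proof. by apply: (computable_op2 (g := subn)) => //; exact: recursive_sub. Qed.

Lemma computable_leq (f g : X -> nat) :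
  computable f -> computable g -> computable (fun x => f x <= g x).
Proof.
apply: (computable_op2 (g := fun m n => 1 - (m - n))).
  by recursive_tac.
by move=> m n; rewrite /dc/= /leq; case: (m - n).
Qed.

Lemma computable_andb (f g : X -> bool) :
  computable f -> computable g -> computable (fun x => f x && g x).
Proof.
apply: (computable_op2 (g := muln)); first exact: recursive_mul.
by move=> m n; rewrite /dc/= muln_eq0 negb_or.
Qed.

Lemma computable_negb (f : X -> bool) :
  computable f -> computable (fun x => ~~ f x).
Proof.
apply: (computable_op1 (g := fun m => 1 - m)).
  by recursive_tac.
by case.
Qed.

Lemma computable_orb (f g : X -> bool) :
  computable f -> computable g -> computable (fun x => f x || g x).
Proof.
apply: (computable_op2 (g := addn)); first exact: recursive_add.
by move=> m n; rewrite /dc/= addn_eq0 negb_and.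
Qed.

Lemma computable_eqn (f g : X -> nat) :
  computable f -> computable g -> computable (fun x => f x == g x).
Proof.
move=> cf cg; rewrite (_ : (fun x => _) = fun x => (f x <= g x) && (g x <= f x)).
  by apply: computable_andb; exact: computable_leq.
by apply/funext => x; rewrite eqn_leq.
Qed.

Lemma computable_cons (A : Type) {cA : code A} (f : X -> A) (g : X -> seq A) :
  computable f -> computable g -> computable (fun x => f x :: g x).
Proof.
apply: (computable_op2 (g := cell)); first exact: recursive_cell.
by move=> m n; rewrite dc_cons.
Qed.

Lemma computable_behead (A : Type) {cA : code A} (f : X -> seq A) :
  computable f -> computable (fun x => behead (f x)).
Proof.
apply: (computable_op1 (g := cdr)); first exact: recursive_cdr.
by move=> n; rewrite /cdr /dc/= CodeSeq.codeK behead_map.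
Qed.

Lemma computable_head (A : Type) {cA : code A} (d : A) (f : X -> seq A) :
  computable f -> computable (fun x => head d (f x)).
Proof.
apply: (computable_op1 (g := fun c => nz c * car c + (1 - c) * ec d)).
  by rewrite /nz; recursive_tac.
move=> n; rewrite nzE; case: (posnP n) => [->|n0] /=.
  by rewrite mul0n add0n mul1n ecK.
rewrite mul1n (eqP (n0 : 1 - _ == 0)) mul0n addn0.
by rewrite {2}(cell_car_cdr n0) decode_cell.
Qed.

End Closure.
End Codes.

Ltac computable_hyp := match goal with
  H : computable ?f |- computable (fun x => ?f (@?g x)) =>
    refine (computable_comp (f := g) H _) end.

Ltac computable_leaf := lazy beta; solve
  [ repeat first [ assumption | apply: computable_id | apply: computable_cst
                 | computable_hyp | apply: computable_fst | apply: computable_snd ] ].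

(** A formal difference over a positive denominator, not reduced: every number is then a valid code,
    and arithmetic needs no gcd. *)
Definition rat_of_code n : rat :=
  ((car n)%:R - (car (cdr n))%:R) / (cdr (cdr n)).+1%:R.

Definition code_of_rat (r : rat) : nat :=
  cell (if 0 <= numq r then `|numq r|%N else 0%N)
    (cell (if 0 <= numq r then 0%N else `|numq r|%N) (`|denq r|.-1)%N).

Lemma ecK_rat r : rat_of_code (code_of_rat r) = r.
Proof.
rewrite /rat_of_code /code_of_rat !(car_cell, cdr_cell).
rewrite prednK ?absz_gt0 ?denq_neq0// -[RHS]divq_num_den.
have -> : `|denq r|%N%:R = (denq r)%:~R :> rat.
  by rewrite -[X in _ = X%:~R](gez0_abs (denq_ge0 r)).
case: ifP => h; rewrite ?subr0 ?sub0r; congr (_ / _).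
  by rewrite -[X in _ = X%:~R](gez0_abs h).
rewrite -[X in _ = X%:~R]opprK -(@ltz0_abs (numq r)) ?intrN//.
by rewrite ltNge h.
Qed.
#[export] Instance code_rat : code rat :=
  {| dc := rat_of_code; ec := code_of_rat; ecK := ecK_rat |}.

Lemma ecK_poly (p : {poly rat}) :
  Poly (dc (ec (polyseq p)) : seq rat) = p.
Proof. by rewrite ecK polyseqK. Qed.
#[export] Instance code_poly : code {poly rat} :=
  {| dc := fun n => Poly (dc n : seq rat); ec := fun p => ec (polyseq p);
     ecK := ecK_poly |}.

(** * Computable operations on lists *)

Section Lists.
Local Open Scope nat_scope.

Lemma computable_rev (X : Type) {cX : code X} (A : Type) {cA : code A} (s : X -> seq A) :
  computable s -> computable (fun x => rev (s x)).
Proof.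
move=> cs; rewrite (_ : (fun x => _) = fun x => foldl (fun y e => e :: y) [::] (s x)).
  apply: computable_foldl => //; last computable_leaf.
  by apply: computable_cons; computable_leaf.
apply/funext => x; rewrite /rev.
by elim: (s x) [::] => [|e t IH] u //=; rewrite IH.
Qed.

Lemma computable_foldr (X : Type) {cX : code X} (A E : Type) {cA : code A} {cE : code E}
  (F : X -> E -> A -> A) (s : X -> seq E) (a : X -> A) :
  computable (fun p : X * (A * E) => F p.1 p.2.2 p.2.1) ->
  computable s -> computable a ->
  computable (fun x => foldr (F x) (a x) (s x)).
Proof.
move=> cF cs ca; rewrite (_ : (fun x => _) =
  fun x => foldl (fun y e => F x e y) (a x) (rev (s x))).
  by apply: computable_foldl => //; exact: computable_rev.
by apply/funext => x; rewrite foldl_rev.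
Qed.

Lemma computable_map (X : Type) {cX : code X} (A B : Type) {cA : code A} {cB : code B}
  (F : X -> A -> B) (s : X -> seq A) :
  computable (fun p : X * A => F p.1 p.2) -> computable s ->
  computable (fun x => map (F x) (s x)).
Proof.
move=> cF cs; rewrite (_ : (fun x => _) =
  fun x => foldr (fun e y => F x e :: y) [::] (s x)); last first.
  by apply/funext => x; elim: (s x) => //= e t ->.
apply: computable_foldr => //; last computable_leaf.
apply: computable_cons; last first.
  computable_leaf.
apply: (computable_comp (f := fun p : X * (seq B * A) => (p.1, p.2.2)) cF).
by apply: computable_pair; computable_leaf.
Qed.

Lemma computable_cat (X : Type) {cX : code X} (A : Type) {cA : code A} (s t : X -> seq A) :
  computable s -> computable t -> computable (fun x => s x ++ t x).
Proof.
move=> cs ct; rewrite (_ : (fun x => _) =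
  fun x => foldr (fun e y => e :: y) (t x) (s x)); last first.
  by apply/funext => x; elim: (s x) => //= e u ->.
apply: computable_foldr => //; apply: computable_cons.
  computable_leaf.
computable_leaf.
Qed.

Lemma computable_big (X : Type) {cX : code X} (A E : Type) {cA : code A} {cE : code E} (idx : A)
  (op : A -> A -> A) (F : X -> E -> A) (s : X -> seq E) :
  computable (fun p : A * A => op p.1 p.2) ->
  computable (fun p : X * E => F p.1 p.2) -> computable s ->
  computable (fun x => \big[op/idx]_(e <- s x) F x e).
Proof.
move=> cop cF cs; rewrite (_ : (fun x => _) =
  fun x => foldr (fun e y => op (F x e) y) idx (s x)); last first.
  apply/funext => x; elim: (s x) => [|e u IH] /=; first by rewrite big_nil.
  by rewrite big_cons IH.
apply: computable_foldr => //; last computable_leaf.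
apply: (computable_comp (f := fun p : X * (A * E) => (F p.1 p.2.2, p.2.1)) cop).
apply: computable_pair; last computable_leaf.
apply: (computable_comp (f := fun p : X * (A * E) => (p.1, p.2.2)) cF).
by apply: computable_pair; computable_leaf.
Qed.

Lemma computable_all (X : Type) {cX : code X} (E : Type) {cE : code E} (F : X -> E -> bool) (s : X -> seq E) :
  computable (fun p : X * E => F p.1 p.2) -> computable s ->
  computable (fun x => all (F x) (s x)).
Proof.
move=> cF cs; rewrite (_ : (fun x => _) = fun x => \big[andb/true]_(e <- s x) F x e).
  apply: computable_big => //; apply: computable_andb; computable_leaf.
by apply/funext => x; rewrite big_all.
Qed.

Lemma computable_flatten (X : Type) {cX : code X} (A : Type) {cA : code A} (s : X -> seq (seq A)) :
  computable s -> computable (fun x => flatten (s x)).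
Proof.
move=> cs; apply: (computable_foldr (F := fun=> cat)) => //; last computable_leaf.
by apply: computable_cat; [computable_leaf|
  computable_leaf].
Qed.

Lemma computable_size (X : Type) {cX : code X} (A : Type) {cA : code A} (s : X -> seq A) :
  computable s -> computable (fun x => size (s x)).
Proof.
move=> cs; rewrite (_ : (fun x => _) = fun x => foldr (fun _ n => n.+1) 0 (s x)).
  apply: computable_foldr => //; last computable_leaf.
  exact/computable_succ/computable_fst/computable_snd/computable_id.
by apply/funext => x; elim: (s x) => //= _ t ->.
Qed.

Lemma computable_nseq (X : Type) {cX : code X} (A : Type) {cA : code A} (n : X -> nat) (a : X -> A) :
  computable n -> computable a -> computable (fun x => nseq (n x) (a x)).
Proof.
move=> cn ca; rewrite (_ : (fun x => _) = fun x => iter (n x) (fun s => a x :: s) [::]).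
  apply: computable_iter => //; last computable_leaf.
  by apply: computable_cons; computable_leaf.
by apply/funext => x; elim: (n x) => //= k ->.
Qed.

Lemma computable_iota0 (X : Type) {cX : code X} (n : X -> nat) :
  computable n -> computable (fun x => iota 0 (n x)).
Proof.
move=> cn; rewrite (_ : (fun x => _) =
  fun x => iter (n x) (fun s => s ++ [:: size s]) [::]).
  apply: computable_iter => //; last computable_leaf.
  apply: computable_cat; first computable_leaf.
  apply: computable_cons; last computable_leaf.
  by apply: computable_size; computable_leaf.
apply/funext => x; elim: (n x) => // k IH.
by rewrite iterS -IH size_iota -[k.+1]addn1 iotaD.
Qed.

Lemma computable_nth (X : Type) {cX : code X} (A : Type) {cA : code A} (d : A) (s : X -> seq A) (n : X -> nat) :
  computable s -> computable n -> computable (fun x => nth d (s x) (n x)).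
Proof.
move=> cs cn; rewrite (_ : (fun x => _) = fun x => head d (iter (n x) behead (s x))).
  apply: computable_head; apply: (computable_iter (F := fun=> behead)) => //.
  by apply: computable_behead; computable_leaf.
apply/funext => x; elim: (n x) (s x) => [|k IH] [|e t] //.
  by rewrite iterSr /= -IH nth_nil.
by rewrite iterSr /= -IH.
Qed.

End Lists.

(** * Computable rational arithmetic *)

Section Rationals.

Lemma computable_addq (X : Type) {cX : code X} (f g : X -> rat) :
  computable f -> computable g -> computable (fun x => f x + g x).
Proof.
apply: (computable_op2 (g := fun m n =>
  cell (car m * (cdr (cdr n)).+1 + car n * (cdr (cdr m)).+1)
   (cell (car (cdr m) * (cdr (cdr n)).+1 + car (cdr n) * (cdr (cdr m)).+1)
     ((cdr (cdr m)).+1 * (cdr (cdr n)).+1 - 1))))%N.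
  by recursive_tac.
move=> m n; rewrite /dc/= /rat_of_code !(car_cell, cdr_cell).
move: (car m) (car n) (car (cdr m)) (car (cdr n)) (cdr (cdr m)) (cdr (cdr n)).
move=> a a' b b' d d'; rewrite subn1 prednK ?muln_gt0//.
rewrite !natrD !natrM.
by field; rewrite !nat1r !pnatr_eq0.
Qed.

Lemma computable_oppq (X : Type) {cX : code X} (f : X -> rat) : computable f -> computable (fun x => - f x).
Proof.
apply: (computable_op1 (g := fun m => cell (car (cdr m)) (cell (car m) (cdr (cdr m))))).
  by recursive_tac.
move=> m; rewrite /dc/= /rat_of_code !(car_cell, cdr_cell).
by rewrite -mulNr opprB.
Qed.

Lemma computable_mulq (X : Type) {cX : code X} (f g : X -> rat) :
  computable f -> computable g -> computable (fun x => f x * g x).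
Proof.
apply: (computable_op2 (g := fun m n =>
  cell (car m * car n + car (cdr m) * car (cdr n))
   (cell (car m * car (cdr n) + car (cdr m) * car n)
     ((cdr (cdr m)).+1 * (cdr (cdr n)).+1 - 1))))%N.
  by recursive_tac.
move=> m n; rewrite /dc/= /rat_of_code !(car_cell, cdr_cell).
move: (car m) (car n) (car (cdr m)) (car (cdr n)) (cdr (cdr m)) (cdr (cdr n)).
move=> a a' b b' d d'; rewrite subn1 prednK ?muln_gt0//.
rewrite !natrD !natrM.
by field; rewrite !nat1r !pnatr_eq0.
Qed.

Lemma computable_invq (X : Type) {cX : code X} (f : X -> rat) : computable f -> computable (fun x => (f x)^-1).
Proof.
(* The inverse of (a - b)/(d + 1) has d + 1 on the positive or the negative side of its numerator,
   and denominator |a - b|. For a = b the truncated subtraction leaves 0/1, the conventional inverse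
   of 0. *)
apply: (computable_op1 (g := fun m =>
  cell ((cdr (cdr m)).+1 * nz (car m - car (cdr m)))
   (cell ((cdr (cdr m)).+1 * nz (car (cdr m) - car m))
     ((car m - car (cdr m)) + (car (cdr m) - car m) - 1))))%N.
  by rewrite /nz; recursive_tac.
move=> m; rewrite /dc/= /rat_of_code !(car_cell, cdr_cell) !nzE.
move: (car m) (car (cdr m)) (cdr (cdr m)) => a b d.
rewrite !subn_eq0 -!ltnNge; case: (ltngtP a b) => [ab|ba|->].
- rewrite muln0 muln1 sub0r (eqP (ltnW ab : (a - b)%N == 0)%N) add0n subn1.
  rewrite prednK ?subn_gt0// natrB ?(ltnW ab)// invf_div.
  have : (b%:R - a%:R : rat) != 0 by rewrite subr_eq0 eqr_nat gtn_eqF.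
  have : (a%:R - b%:R : rat) != 0 by rewrite subr_eq0 eqr_nat ltn_eqF.
  by move=> h1 h2; field; rewrite h1 h2.
- rewrite muln0 muln1 subr0 (eqP (ltnW ba : (b - a)%N == 0)%N) addn0 subn1.
  by rewrite prednK ?subn_gt0// natrB ?(ltnW ba)// invf_div.
- by rewrite muln0 !subrr !mul0r invr0.
Qed.

Lemma computable_leq_rat (X : Type) {cX : code X} (f g : X -> rat) :
  computable f -> computable g -> computable (fun x => f x <= g x).
Proof.
apply: (computable_op2 (g := fun m n =>
  1 - ((car m * (cdr (cdr n)).+1 + car (cdr n) * (cdr (cdr m)).+1) -
       (car n * (cdr (cdr m)).+1 + car (cdr m) * (cdr (cdr n)).+1))))%N.
  by recursive_tac.
move=> m n; rewrite /dc/= /rat_of_code.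
move: (car m) (car n) (car (cdr m)) (car (cdr n)) (cdr (cdr m)) (cdr (cdr n)).
move=> a a' b b' d d'.
rewrite ler_pdivrMr ?ltr0n// mulrAC ler_pdivlMr ?ltr0n//.
rewrite -[LHS]/((1 - _)%N != 0%N) subn_eq0 -ltnNge ltnS leqn0 subn_eq0.
rewrite -(ler_nat rat) !natrD !natrM.
by rewrite !mulrBl lerBlDr addrAC lerBrDr.
Qed.

Lemma computable_eqq (X : Type) {cX : code X} (f g : X -> rat) :
  computable f -> computable g -> computable (fun x => f x == g x).
Proof.
move=> cf cg; rewrite (_ : (fun x => _) = fun x => (f x <= g x) && (g x <= f x)).
  by apply: computable_andb; exact: computable_leq_rat.
by apply/funext => x; rewrite eq_le.
Qed.

Lemma computable_ltq (X : Type) {cX : code X} (f g : X -> rat) :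
  computable f -> computable g -> computable (fun x => f x < g x).
Proof.
move=> cf cg; rewrite (_ : (fun x => _) = fun x => ~~ (g x <= f x)).
  by apply: computable_negb; exact: computable_leq_rat.
by apply/funext => x; rewrite ltNge.
Qed.

Lemma computable_natq (X : Type) {cX : code X} (f : X -> nat) :
  computable f -> computable (fun x => (f x)%:R : rat).
Proof.
apply: (computable_op1 (g := fun m => cell m (cell 0 0))).
  by recursive_tac.
move=> m; rewrite /dc/= /rat_of_code !(car_cell, cdr_cell).
by rewrite subr0 divr1.
Qed.

Lemma computable_expq (X : Type) {cX : code X} (f : X -> rat) (n : X -> nat) :
  computable f -> computable n -> computable (fun x => f x ^+ n x).
Proof.
move=> cf cn; rewrite (_ : (fun x => _) = fun x => iter (n x) (fun y => f x * y) 1).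
  apply: computable_iter => //; last computable_leaf.
  by apply: computable_mulq; computable_leaf.
by apply/funext => x; elim: (n x) => // k IH; rewrite exprS IH.
Qed.

Lemma computable_normq (X : Type) {cX : code X} (f : X -> rat) : computable f -> computable (fun x => `|f x|).
Proof.
move=> cf; rewrite (_ : (fun x => _) = fun x => if 0 <= f x then f x else - f x).
  apply: computable_if => //; last exact: computable_oppq.
  by apply: computable_leq_rat => //; computable_leaf.
by apply/funext => x; case: ger0P => // /ltW; rewrite leNgt => /negbTE.
Qed.

Lemma computable_count (X : Type) {cX : code X} (a : X -> rat) (s : X -> seq rat) :
  computable a -> computable s -> computable (fun x => count_mem (a x) (s x)).
Proof.
move=> ca cs; rewrite (_ : (fun x => _) =
  fun x => foldr (fun e n => (if e == a x then 1 else 0) + n)%N 0%N (s x)).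
  apply: computable_foldr => //; last computable_leaf.
  apply: computable_addn; last computable_leaf.
  apply: computable_if; [|computable_leaf|computable_leaf].
  by apply: computable_eqq; computable_leaf.
by apply/funext => x; elim: (s x) => //= e t ->; case: eqP.
Qed.

Lemma computable_perm_eq (X : Type) {cX : code X} (s t : X -> seq rat) :
  computable s -> computable t -> computable (fun x => perm_eq (s x) (t x)).
Proof.
move=> cs ct; rewrite (_ : (fun x => _) = fun x =>
  all (fun e => count_mem e (s x) == count_mem e (t x)) (s x ++ t x)) //.
apply: computable_all; last exact: computable_cat.
by apply: computable_eqn; apply: computable_count; computable_leaf.
Qed.

End Rationals.

(** * Computable polynomial arithmetic *)

Section Polynomials.

Lemma computable_Poly (X : Type) {cX : code X} (s : X -> seq rat) : computable s -> computable (fun x => Poly (s x)).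
Proof. by apply: (computable_op1 (g := id)) => //; exact: recursive1_id. Qed.

(** A coded polynomial is a coefficient list that may end in zeros; this fold strips them, which
    makes the size and the leading coefficient computable. *)
Lemma polyseq_Poly_foldr (s : seq rat) : polyseq (Poly s) =
  foldr (fun c t => if (c == 0) && (size t == 0)%N then [::] else c :: t) [::] s.
Proof.
elim: s => [|c s IH] /=; first by rewrite polyseq0.
rewrite polyseq_cons -IH /nilp polyseqC.
case: (polyseq (Poly s)) => [|d t] /=; last by rewrite andbF.
by rewrite andbT; case: eqP.
Qed.

Lemma computable_polyseq (X : Type) {cX : code X} (f : X -> {poly rat}) : computable f -> computable (fun x => polyseq (f x)).
Proof.
move=> cf; apply: computable_comp cf.
have [h rh hP] : computable (fun s : seq rat =>
  foldr (fun c t => if (c == 0) && (size t == 0)%N then [::] else c :: t) [::] s).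
  apply: computable_foldr; [|computable_leaf|computable_leaf].
  apply: computable_if; [|computable_leaf|by apply: computable_cons; computable_leaf].
  apply: computable_andb; first by apply: computable_eqq; computable_leaf.
  by apply: computable_eqn; [apply: computable_size|]; computable_leaf.
by exists h => // n; rewrite hP -polyseq_Poly_foldr.
Qed.

Lemma computable_coef (X : Type) {cX : code X} (f : X -> {poly rat}) (n : X -> nat) :
  computable f -> computable n -> computable (fun x => (f x)`_(n x)).
Proof. by move=> cf cn; apply: computable_nth => //; exact: computable_polyseq. Qed.

Lemma computable_sizep (X : Type) {cX : code X} (f : X -> {poly rat}) : computable f -> computable (fun x => size (f x)).
Proof. by move=> cf; apply: computable_size; exact: computable_polyseq. Qed.

Lemma computable_addp (X : Type) {cX : code X} (f g : X -> {poly rat}) :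
  computable f -> computable g -> computable (fun x => f x + g x).
Proof.
move=> cf cg; rewrite (_ : (fun x => _) = fun x =>
  Poly (map (fun i => (f x)`_i + (g x)`_i) (iota 0 (size (f x) + size (g x))%N))).
  apply: computable_Poly; apply: computable_map; last first.
    by apply: computable_iota0; apply: computable_addn; exact: computable_sizep.
  by apply: computable_addq; apply: computable_coef; computable_leaf.
apply/funext => x; apply/polyP => i; rewrite coef_Poly coefD.
have [h|h] := ltnP i (size (f x) + size (g x))%N.
  by rewrite (nth_map 0%N) ?size_iota// nth_iota.
have fi : (f x)`_i = 0 by rewrite nth_default// (leq_trans _ h)// leq_addr.
have gi : (g x)`_i = 0 by rewrite nth_default// (leq_trans _ h)// leq_addl.
by rewrite fi gi addr0 nth_default// size_map size_iota.
Qed.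

Lemma computable_scalep (X : Type) {cX : code X} (c : X -> rat) (f : X -> {poly rat}) :
  computable c -> computable f -> computable (fun x => c x *: f x).
Proof.
move=> cc cf; rewrite (_ : (fun x => _) = fun x => Poly (map (fun e => c x * e) (f x))).
  apply: computable_Poly; apply: computable_map; last exact: computable_polyseq.
  by apply: computable_mulq; computable_leaf.
apply/funext => x; apply/polyP => i; rewrite coef_Poly coefZ.
have [h|h] := ltnP i (size (f x)); first by rewrite (nth_map 0).
by rewrite !nth_default ?size_map ?mulr0.
Qed.

Lemma computable_oppp (X : Type) {cX : code X} (f : X -> {poly rat}) : computable f -> computable (fun x => - f x).
Proof.
move=> cf; rewrite (_ : (fun x => _) = fun x => (-1) *: f x).
  by apply: computable_scalep => //; computable_leaf.
by apply/funext => x; rewrite scaleN1r.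
Qed.

Lemma computable_mulp (X : Type) {cX : code X} (f g : X -> {poly rat}) :
  computable f -> computable g -> computable (fun x => f x * g x).
Proof.
move=> cf cg; rewrite (_ : (fun x => _) = fun x =>
  foldr (fun c p => c *: g x + Poly (0 :: polyseq p)) 0 (f x)).
  apply: computable_foldr; [|exact: computable_polyseq|computable_leaf].
  apply: computable_addp.
    by apply: computable_scalep; computable_leaf.
  apply: computable_Poly; apply: computable_cons; first computable_leaf.
  by apply: computable_polyseq; computable_leaf.
apply/funext => x; rewrite -[in LHS](polyseqK (f x)).
elim: (polyseq (f x)) => [|c s IH] /=; first by rewrite mul0r.
rewrite -IH !cons_poly_def polyseqK addr0 mulrDl mul_polyC addrC.
by rewrite mulrAC.
Qed.

Lemma computable_expp (X : Type) {cX : code X} (f : X -> {poly rat}) (n : X -> nat) :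
  computable f -> computable n -> computable (fun x => f x ^+ n x).
Proof.
move=> cf cn; rewrite (_ : (fun x => _) = fun x => iter (n x) (fun y => f x * y) 1).
  apply: computable_iter => //; last computable_leaf.
  by apply: computable_mulp; computable_leaf.
by apply/funext => x; elim: (n x) => // k IH; rewrite exprS IH.
Qed.

Lemma computable_polyC (X : Type) {cX : code X} (c : X -> rat) :
  computable c -> computable (fun x => (c x)%:P).
Proof.
move=> cc; rewrite (_ : (fun x => _) = fun x => Poly [:: c x]).
  by apply: computable_Poly; apply: computable_cons => //; computable_leaf.
by apply/funext => x; rewrite /= cons_poly_def mul0r add0r.
Qed.

Lemma computable_eqp (X : Type) {cX : code X} (f g : X -> {poly rat}) :
  computable f -> computable g -> computable (fun x => f x == g x).
Proof.
move=> cf cg; rewrite (_ : (fun x => _) = fun x => size (f x - g x) == 0%N).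
  apply: computable_eqn; last computable_leaf.
  by apply: computable_sizep; apply: computable_addp => //; exact: computable_oppp.
by apply/funext => x; rewrite size_poly_eq0 subr_eq0.
Qed.

Lemma computable_horner (X : Type) {cX : code X} (f : X -> {poly rat}) (c : X -> rat) :
  computable f -> computable c -> computable (fun x => (f x).[c x]).
Proof.
move=> cf cc; rewrite (_ : (fun x => _) =
  fun x => foldr (fun e y => y * c x + e) 0 (f x)).
  apply: computable_foldr; [|exact: computable_polyseq|computable_leaf].
  apply: computable_addq; last computable_leaf.
  by apply: computable_mulq; computable_leaf.
by apply/funext => x; rewrite /horner; elim: (polyseq (f x)) => //= e s ->.
Qed.

End Polynomials.

Ltac computable_user := fail.

Ltac computable_step := lazy beta; first
  [ computable_leaf
  | computable_user
  | computable_hyp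
  | apply: computable_pair
  | apply: computable_eqq | apply: computable_eqp | apply: computable_eqn
  | apply: computable_andb | apply: computable_orb | apply: computable_negb
  | apply: computable_horner | apply: computable_coef
  | apply: computable_sizep
  | apply: computable_addq | apply: computable_mulq | apply: computable_oppq
  | apply: computable_invq | apply: computable_normq | apply: computable_natq
  | apply: computable_expq
  | apply: computable_addp | apply: computable_mulp | apply: computable_oppp
  | apply: computable_expp | apply: computable_scalep | apply: computable_polyC
  | apply: computable_leq_rat | apply: computable_ltq | apply: computable_leq
  | apply: computable_perm_eq
  | apply: computable_cons | apply: computable_cat | apply: computable_flatten
  | apply: computable_nseq | apply: computable_iota0 | apply: computable_size
  | apply: computable_nth | apply: computable_all | apply: computable_map
  | apply: computable_big | apply: computable_Poly
  | apply: computable_succ | apply: computable_addn | apply: computable_muln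
  | apply: computable_subn
  | apply: computable_if
  | apply: computable_fst | apply: computable_snd ].

Ltac computable_tac := repeat computable_step.

(** * Semidecidability and decision *)

Section Semidecidable.
Variables (X : Type) (cX : code X).
Implicit Types (D P Q : X -> Prop).

(** The domain [D] is a promise: the inputs below are bare data, and only those coming from a
    [hypergeometric] satisfy the conditions on p and q. *)
Definition semidecidable D P := exists2 c : X * nat -> bool, computable c &
  forall x, D x -> (P x <-> exists w, c (x, w)).

(** Every natural number decodes to a certificate, so a search over the numbers is a search over
    [W]. *)
Lemma semidecidable_cert (W : Type) {cW : code W} (c : X * W -> bool) D P :
  computable c -> (forall x, D x -> (P x <-> exists w, c (x, w))) ->
  semidecidable D P.
Proof.
move=> cc cP; exists (fun p => c (p.1, dc p.2)).
  apply: (computable_comp (f := fun p : X * nat => (p.1, dc p.2)) cc).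
  apply: computable_pair; first computable_leaf.
  apply: (computable_comp (g := fun n : nat => dc n : W)).
    by exists id => //; exact: recursive1_id.
  computable_leaf.
move=> x Dx; rewrite (cP _ Dx); split=> [[w cw]|[w cw]]; last by exists (dc w).
by exists (ec w); rewrite /= ecK.
Qed.

(** Post's theorem: find the least w accepted by one of the two checks, and report whether the first
    one accepted it. The search ends because P or its negation holds, by excluded middle. *)
Lemma decidable_of_semidecidable (p : decision_problem) (conv : nat -> X)
  (i : instance p -> X) D P : computable conv ->
  (forall x, conv (encode x) = i x) -> (forall x, D (i x)) ->
  (forall x, holds x <-> P (i x)) ->
  semidecidable D P -> semidecidable D (fun x => ~ P x) ->
  decidable_problem p.
Proof.
move=> [k rk kP] ci Di hP [c1 [g1 r1 g1P] c1P] [c2 [g2 r2 g2P] c2P].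
pose code_of w y := cell (k y) w.
have [t tP] : recursive2 (fun w y =>
    1 - (g1 (code_of w y) + g2 (code_of w y)))%N.
  by rewrite /code_of; recursive_tac.
have [r rP] : recursive2 (fun w y => nz (g1 (code_of w y))).
  by rewrite /code_of /nz; recursive_tac.
exists (RComp r [:: RMin t; RProj 0]) => x.
set y := encode x.
have e1 w : (g1 (code_of w y) != 0)%N = c1 (i x, w).
  transitivity (dc (g1 (code_of w y)) : bool) => //.
  by rewrite g1P dc_pair car_cell cdr_cell kP -ci.
have e2 w : (g2 (code_of w y) != 0)%N = c2 (i x, w).
  transitivity (dc (g2 (code_of w y)) : bool) => //.
  by rewrite g2P dc_pair car_cell cdr_cell kP -ci.
have ex : exists w, c1 (i x, w) || c2 (i x, w).
  have [Px|nPx] := pselect (P (i x)).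
    by have [w cw] := (c1P _ (Di x)).1 Px; exists w; rewrite cw.
  by have [w cw] := (c2P _ (Di x)).1 nPx; exists w; rewrite cw orbT.
have zero_t w : ((1 - (g1 (code_of w y) + g2 (code_of w y)) == 0) =
    (c1 (i x, w) || c2 (i x, w)))%N.
  by rewrite -e1 -e2 subn_eq0 lt0n addn_eq0 negb_and.
pose w := ex_minn ex.
have [cw wmin] : c1 (i x, w) || c2 (i x, w) /\
    forall v, c1 (i x, v) || c2 (i x, v) -> (w <= v)%N.
  by rewrite /w; case: ex_minnP.
exists (c1 (i x, w)).
  rewrite -e1 -nzE; apply: (@eval_comp _ _ _ [:: w; y]); last exact: (rP [:: w; y]).
  apply: evals_cons.
    apply: (@eval_min _ _ _ (fun=> 0%N)) => [j jw|].
      have := tP [:: j; y] erefl; rewrite /=.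
      have : (1 - (g1 (code_of j y) + g2 (code_of j y)) != 0)%N.
        by rewrite zero_t; apply/negP => /wmin; rewrite leqNgt jw.
      by case: (g1 _ + _)%N => //=.
    have := tP [:: w; y] erefl; rewrite /=.
    by rewrite (eqP (etrans (zero_t w) cw)).
  by apply: evals_cons; [exact: eval_proj|exact: evals_nil].
split=> [c1w|/hP Px].
  by apply/hP/(c1P _ (Di x)); exists w.
case/orP: cw => // c2w.
by have := (c2P _ (Di x)).2 (ex_intro _ w c2w) Px.
Qed.

End Semidecidable.

Arguments semidecidable {X cX} D P.

(** * Decoding of instances *)

Section Inputs.

Definition input : Type := ({poly rat} * {poly rat}) * (rat * rat).

Definition input_of (x : hypergeometric * rat) : input :=
  ((hg_p x.1, hg_q x.1), (hg_u0 x.1, x.2)).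

(** Translates the prescribed encoding into [rat_of_code]: the parity of an [int_code] is the sign,
    [Negz n] stands for -(n + 1), and the denominator is stored minus one. *)
Definition decode_rat (n : nat) : rat :=
  rat_of_code (cell ((1 - odd (car n)) * (car n)./2)
    (cell (odd (car n) * (car n)./2.+1) ((car (cdr n))./2 - 1)))%N.

Definition decode_input (n : nat) : input :=
  let l := CodeSeq.decode n in
  ((Poly [seq decode_rat c | c <- CodeSeq.decode (nth 0%N l 0)],
    Poly [seq decode_rat c | c <- CodeSeq.decode (nth 0%N l 1)]),
   (decode_rat (nth 0%N l 2), decode_rat (nth 0%N l 3))).

Lemma decode_ratK (r : rat) : decode_rat (rat_code r) = r.
Proof.
rewrite /decode_rat /rat_code /=.
rewrite -[(2 ^ int_code (numq r) * _)%N]/(cell (int_code (numq r)) (cell (int_code (denq r)) 0)).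
rewrite !(car_cell, cdr_cell) -[RHS]divq_num_den.
have d0 := denq_gt0 r; case: (denq r) d0 => // d d0.
rewrite /rat_of_code !(car_cell, cdr_cell) /= doubleK subn1 prednK//.
congr (_ / _); case: (numq r) => n /=.
  by rewrite odd_double /= mul0n subr0 subn0 mul1n doubleK.
by rewrite odd_double /= subnn mul0n sub0r uphalf_double mul1n NegzE intrN.
Qed.

Lemma decode_inputK (x : hypergeometric * rat) :
  decode_input (encode (d := membership_problem) x) = input_of x.
Proof.
have dp (p : {poly rat}) :
    Poly [seq decode_rat c | c <- CodeSeq.decode (poly_code p)] = p.
  rewrite /poly_code CodeSeq.codeK -map_comp -[RHS]polyseqK; congr Poly.
  by rewrite -[RHS]map_id; apply: eq_map => c /=; exact: decode_ratK.
rewrite /decode_input /= CodeSeq.codeK /= !dp !decode_ratK.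
by rewrite /input_of.
Qed.

Lemma computable_decode_input : computable decode_input.
Proof.
have cr : computable decode_rat.
  exists (fun n => cell ((1 - odd (car n)) * (car n)./2)
    (cell (odd (car n) * (car n)./2.+1) ((car (cdr n))./2 - 1)))%N => //.
  by recursive_tac.
have cd : computable CodeSeq.decode.
  exists id; first exact: recursive1_id.
  by move=> n; rewrite /dc/= map_id.
have cm : computable (fun n => Poly [seq decode_rat c | c <- CodeSeq.decode n]).
  apply: computable_Poly; apply: computable_map => //.
  by apply: (computable_comp cr); computable_tac.
have cn i : computable (fun n => nth 0%N (CodeSeq.decode n) i).
  by apply: computable_nth => //; computable_tac.
by apply: computable_pair; apply: computable_pair;
  [apply: (computable_comp cm)|apply: (computable_comp cm)
  |apply: (computable_comp cr)|apply: (computable_comp cr)].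
Qed.

End Inputs.

(** * The Gamma function *)

Section GammaIntegral.
Variable R : realType.
Implicit Types (x t s : R) (n : nat).
Notation mu := (@lebesgue_measure R).

Definition gamma_fun x t : R := t `^ (x - 1) * expR (- t).

Lemma measurable_gamma_fun x (D : set R) : measurable D ->
  measurable_fun D (EFin \o gamma_fun x).
Proof.
move=> mD; apply/measurable_EFinP; apply: measurable_funM.
  exact: measurable_funTS (measurable_powR _).
apply: measurable_funTS.
have : measurable_fun [set: R] (@expR R \o -%R).
  by apply: measurableT_comp; [exact: measurable_expR|exact: oppr_measurable].
by [].
Qed.

Lemma gamma_fun_ge0 x t : 0 <= gamma_fun x t.
Proof. by rewrite mulr_ge0 ?powR_ge0 ?expR_ge0. Qed.

(** Extended-valued, so that inequalities can be integrated before finiteness is known; [egamma_fin]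
    obtains finiteness from them. *)
Definition egamma x : \bar R :=
  (\int[mu]_(t in `]0%R, +oo[%classic) (gamma_fun x t)%:E)%E.

Lemma egamma_ge0 x : (0 <= egamma x)%E.
Proof. by apply: integral_ge0 => t _; rewrite lee_fin gamma_fun_ge0. Qed.

(** A compact exhaustion of the half-line; the shift by 2 keeps the endpoints strictly ordered. *)
Definition gamma_itv n : set R := `[n.+2%:R^-1, n.+2%:R]%classic.

Lemma gamma_itv_bigcup : \bigcup_n gamma_itv n = `]0%R, +oo[%classic.
Proof.
apply/seteqP; split => [t [n _]|t]; rewrite /gamma_itv/= !in_itv/= ?andbT.
  by case/andP => nt _; apply: lt_le_trans nt; rewrite invr_gt0 ltr0n.
move=> t0; exists (Num.truncn (t + t^-1)) => //; rewrite /gamma_itv/= in_itv/=.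
have h : t + t^-1 < (Num.truncn (t + t^-1)).+2%:R.
  apply: (@lt_trans _ _ (Num.truncn (t + t^-1)).+1%:R); last by rewrite ltr_nat.
  by rewrite truncnS_gt.
have t'0 : 0 < t^-1 by rewrite invr_gt0.
apply/andP; split; last by lra.
rewrite invf_ple ?posrE//; lra.
Qed.

Lemma gamma_itv_nd : nondecreasing_seq gamma_itv.
Proof.
apply/nondecreasing_seqP => n; rewrite subsetEset => t.
rewrite /gamma_itv/= !in_itv/= => /andP[h1 h2]; apply/andP; split.
  by apply: le_trans h1; rewrite lef_pV2 ?posrE ?ltr0n// ler_nat.
by apply: (le_trans h2); rewrite ler_nat.
Qed.

Lemma egamma_cvg x :
  (\int[mu]_(t in gamma_itv n) (gamma_fun x t)%:E)%E @[n --> \oo] --> egamma x.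
Proof.
rewrite /egamma -gamma_itv_bigcup; apply: ge0_nondecreasing_set_cvg_integral.
- exact: gamma_itv_nd.
- by move=> i; exact: measurable_itv.
- by move=> i; apply: measurable_gamma_fun; exact: measurable_itv.
- by move=> i t _; rewrite lee_fin gamma_fun_ge0.
Qed.

Lemma is_derive_gamma_prim x t : 0 < t ->
  is_derive t 1 (fun t => t `^ x * expR (- t))
    (x * gamma_fun x t - gamma_fun (x + 1) t).
Proof.
move=> t0.
have d1 := is_derive1_powR x t0.
have d2 : is_derive t 1 (fun t : R => expR (- t)) (- expR (- t)).
  have dN : is_derive t 1 (fun t : R => - t) (- 1).
    by apply: is_deriveN; exact: is_derive_id.
  by apply: (is_derive_eq (is_derive1_comp _ dN)); rewrite mulrN1.
have h : is_derive t 1 (fun t => t `^ x * expR (- t)) _ := is_deriveM d1 d2.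
apply: (is_derive_eq h).
by rewrite /gamma_fun addrK /GRing.scale /=; ring.
Qed.

Lemma continuous_gamma_fun x t : 0 < t -> {for t, continuous (gamma_fun x)}.
Proof.
move=> t0; apply/differentiable_continuous/derivable1_diffP.
by have := @is_derive_gamma_prim (x - 1) t t0 => -[].
Qed.

Lemma within_continuous_gamma_fun x n :
  {within gamma_itv n, continuous (gamma_fun x)}.
Proof.
apply: continuous_in_subspaceT => t; rewrite inE /gamma_itv/= in_itv/= => /andP[h _].
by apply: continuous_gamma_fun; apply: lt_le_trans h; rewrite invr_gt0 ltr0n.
Qed.

Lemma gamma_itv_lt n : n.+2%:R^-1 < n.+2%:R :> R.
Proof.
apply: (@lt_trans _ _ 1); last by rewrite ltr1n.
by rewrite invf_lt1 ?ltr0n// ltr1n.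
Qed.

Lemma integrable_gamma_fun_itv x n :
  mu.-integrable (gamma_itv n) (fun t => (gamma_fun x t)%:E).
Proof.
apply: continuous_compact_integrable; first exact: segment_compact.
exact: within_continuous_gamma_fun.
Qed.

Definition gamma_bdry x n : R :=
  n.+2%:R `^ x * expR (- n.+2%:R) - n.+2%:R^-1 `^ x * expR (- n.+2%:R^-1).

(** Integration by parts on a compact interval, where all terms are finite; the boundary term is
    sent to 0 afterwards. *)
Lemma gamma_itv_parts x n :
  (x%:E * \int[mu]_(t in gamma_itv n) (gamma_fun x t)%:E =
   \int[mu]_(t in gamma_itv n) (gamma_fun (x + 1) t)%:E +
   (gamma_bdry x n)%:E)%E.
Proof.
pose F t := t `^ x * expR (- t).
pose f t := x * gamma_fun x t - gamma_fun (x + 1) t.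
have pos t : n.+2%:R^-1 <= t -> 0 < t.
  by apply: lt_le_trans; rewrite invr_gt0 ltr0n.
have dF t : n.+2%:R^-1 <= t -> is_derive t 1 F (f t).
  by move/pos; exact: is_derive_gamma_prim.
have cF t : n.+2%:R^-1 <= t -> {for t, continuous F}.
  move=> /dF [h _]; exact/differentiable_continuous/derivable1_diffP.
have := @continuous_FTC2 R f F _ _ (gamma_itv_lt n) _ _ _.
rewrite -EFinB /gamma_bdry => <-.
- rewrite -[`[_, _]%classic]/(gamma_itv n) /f.
  have -> : (\int[mu]_(t in gamma_itv n) (x * gamma_fun x t - gamma_fun (x + 1) t)%:E =
     \int[mu]_(t in gamma_itv n) (x%:E * (gamma_fun x t)%:E) -
     \int[mu]_(t in gamma_itv n) (gamma_fun (x + 1) t)%:E)%E.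
    rewrite -integralB//=.
    * exact: measurable_itv.
    * by apply: (integrableZl _ x (integrable_gamma_fun_itv x n)); exact: measurable_itv.
    * exact: integrable_gamma_fun_itv.
  rewrite integralZl//; [|exact: measurable_itv|exact: integrable_gamma_fun_itv].
  rewrite addeC subeK//; apply/integrable_fin_num; first exact: measurable_itv.
  exact: integrable_gamma_fun_itv.
- apply: continuous_in_subspaceT => t; rewrite inE /gamma_itv/= in_itv/= => /andP[h _].
  apply: cvgB; last exact/continuous_gamma_fun/pos.
  by apply: cvgM; [exact: cvg_cst | exact/continuous_gamma_fun/pos].
- split=> [t|| ].
  + by rewrite in_itv/= => /andP[/ltW/dF[]].
  + by apply: cvg_at_right_filter; exact: cF.
  + by apply: cvg_at_left_filter; apply: cF; exact/ltW/gamma_itv_lt.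
- move=> t; rewrite in_itv/= => /andP[/ltW/dF h _].
  by rewrite derive1E derive_val.
Qed.

Lemma cvg_invSS : n.+2%:R^-1 @[n --> \oo] --> (0 : R).
Proof.
have h := @cvg_harmonic R.
by rewrite -(cvg_shiftS (@harmonic R)) in h.
Qed.

Lemma gamma_tail_cvg0 x : 0 < x ->
  gamma_bdry x n @[n --> \oo] --> (0 : R).
Proof.
move=> x0; rewrite -[X in _ --> X]subr0; apply: cvgB; last first.
  have h : (n.+2%:R^-1 `^ x) @[n --> \oo] --> (0 : R).
    have := powR_cvg0 x0 => /cvg_at_rightP; apply; split.
      by move=> n; rewrite invr_gt0 ltr0n.
    exact: cvg_invSS.
  apply: squeeze_cvgr h; last exact: cvg_cst.
  near=> n; rewrite mulr_ge0 ?powR_ge0 ?expR_ge0//=.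
  by rewrite ler_piMr ?powR_ge0// -expR0 ler_expR oppr_le0.
have [k kx] : exists k : nat, x <= k%:R.
  exists (Num.truncn x).+1; exact/ltW/truncnS_gt.
(* With k >= x, the bound e^y >= y^(k+1)/(k+1)! at y = n + 2 beats y^x by a factor y. *)
have h n : n.+2%:R `^ x * expR (- n.+2%:R) <= k.+1`!%:R * n.+2%:R^-1 :> R.
  have n1 : 1 <= n.+2%:R :> R by rewrite ler1n.
  have n0 : 0 < n.+2%:R :> R by rewrite ltr0n.
  rewrite expRN ler_pdivrMr ?expR_gt0//.
  apply: (@le_trans _ _ (n.+2%:R ^+ k)).
    by rewrite -powR_mulrn// ler_powR.
  have := @expR_ge1Dxn R n.+2%:R k (ltW n0).
  have f0 : 0 < k.+1`!%:R :> R by rewrite ltr0n fact_gt0.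
  move=> h; apply: (@le_trans _ _ (k.+1`!%:R / n.+2%:R * (n.+2%:R ^+ k.+1 / k.+1`!%:R))).
    rewrite exprS le_eqVlt; apply/orP; left; apply/eqP; field.
    by rewrite !gt_eqF.
  apply: ler_wpM2l; first by rewrite divr_ge0// ltW.
  by apply: le_trans h; rewrite lerDr.
apply: (@squeeze_cvgr _ _ _ _ (fun=> 0) (fun n => k.+1`!%:R * n.+2%:R^-1)).
- by near=> n; rewrite h mulr_ge0 ?powR_ge0 ?expR_ge0.
- exact: cvg_cst.
- rewrite -[X in _ --> X](mulr0 k.+1`!%:R); apply: cvgMr.
  exact: cvg_invSS.
Unshelve. all: by end_near. Qed.

Lemma egammaD1 x : 0 < x -> egamma (x + 1) = (x%:E * egamma x)%E.
Proof.
move=> x0.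
have h1 := @cvgeZl _ _ _ _ _ x%:E isT (@egamma_cvg x).
have h2 : (\int[mu]_(t in gamma_itv n) (gamma_fun (x + 1) t)%:E +
   (gamma_bdry x n)%:E)%E @[n --> \oo] --> (egamma (x + 1) + 0%:E)%E.
  apply: cvgeD; [by rewrite fin_num_adde_defl | exact: egamma_cvg |].
  by apply: cvg_EFin; [exact: nearW | exact: gamma_tail_cvg0].
rewrite adde0 in h2.
move: h1; under eq_fun do rewrite gamma_itv_parts.
move=> h1; exact: (cvg_unique _ h2 h1).
Qed.

End GammaIntegral.

(** * Log-convexity and Euler's limit formula *)

Section GammaReal.
Variable R : realType.
Implicit Types (x t s : R) (n : nat).
Notation mu := (@lebesgue_measure R).

Lemma gt0_powRD x t s : 0 < x -> x `^ (t + s) = x `^ t * x `^ s.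
Proof. by move=> x0; rewrite powRD// (gt_eqF x0) implybT. Qed.

Lemma gt0_powRB x t s : 0 < x -> x `^ (t - s) = x `^ t / x `^ s.
Proof. by move=> x0; rewrite powRB// (gt_eqF x0) implybT. Qed.

Lemma egamma1 : egamma (1 : R) = 1%E.
Proof.
have d2 t : is_derive t 1 (fun t : R => - expR (- t)) (expR (- t)).
  have dN : is_derive t 1 (fun t : R => - t) (- 1).
    by apply: is_deriveN; exact: is_derive_id.
  have h : is_derive t 1 (fun t : R => - expR (- t)) _ :=
    is_deriveN (is_derive1_comp (is_derive_expR _) dN).
  by apply: (is_derive_eq h); rewrite mulrN1 opprK.
have cN : continuous (fun t : R => expR (- t)).
  move=> t; apply: continuous_comp; first exact: continuousN.
  exact: continuous_expR.
rewrite /egamma.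
transitivity (\int[mu]_(t in `]0%R, +oo[%classic) (expR (- t))%:E)%E.
  by apply: eq_integral => t _; rewrite /gamma_fun subrr powRr0 mul1r.
rewrite integral_itv_obnd_cbnd; last first.
  apply/measurable_EFinP; apply: measurable_funTS.
  by apply: continuous_measurable_fun; exact: cN.
rewrite (@ge0_continuous_FTC2y R _ (fun t => - expR (- t)) 0 0).
- by rewrite oppr0 expR0 sub0e -EFinN opprK.
- by move=> t _; exact: expR_ge0.
- exact: continuous_subspaceT.
- by rewrite -[X in _ --> X]oppr0; apply: cvgN; exact: cvgr_expR.
- by move=> t _; have [] := d2 t.
- apply: cvg_at_right_filter; apply: cvgN; exact: cN.
- by move=> t _; rewrite derive1E; have [_ ->] := d2 t.
Qed.

(* The concave function t ^ s lies below its tangent at [l]. *)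
Lemma young_powR (l t s : R) : 0 < l -> 0 < t -> 0 <= s <= 1 ->
  t `^ s <= (1 - s) * l `^ s + s * l `^ (s - 1) * t.
Proof.
move=> l0 t0 /andP[s0 s1].
pose y := ln (t / l).
have tl : 0 < t / l by rewrite divr_gt0.
have ey : expR y = t / l by rewrite lnK.
(* In the variable y the claim is e^(sy) <= 1 - s + s e^y. Take e^z >= 1 + z at z = -sy with weight
   1 - s and at z = (1-s)y with weight s: the right sides add up to 1. Then multiply by e^(sy). *)
have h1 : expR (s * y) <= (1 - s) + s * expR y.
  have a1 := expR_ge1Dx (- (s * y)).
  have a2 := expR_ge1Dx ((1 - s) * y).
  have e1 : expR y = expR (s * y) * expR ((1 - s) * y).
    by rewrite -expRD; congr expR; ring.
  have e2 : expR (s * y) * expR (- (s * y)) = 1 by rewrite expRN divff// gt_eqF ?expR_gt0.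
  have p := expR_gt0 (s * y).
  have : expR (s * y) * 1 <= expR (s * y) * ((1 - s) * expR (- (s * y)) + s * expR ((1 - s) * y)).
    rewrite ler_pM2l//.
    apply: (@le_trans _ _ ((1 - s) * (1 - s * y) + s * (1 + (1 - s) * y))); first by lra.
    by apply: lerD; apply: ler_wpM2l => //; rewrite subr_ge0.
  by rewrite mulr1 mulrDr mulrCA e2 mulr1 (mulrCA _ s) -e1.
have -> : t `^ s = l `^ s * expR (s * y).
  have -> : expR (s * y) = (t / l) `^ s by rewrite /powR gt_eqF.
  by rewrite -powRM ?ltW// mulrC divfK// gt_eqF.
apply: (@le_trans _ _ (l `^ s * (1 - s + s * expR y))).
  by rewrite ler_wpM2l// powR_ge0.
rewrite ey gt0_powRB//.
rewrite powRr1; last exact: ltW.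
rewrite le_eqVlt; apply/orP; left; apply/eqP; field.
by rewrite gt_eqF.
Qed.

(** The tangent bound is integrated with the tangent taken at l = x, so that Gamma(x+1) = x Gamma(x)
    makes the two terms add up to x^s Gamma(x). This is log-convexity in Wendel's form; the
    asymptotics of Gamma below rest on it. *)
Lemma egammaDle x s : 0 < x -> 0 <= s <= 1 ->
  (egamma (x + s) <= (x `^ s)%:E * egamma x)%E.
Proof.
move=> x0 s01; have /andP[s0 s1] := s01.
set a := (1 - s) * x `^ s; set b := s * x `^ (s - 1).
have a0 : 0 <= a by rewrite mulr_ge0 ?powR_ge0// subr_ge0.
have b0 : 0 <= b by rewrite mulr_ge0 ?powR_ge0.
have mD : measurable (`]0%R, +oo[%classic : set R) by exact: measurable_itv.
apply: (@le_trans _ _ (\int[mu]_(t in `]0%R, +oo[%classic)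
   (a%:E * (gamma_fun x t)%:E + b%:E * (gamma_fun (x + 1) t)%:E))%E).
  apply: ge0_le_integral => //.
  - by move=> t _; rewrite lee_fin gamma_fun_ge0.
  - exact: measurable_gamma_fun.
  - apply: emeasurable_funD; apply: measurable_funeM; exact: measurable_gamma_fun.
  - move=> t; rewrite /= in_itv/= andbT => t0.
    rewrite -!EFinM -EFinD lee_fin /gamma_fun addrK.
    have -> : t `^ (x + s - 1) = t `^ s * t `^ (x - 1).
      by rewrite -gt0_powRD//; congr powR; ring.
    have -> : t `^ x = t * t `^ (x - 1).
      by rewrite -[X in X * _]powRr1 ?ltW// -gt0_powRD//;
         congr powR; ring.
    have := young_powR x0 t0 s01; rewrite -/a -/b => h.
    rewrite !mulrA -!mulrDl -!mulrA.
    apply: ler_wpM2r; first by rewrite mulr_ge0 ?powR_ge0 ?expR_ge0.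
    by move: h; rewrite /b !mulrA.
rewrite ge0_integralD//=; last 4 first.
- by move=> t _; rewrite mule_ge0// lee_fin gamma_fun_ge0.
- by apply: measurable_funeM; exact: measurable_gamma_fun.
- by move=> t _; rewrite mule_ge0// lee_fin gamma_fun_ge0.
- by apply: measurable_funeM; exact: measurable_gamma_fun.
rewrite !ge0_integralZl//=; try by [exact: measurable_gamma_fun |
  move=> t _; rewrite lee_fin gamma_fun_ge0].
rewrite -/(egamma x) -/(egamma (x + 1)) egammaD1// muleA -EFinM.
rewrite -ge0_muleDl ?lee_fin//; last by rewrite mulr_ge0// ltW.
rewrite lee_wpmul2r ?egamma_ge0// -EFinD lee_fin.
rewrite /a /b gt0_powRB//.
rewrite powRr1; last exact: ltW.
rewrite le_eqVlt; apply/orP; left; apply/eqP; field.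
by rewrite gt_eqF.
Qed.

Lemma egamma_nat n : egamma (n.+1%:R : R) = (n`!%:R)%:E.
Proof.
elim: n => [|n IH]; first by rewrite egamma1.
by rewrite -natr1 egammaD1// IH -EFinM -natrM -factS.
Qed.

Lemma truncn_bounds x : 0 <= x ->
  0 <= x - (Num.truncn x)%:R <= 1.
Proof.
move=> x0; have /andP[h1 h2] := truncn_itv x0.
by rewrite -natr1 in h2; apply/andP; split; lra.
Qed.

(** For x = n + s the preceding inequality bounds Gamma(x+1) by (n+1)^s n!, and Gamma(x+1) = x
    Gamma(x) with x > 0 carries finiteness back to x. *)
Lemma egamma_fin x : 0 < x -> egamma x \is a fin_num.
Proof.
move=> x0.
have h : (egamma (x + 1) < +oo)%E.
  have := truncn_bounds (ltW x0).
  set n := Num.truncn x; set s := x - n%:R => s01.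
  have -> : x + 1 = n.+1%:R + s by rewrite /s -natr1; ring.
  apply: le_lt_trans (egammaDle (ltr0Sn _ n) s01) _.
  by rewrite egamma_nat -EFinM ltry.
rewrite egammaD1// in h.
rewrite ge0_fin_numE ?egamma_ge0//.
move: h (egamma_ge0 x); case: (egamma x) => [r|h|//] _; first by rewrite ltry.
by rewrite gt0_muley ?lte_fin in h.
Qed.

(** A zero at x = n + s would force Gamma(n+2) <= (x+1)^(1-s) Gamma(x+1) = 0, against (n+1)! > 0. *)
Lemma egamma_gt0 x : 0 < x -> (0 < egamma x)%E.
Proof.
move=> x0; rewrite lt_neqAle egamma_ge0 andbT; apply/eqP => e0.
have := truncn_bounds (ltW x0).
set n := Num.truncn x; set s := x - n%:R => /andP[s0 s1].
have := @egammaDle (x + 1) (1 - s) (ltr_wpDl (ltW x0) ltr01).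
rewrite subr_ge0 s1/= gerBl s0 => /(_ isT).
have -> : x + 1 + (1 - s) = n.+2%:R by rewrite /s -!natr1; ring.
by rewrite egammaD1// -e0 !mule0 egamma_nat lee_fin leNgt ltr0n fact_gt0.
Qed.

Lemma Gamma_integralE x : Gamma_integral x = fine (egamma x).
Proof. by []. Qed.

Lemma Gamma_integral_gt0 x : 0 < x -> 0 < Gamma_integral x.
Proof.
move=> x0; rewrite Gamma_integralE fine_gt0// egamma_gt0//=.
by have := egamma_fin x0; rewrite fin_numE => /andP[_]; rewrite lt_neqAle leey andbT.
Qed.

Lemma Gamma_integralD1 x : 0 < x -> Gamma_integral (x + 1) = x * Gamma_integral x.
Proof. by move=> x0; rewrite !Gamma_integralE egammaD1// fineM ?egamma_fin. Qed.

Lemma Gamma_integral1 : Gamma_integral (1 : R) = 1.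
Proof. by rewrite Gamma_integralE egamma1. Qed.

Lemma Gamma_integralDle x s : 0 < x -> 0 <= s <= 1 ->
  Gamma_integral (x + s) <= x `^ s * Gamma_integral x.
Proof.
move=> x0 s01; rewrite !Gamma_integralE.
have xs : 0 < x + s by case/andP: s01 => ? _; apply: ltr_wpDr.
have := egammaDle x0 s01.
by rewrite -(fineK (egamma_fin x0)) -(fineK (egamma_fin xs)) -EFinM lee_fin.
Qed.

(** Its convergence to 1 is Euler's limit formula for Gamma(x), once Gamma(n+x) is unfolded by the
    functional equation. For the finitely many n with n + x <= 0 the value carries no meaning. *)
Definition Gamma_ratio x n : R :=
  Gamma_integral (n%:R + x) / (Gamma_integral n%:R * n%:R `^ x).

Lemma cvg_invn : n%:R^-1 @[n --> \oo] --> (0 : R).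
Proof.
have h := @cvg_harmonic R.
by rewrite (cvg_shiftS (fun n => n%:R^-1 : R)) in h.
Qed.

Lemma cvg_natDdiv x : (n%:R + x) / n%:R @[n --> \oo] --> (1 : R).
Proof.
have h : 1 + x * n%:R^-1 @[n --> \oo] --> (1 + x * 0 : R).
  by apply: cvgD; [exact: cvg_cst|apply: cvgMr; exact: cvg_invn].
rewrite mulr0 addr0 in h; apply: cvg_trans h.
apply: near_eq_cvg; near=> n.
have n0 : 0 < n%:R :> R by near: n; exact: nbhs_infty_gtr.
by field; rewrite gt_eqF.
Unshelve. all: by end_near. Qed.

Lemma cvg_natDdivV x : n%:R / (n%:R + x) @[n --> \oo] --> (1 : R).
Proof.
rewrite -[X in _ --> X]invr1.
under eq_fun do rewrite -invf_div.
by apply: cvgV; [rewrite oner_eq0|exact: cvg_natDdiv].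
Qed.

Lemma Gamma_ratioS x n : 0 < n%:R + x -> 0 < n%:R :> R ->
  Gamma_ratio (x + 1) n = Gamma_ratio x n * ((n%:R + x) / n%:R).
Proof.
rewrite /Gamma_ratio; move: (n%:R : R) => y yx y0.
rewrite addrA Gamma_integralD1// gt0_powRD// powRr1; last exact: ltW.
have := Gamma_integral_gt0 y0; have := powR_gt0 x y0.
move: (y `^ x) (Gamma_integral y) => a b a0 b0.
by field; rewrite !gt_eqF.
Qed.

Lemma Gamma_ratio_cvgS x :
  Gamma_ratio x n @[n --> \oo] --> (1 : R) -> Gamma_ratio (x + 1) n @[n --> \oo] --> (1 : R).
Proof.
move=> h; have h2 : Gamma_ratio x n * ((n%:R + x) / n%:R) @[n --> \oo] --> (1 * 1 : R).
  exact: cvgM h (cvg_natDdiv x).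
rewrite mul1r in h2; apply: cvg_trans h2.
apply: near_eq_cvg; near=> n.
rewrite Gamma_ratioS//; last by near: n; exact: nbhs_infty_gtr.
by rewrite -ltrBlDr sub0r; near: n; exact: nbhs_infty_gtr.
Unshelve. all: by end_near. Qed.

Lemma Gamma_ratio_cvgP x :
  Gamma_ratio (x + 1) n @[n --> \oo] --> (1 : R) -> Gamma_ratio x n @[n --> \oo] --> (1 : R).
Proof.
move=> h; have h2 : Gamma_ratio (x + 1) n * (n%:R / (n%:R + x)) @[n --> \oo] --> (1 * 1 : R).
  exact: cvgM h (cvg_natDdivV x).
rewrite mul1r in h2; apply: cvg_trans h2.
apply: near_eq_cvg; near=> n.
have nx : 0 < n%:R + x.
  by rewrite -ltrBlDr sub0r; near: n; exact: nbhs_infty_gtr.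
have n0 : 0 < n%:R :> R by near: n; exact: nbhs_infty_gtr.
by rewrite /= Gamma_ratioS//; field; rewrite !gt_eqF.
Unshelve. all: by end_near. Qed.

(** The upper bound is log-convexity from y to y + s. The lower one applies it from y + s to y + 1,
    together with r^(1-s) >= r for r = y/(y+s) <= 1. *)
Lemma Gamma_ratio_bounds s y : 0 <= s <= 1 -> 0 < y ->
  y / (y + s) <= Gamma_integral (y + s) / (Gamma_integral y * y `^ s) <= 1.
Proof.
move=> s01 y0; have /andP[s0 s1] := s01.
have ys : 0 < y + s by apply: ltr_wpDr.
have G0 := Gamma_integral_gt0 y0.
have P0 := powR_gt0 s y0.
have GP0 : 0 < Gamma_integral y * y `^ s by exact: mulr_gt0.
apply/andP; split; last first.
  by rewrite ler_pdivrMr// mul1r mulrC Gamma_integralDle.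
have := @Gamma_integralDle (y + s) (1 - s) ys.
rewrite subr_ge0 s1/= gerBl s0 => /(_ isT).
have -> : y + s + (1 - s) = y + 1 by ring.
rewrite Gamma_integralD1// => h.
rewrite ler_pdivlMr//.
have q0 : 0 < (y + s) `^ (1 - s) by rewrite powR_gt0.
rewrite -(ler_pM2l q0); apply: le_trans h.
have e1 : y `^ (1 - s) * y `^ s = y.
  by rewrite -gt0_powRD// subrK powRr1// ltW.
have e2 : y `^ (1 - s) = (y + s) `^ (1 - s) * (y / (y + s)) `^ (1 - s).
  rewrite -powRM; [|exact: ltW|by rewrite ltW// divr_gt0].
  by rewrite mulrC divfK// gt_eqF.
rewrite -[X in _ <= X * _]e1 e2.
set A := (y + s) `^ (1 - s); set B := _ `^ (1 - s).
rewrite [X in _ <= X](_ : _ = A * (B * (Gamma_integral y * y `^ s))); last by ring.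
rewrite ler_pM2l// ler_pM2r//.
apply: ger1_powR; last by rewrite gerBl.
by rewrite divr_gt0//= ler_pdivrMr// mul1r lerDl.
Qed.

Lemma Gamma_ratio_cvg01 s : 0 <= s <= 1 -> Gamma_ratio s n @[n --> \oo] --> (1 : R).
Proof.
move=> s01; apply: (@squeeze_cvgr _ _ _ _ (fun n => n%:R / (n%:R + s)) (fun=> 1));
  [|exact: cvg_natDdivV|exact: cvg_cst].
near=> n; apply: Gamma_ratio_bounds => //.
by near: n; exact: nbhs_infty_gtr.
Unshelve. all: by end_near. Qed.

(** Shifting x by 1 multiplies the ratio by (n+x)/n, which tends to 1, so all x are reached from the
    interval [0, 1]. *)
Lemma Gamma_ratio_cvg x : Gamma_ratio x n @[n --> \oo] --> (1 : R).
Proof.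
have pos k s : 0 <= s <= 1 -> Gamma_ratio (s + k%:R) n @[n --> \oo] --> (1 : R).
  elim: k => [|k IH] s01; first by rewrite addr0; exact: Gamma_ratio_cvg01.
  by rewrite -natr1 addrA; apply: Gamma_ratio_cvgS; exact: IH.
have [x0|/ltW x0] := leP 0 x.
  have := pos (Num.truncn x) _ (truncn_bounds x0).
  by rewrite subrK.
have neg k : 0 <= x + k%:R -> Gamma_ratio x n @[n --> \oo] --> (1 : R).
  have gen j : Gamma_ratio (x + j%:R) n @[n --> \oo] --> (1 : R) ->
      Gamma_ratio x n @[n --> \oo] --> (1 : R).
    elim: j => [|j IH]; first by rewrite addr0.
    by rewrite -natr1 addrA => /Gamma_ratio_cvgP.
  move=> xk; apply: (gen k); have := pos (Num.truncn (x + k%:R)) _ (truncn_bounds xk).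
  by rewrite subrK.
apply: (neg (Num.truncn (- x)).+1).
by have := truncnS_gt (- x) => h; lra.
Qed.

Lemma Gamma_integral_prod x k n : 0 < x + k%:R ->
  Gamma_integral (x + (k + n)%:R) =
  Gamma_integral (x + k%:R) * \prod_(i < n) (x + (k + i)%:R).
Proof.
move=> xk; elim: n => [|n IH]; first by rewrite addn0 big_ord0 mulr1.
rewrite addnS -natr1 addrA Gamma_integralD1 ?IH; last first.
  by rewrite natrD addrA; apply: ltr_wpDr.
by rewrite big_ord_recr/=; ring.
Qed.

(** Replaces the least shift of the definition by any sufficient one: enlarging k multiplies
    numerator and denominator by the same factors. *)
Lemma GammaE x k : (forall i : nat, x + i%:R != 0) -> 0 < x + k%:R ->
  Gamma x = Gamma_integral (x + k%:R) / \prod_(i < k) (x + i%:R).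
Proof.
move=> xi xk; rewrite /Gamma; set k0 := (if _ then _ else _).
have k0P : 0 < x + k0%:R.
  rewrite /k0; case: ifP => [|_]; first by rewrite addr0.
  by have := truncnS_gt (- x) => h; lra.
have k0k : (k0 <= k)%N.
  rewrite /k0; case: ifPn => //; rewrite -leNgt => x0.
  have h : (Num.truncn (- x))%:R <= - x by rewrite truncn_le; lra.
  by rewrite -(ltr_nat R); lra.
rewrite -(subnKC k0k) Gamma_integral_prod//.
have h : \prod_(i < k0 + (k - k0)) (x + i%:R) =
  \prod_(i < k0) (x + i%:R) * \prod_(i < k - k0) (x + (k0 + i)%:R).
  by rewrite big_split_ord.
rewrite h; field.
by apply/andP; split; apply/prodf_neq0 => i _; exact: xi.
Qed.

Lemma Gamma_neq0 x : (forall i : nat, x + i%:R != 0) -> Gamma x != 0.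
Proof.
move=> xi; have h : 0 < x + (Num.truncn (- x)).+1%:R.
  by have := truncnS_gt (- x) => h; lra.
rewrite (GammaE xi h) mulf_neq0//; first by rewrite gt_eqF// Gamma_integral_gt0.
by rewrite invr_eq0; apply/prodf_neq0 => i _; exact: xi.
Qed.

Lemma Gamma1 : Gamma (1 : R) = 1.
Proof. by rewrite /Gamma ltr01 addr0 big_ord0 divr1 Gamma_integral1. Qed.

Lemma GammaD1 x : (forall i : nat, x + i%:R != 0) -> Gamma (x + 1) = x * Gamma x.
Proof.
move=> xi; have xi1 (i : nat) : x + 1 + i%:R != 0.
  by rewrite -addrA nat1r; exact: xi.
have h : 0 < x + (Num.truncn (- x)).+1%:R.
  by have := truncnS_gt (- x) => h; lra.
set k := (Num.truncn (- x)).+1 in h.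
have h1 : 0 < x + 1 + k%:R by lra.
have h2 : 0 < x + k.+1%:R by rewrite -nat1r addrA.
rewrite (GammaE xi1 h1) (GammaE xi h2) big_ord_recl/= addr0.
have -> : x + k.+1%:R = x + 1 + k%:R by rewrite -nat1r addrA.
have -> : \prod_(i < k) (x + (bump 0 i)%:R) = \prod_(i < k) (x + 1 + i%:R).
  by apply: eq_bigr => i _; rewrite /bump leq0n -nat1r addrA.
field; apply/andP; split; first by apply/prodf_neq0 => i _; exact: xi1.
by have := xi 0%N; rewrite addr0.
Qed.

End GammaReal.

(** * Euler's sine product and the reflection formula *)

Section SineProduct.
Variable R : realType.
Implicit Types (x t : R) (n m k : nat).
Notation mu := (@lebesgue_measure R).

Definition quarter_int (f : R -> R) : R :=
  \int[mu]_(t in `[0%R, pi / 2]%classic) f t.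

Lemma pihalf_gt0 : 0 < pi / 2 :> R.
Proof. by rewrite divr_gt0// pi_gt0. Qed.

Lemma quarter_integrable (f : R -> R) : continuous f ->
  mu.-integrable `[0%R, pi / 2]%classic (EFin \o f).
Proof.
move=> cf; apply: continuous_compact_integrable; first exact: segment_compact.
exact: continuous_subspaceT.
Qed.

Lemma quarter_intZ (a : R) (f : R -> R) : continuous f ->
  quarter_int (fun t => a * f t) = a * quarter_int f.
Proof.
by move=> cf; rewrite /quarter_int RintegralZl//; exact: quarter_integrable.
Qed.

Lemma quarter_intB (f g : R -> R) : continuous f -> continuous g ->
  quarter_int (fun t => f t - g t) = quarter_int f - quarter_int g.
Proof.
by move=> cf cg; rewrite /quarter_int RintegralB//; exact: quarter_integrable.
Qed.

Lemma quarter_int_le (f g : R -> R) : continuous f -> continuous g ->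
  (forall t, 0 <= t <= pi / 2 -> f t <= g t) -> quarter_int f <= quarter_int g.
Proof.
move=> cf cg fg; apply: le_Rintegral => //; exact: quarter_integrable.
Qed.

Lemma quarter_int_derive (F f : R -> R) : continuous f ->
  (forall t, is_derive t 1 F (f t)) -> quarter_int f = F (pi / 2) - F 0.
Proof.
move=> cf dF; rewrite /quarter_int /Rintegral.
have cF : continuous F.
  by move=> t; apply/differentiable_continuous/derivable1_diffP; case: (dF t).
rewrite (@continuous_FTC2 R f F 0 (pi / 2) pihalf_gt0)//.
- exact: continuous_subspaceT.
- split=> [t _|| ]; first by case: (dF t).
  + by apply: cvg_at_right_filter; exact: cF.
  + by apply: cvg_at_left_filter; exact: cF.
- by move=> t _; rewrite derive1E; case: (dF t).
Qed.

(* The recurrence of these integrals in [n], compared with that for x = 0, yields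
   the product formula of the sine. *)
Definition wallis x n : R := quarter_int (fun t => cos (2 * x * t) * cos t ^+ n).

Lemma is_derive_lin (a t : R) : is_derive t 1 (fun t => a * t) a.
Proof.
have h : is_derive t 1 (fun t => a * t) _ := is_deriveZ a (is_derive_id t 1).
by apply: (is_derive_eq h); rewrite /GRing.scale/= mulr1.
Qed.

Lemma is_derive_coslin (a t : R) :
  is_derive t 1 (fun t => cos (a * t)) (- sin (a * t) * a).
Proof. exact: (is_derive1_comp (is_derive_cos _) (is_derive_lin a t)). Qed.

Lemma is_derive_sinlin (a t : R) :
  is_derive t 1 (fun t => sin (a * t)) (cos (a * t) * a).
Proof. exact: (is_derive1_comp (is_derive_sin _) (is_derive_lin a t)). Qed.

Lemma is_derive_cosX n t :
  is_derive t 1 (fun t => cos t ^+ n.+1) (- (n.+1%:R * cos t ^+ n * sin t)).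
Proof.
have h := is_deriveX n.+1 (is_derive_cos t).
rewrite (_ : cos ^+ n.+1 = fun t => cos t ^+ n.+1) in h; last first.
  by apply/funext => y; rewrite exprfctE.
by apply: (is_derive_eq h); rewrite /GRing.scale/= mulrN.
Qed.

Lemma continuous_coslin (a : R) : continuous (fun t : R => cos (a * t)).
Proof.
move=> t; apply/differentiable_continuous/derivable1_diffP.
by case: (is_derive_coslin a t).
Qed.

Lemma continuous_cosX n : continuous (fun t : R => cos t ^+ n).
Proof. move=> t; exact: (continuous_comp (@continuous_cos R t) (@exprn_continuous R n _)). Qed.

Lemma continuous_wallis x n :
  continuous (fun t => cos (2 * x * t) * cos t ^+ n).
Proof. move=> t; apply: cvgM; [exact: continuous_coslin|exact: continuous_cosX]. Qed.

(** Two integrations by parts in one: [h] is the derivative of [H], and [H] vanishes at 0 because of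
    the sines and at pi/2 because of the powers of the cosine. *)
Lemma wallis_rec x n :
  (n.+2%:R ^+ 2 - 4 * x ^+ 2) * wallis x n.+2 = n.+2%:R * n.+1%:R * wallis x n.
Proof.
pose f t := cos (2 * x * t).
pose g t := sin (2 * x * t).
pose H t := n.+2%:R * (f t * (cos t ^+ n.+1 * sin t)) - 2 * x * (g t * cos t ^+ n.+2).
pose h t := (n.+2%:R ^+ 2 - 4 * x ^+ 2) * (f t * cos t ^+ n.+2) -
            n.+2%:R * n.+1%:R * (f t * cos t ^+ n).
have cw k : continuous (fun t => f t * cos t ^+ k) by exact: continuous_wallis.
have dH t : is_derive t 1 H (h t).
  have d1 := is_derive_coslin (2 * x) t.
  have d2 := is_derive_sinlin (2 * x) t.
  have d3 := is_derive_cosX n t.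
  have d4 := is_derive_cosX n.+1 t.
  have d5 := is_derive_sin t.
  have e1 : is_derive t 1 (fun t => cos t ^+ n.+1 * sin t) _ := is_deriveM d3 d5.
  have e2 : is_derive t 1 (fun t => f t * (cos t ^+ n.+1 * sin t)) _ := is_deriveM d1 e1.
  have e3 : is_derive t 1 (fun t => g t * cos t ^+ n.+2) _ := is_deriveM d2 d4.
  have e4 : is_derive t 1 (fun t => n.+2%:R * (f t * (cos t ^+ n.+1 * sin t))) _ :=
    is_deriveZ n.+2%:R e2.
  have e5 : is_derive t 1 (fun t => 2 * x * (g t * cos t ^+ n.+2)) _ :=
    is_deriveZ (2 * x) e3.
  have e6 : is_derive t 1 H _ := is_deriveB e4 e5.
  apply: (is_derive_eq e6); rewrite /GRing.scale/= /h /f /g.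
  have s2 := sin2cos2 t.
  set S := sin t in s2 *; set C := cos t in s2 *.
  set F := cos _; set G := sin _; rewrite !exprS.
  set N := C ^+ n.
  have e : S * S = 1 - C * C by rewrite -!expr2.
  rewrite -!natr1.
  transitivity ((n%:R + 1 + 1) * (F * (C * N * C - (n%:R + 1) * N * (S * S)))
     - 2 * x * (F * (2 * x) * (C * (C * N)))); first by ring.
  by rewrite e; ring.
have ch : continuous h.
  by move=> t; apply: cvgB; apply: cvgM; [exact: cvg_cst|exact: cw|exact: cvg_cst|exact: cw].
have := quarter_int_derive ch dH.
rewrite /h quarter_intB; last 2 first.
- by move=> t; apply: cvgM; [exact: cvg_cst|exact: cw].
- by move=> t; apply: cvgM; [exact: cvg_cst|exact: cw].
rewrite !quarter_intZ; [|exact: cw|exact: cw].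
rewrite /H /g cos_pihalf !exprS !mul0r mulr0 sin0 !mulr0 sin0 mul0r !mulr0 !subr0.
by move/eqP; rewrite subr_eq0 => /eqP.
Qed.

Lemma wallis0 n : wallis 0 n = quarter_int (fun t => cos t ^+ n).
Proof.
rewrite /wallis; congr quarter_int; apply/funext => t.
by rewrite mulr0 mul0r cos0 mul1r.
Qed.

Lemma wallis00 : wallis 0 0 = pi / 2.
Proof.
rewrite wallis0 (@quarter_int_derive id)//; first by rewrite subr0.
by move=> t; exact: cvg_cst.
Qed.

Lemma wallisx0 x : x != 0 -> wallis x 0 = sin (pi * x) / (2 * x).
Proof.
move=> x0.
have x20 : 2 * x != 0 by rewrite mulf_neq0// pnatr_eq0.
have -> : wallis x 0 = (2 * x)^-1 * sin (2 * x * (pi / 2)) - (2 * x)^-1 * sin (2 * x * 0).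
  apply: (@quarter_int_derive (fun t => (2 * x)^-1 * sin (2 * x * t))); last first.
  move=> t; have h : is_derive t 1 (fun t => (2 * x)^-1 * sin (2 * x * t)) _ :=
    is_deriveZ (2 * x)^-1 (is_derive_sinlin (2 * x) t).
  apply: (is_derive_eq h); rewrite /GRing.scale/= expr0 mulr1.
  by rewrite mulrCA mulVf// mulr1.
  exact: continuous_wallis.
rewrite mulr0 sin0 mulr0 subr0 mulrC; congr (sin _ / _).
by field.
Qed.

Lemma wallis0_gt0 m : 0 < wallis 0 m.*2.
Proof.
elim: m => [|m IH]; first by rewrite wallis00 pihalf_gt0.
have := wallis_rec 0 m.*2; rewrite expr0n/= mulr0 subr0 doubleS => h.
have p : 0 < m.*2.+2%:R ^+ 2 :> R by rewrite exprn_gt0.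
by rewrite -(pmulr_rgt0 _ p) h mulr_gt0// mulr_gt0.
Qed.

(** Dividing the recurrence by its case x = 0 leaves the factor 1 - 4x^2/(2k+2)^2 at each step. *)
Lemma wallis_ratio_prod x m :
  wallis x 0 / wallis 0 0 =
  \prod_(k < m) (1 - x ^+ 2 / k.+1%:R ^+ 2) * (wallis x m.*2 / wallis 0 m.*2).
Proof.
elim: m => [|m ->]; first by rewrite big_ord0 mul1r.
rewrite big_ord_recr/= -mulrA; congr (_ * _).
have h1 := wallis_rec x m.*2.
have h2 := wallis_rec 0 m.*2; rewrite expr0n/= mulr0 subr0 in h2.
have p1 := wallis0_gt0 m; have p2 := wallis0_gt0 m.+1.
rewrite doubleS in p2 *.
set a := wallis x m.*2 in h1 *; set b := wallis x _ in h1 *.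
set c := wallis 0 m.*2 in h2 p1 *; set d := wallis 0 _ in h2 p2 *.
have n1 : m.*2.+1%:R != 0 :> R by rewrite pnatr_eq0.
have n2 : m.*2.+2%:R != 0 :> R by rewrite pnatr_eq0.
have -> : a = (m.*2.+2%:R ^+ 2 - 4 * x ^+ 2) * b / (m.*2.+2%:R * m.*2.+1%:R).
  by rewrite h1; field; apply/andP.
have -> : c = m.*2.+2%:R ^+ 2 * d / (m.*2.+2%:R * m.*2.+1%:R).
  by rewrite h2; field; apply/andP.
have e : m.*2.+2%:R = 2 * m.+1%:R :> R by rewrite -natrM mul2n doubleS.
rewrite e in n2 *.
have m1 : m.+1%:R != 0 :> R by rewrite pnatr_eq0.
move: (m.*2.+1%:R) (m.+1%:R) n1 m1 => u v u0 v0.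
by field; rewrite u0 v0 (gt_eqF p2).
Qed.

Lemma norm_sin_le t : `|sin t| <= `|t|.
Proof.
have pos (s : R) : 0 <= s -> `|sin s| <= s.
  move=> s0; have [c _] := @MVT_segment R sin cos 0 s s0
    (fun y _ => is_derive_sin y) (continuous_subspaceT (@continuous_sin R)).
  rewrite sin0 !subr0 => ->; rewrite normrM (ger0_norm s0).
  by rewrite ler_piMl// cos_max.
have [t0|/ltW t0] := leP 0 t; first by rewrite (ger0_norm t0) pos.
by rewrite -normrN -sinN (ler0_norm t0) pos// oppr_ge0.
Qed.

Lemma mul_cos_le_sin t : 0 <= t <= pi / 2 -> t * cos t <= sin t.
Proof.
move=> /andP[t0 tp].
have d (y : R) : is_derive y 1 (fun y => sin y - y * cos y) (y * sin y).
  have d1 : is_derive y 1 (fun y => y * cos y) _ :=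
    is_deriveM (is_derive_id y 1) (is_derive_cos y).
  have h : is_derive y 1 (fun y => sin y - y * cos y) _ :=
    is_deriveB (is_derive_sin y) d1.
  by apply: (is_derive_eq h); rewrite /GRing.scale/=; ring.
have cd : continuous (fun y : R => sin y - y * cos y).
  by move=> y; apply/differentiable_continuous/derivable1_diffP; case: (d y).
have [c] := @MVT_segment R (fun y => sin y - y * cos y) (fun y => y * sin y) 0 t t0
  (fun y _ => d y) (continuous_subspaceT cd).
rewrite in_itv/= => /andP[c0 ct]; rewrite sin0 mul0r !subr0 => h.
rewrite -subr_ge0 h; apply: mulr_ge0 => //; apply: mulr_ge0 => //.
apply: sin_ge0_pi; rewrite c0/= (le_trans ct)// (le_trans tp)//.
by rewrite ler_pdivrMr// ler_peMr ?pi_ge0// ler1n.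
Qed.

Lemma cos_lower (y : R) : 1 - cos (2 * y) <= 2 * y ^+ 2.
Proof.
have -> : cos (2 * y) = 1 - 2 * sin y ^+ 2.
  rewrite mulr_natl cos_mulr2n cos2sin2; ring.
rewrite opprB addrCA subrr addr0 ler_pM2l//.
rewrite -[X in X <= _]real_normK ?num_real// -[X in _ <= X]real_normK ?num_real//.
by apply: lerXn2r; rewrite ?nnegrE//; exact: norm_sin_le.
Qed.

Lemma cos_pihalf_ge0 t : 0 <= t <= pi / 2 -> 0 <= cos t.
Proof.
move=> /andP[t0 tp]; apply: cos_ge0_pihalf; rewrite tp andbT.
by apply: le_trans t0; rewrite oppr_le0 ltW// pihalf_gt0.
Qed.

(** For the lower bound, 1 - cos(2xt) <= 2 x^2 t^2, and t cos t <= sin t replaces t^2 cos^(n+2) t by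
    t cos^(n+1) t sin t, whose integral is by parts that of cos^(n+2) t divided by n + 2. *)
Lemma wallis_bounds x n :
  wallis 0 n.+2 * (1 - 2 * x ^+ 2 / n.+2%:R) <= wallis x n.+2 <= wallis 0 n.+2.
Proof.
have cX k : continuous (fun t : R => cos t ^+ k) by exact: continuous_cosX.
have cs : continuous (fun t : R => t * (cos t ^+ n.+1 * sin t)).
  move=> t; apply: cvgM; first exact: cvg_id.
  by apply: cvgM; [exact: cX|exact: continuous_sin].
apply/andP; split; last first.
  rewrite wallis0; apply: quarter_int_le => //; first exact: continuous_wallis.
  move=> t /cos_pihalf_ge0 c0; apply: ler_piMl; first exact: exprn_ge0.
  exact: cos_le1.
have parts : n.+2%:R * quarter_int (fun t => t * (cos t ^+ n.+1 * sin t)) =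
    wallis 0 n.+2.
  have d (t : R) : is_derive t 1 (fun t => t * cos t ^+ n.+2)
      (cos t ^+ n.+2 - n.+2%:R * (t * (cos t ^+ n.+1 * sin t))).
    have h : is_derive t 1 (fun t => t * cos t ^+ n.+2) _ :=
      is_deriveM (is_derive_id t 1) (is_derive_cosX n.+1 t).
    by apply: (is_derive_eq h); rewrite /GRing.scale/=; ring.
  have := quarter_int_derive _ d; rewrite cos_pihalf !exprS !mul0r !mulr0 subrr.
  rewrite quarter_intB//; last first.
    by move=> t; apply: cvgM; [exact: cvg_cst|exact: cs].
  rewrite quarter_intZ// wallis0 => h.
  apply/eqP; rewrite eq_sym -subr_eq0; apply/eqP; apply: h.
  move=> t; apply: cvgB; first exact: cX.
  by apply: cvgM; [exact: cvg_cst|exact: cs].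
rewrite -parts mulrBr mulr1 [X in _ - X](_ : _ =
  2 * x ^+ 2 * quarter_int (fun t => t * (cos t ^+ n.+1 * sin t))); last first.
  have : n.+2%:R != 0 :> R by rewrite pnatr_eq0.
  by move: (n.+2%:R) => N N0; field.
rewrite parts wallis0 -quarter_intZ// -quarter_intB//; last first.
  by move=> t; apply: cvgM; [exact: cvg_cst|exact: cs].
apply: quarter_int_le.
- move=> t; apply: cvgB; first exact: cX.
  by apply: cvgM; [exact: cvg_cst|exact: cs].
- exact: continuous_wallis.
move=> t t01; have c0 := cos_pihalf_ge0 t01; have h1 := mul_cos_le_sin t01.
have h2 := cos_lower (x * t); rewrite mulrA in h2.
have t0 : 0 <= t by case/andP: t01.
have p0 : 0 <= cos t ^+ n.+1 by exact: exprn_ge0.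
have p1 : 0 <= cos t ^+ n.+2 by exact: exprn_ge0.
rewrite lerBlDr -lerBlDl -[X in X - _]mul1r -mulrBl.
apply: (@le_trans _ _ (2 * (x * t) ^+ 2 * cos t ^+ n.+2)).
  exact: ler_wpM2r.
have -> : 2 * (x * t) ^+ 2 * cos t ^+ n.+2 =
  2 * x ^+ 2 * (t * (cos t ^+ n.+1 * (t * cos t))) by rewrite (exprSr _ n.+1); ring.
apply: ler_wpM2l; first by rewrite mulr_ge0// sqr_ge0.
by apply: ler_wpM2l => //; apply: ler_wpM2l.
Qed.

Lemma wallis_ratio_cvg x :
  wallis x m.*2 / wallis 0 m.*2 @[m --> \oo] --> (1 : R).
Proof.
apply: (@squeeze_cvgr _ _ _ _ (fun m => 1 - x ^+ 2 * m%:R^-1) (fun=> 1)).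
- near=> m.
  have [k ->] : exists k, m = k.+1.
    exists m.-1; rewrite prednK//; near: m; exact: nbhs_infty_gt.
  have p := wallis0_gt0 k.+1.
  have := wallis_bounds x k.*2; rewrite -doubleS => /andP[h1 h2].
  rewrite ler_pdivlMr// ler_pdivrMr// mul1r h2 andbT; apply: le_trans h1.
  rewrite mulrC ler_pM2l// lerD2l lerN2 -muln2 natrM.
  by rewrite le_eqVlt; apply/orP; left; apply/eqP; field; rewrite nat1r pnatr_eq0.
- have h : 1 - x ^+ 2 * m%:R^-1 @[m --> \oo] --> (1 - x ^+ 2 * 0 : R).
    by apply: cvgB; [exact: cvg_cst|apply: cvgMr; exact: cvg_invn].
  by rewrite mulr0 subr0 in h.
- exact: cvg_cst.
Unshelve. all: by end_near. Qed.

Lemma sin_pi_ratio x : x != 0 ->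
  wallis x 0 / wallis 0 0 = sin (pi * x) / (pi * x).
Proof.
move=> x0; rewrite wallisx0// wallis00.
have pi0 : pi != 0 :> R by rewrite gt_eqF ?pi_gt0.
by move: (sin _) => S; move: (@pi R) pi0 => p p0; field; rewrite x0 p0.
Qed.

(** Euler's limit formula at x and at -x shows that x Gamma(x) Gamma(1-x) times the k-th partial
    sine product tends to 1. The same partial product times a ratio of Wallis integrals, which also
    tends to 1, is exactly sin(pi x)/(pi x). *)
Lemma Gamma_reflection x : (forall z : int, x != z%:~R) ->
  Gamma x * Gamma (1 - x) * sin (pi * x) = pi.
Proof.
move=> xz.
have x0 : x != 0 by exact: (xz 0).
have xi (i : nat) : x + i%:R != 0.
  by rewrite addr_eq0; have := xz (- i%:Z); rewrite intrN.
have x1i (i : nat) : 1 - x + i%:R != 0.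
  have := xz i.+1%:Z; apply: contra_neq => h.
  by rewrite -[_%:~R]/(i.+1%:R) -natr1; lra.
pose P k : R := \prod_(i < k) (1 - x ^+ 2 / i.+1%:R ^+ 2).
pose A := Gamma x * Gamma (1 - x) * x.
(* Besides a lone factor x, the factors pair off as (i+1+x)(i+1-x) = (i+1)^2 (1 - x^2/(i+1)^2). *)
have prodE k : \prod_(i < k.+1) (x + i%:R) * \prod_(i < k) (1 - x + i%:R) =
    x * k`!%:R ^+ 2 * P k.
  rewrite /P; elim: k => [|k IH].
    by rewrite big_ord_recr !big_ord0/= fact0 addr0; ring.
  rewrite big_ord_recr/= [\prod_(i < k.+1) (1 - x + _)]big_ord_recr/=.
  rewrite mulrACA IH big_ord_recr/= factS natrM.
  have m1 : k.+1%:R != 0 :> R by rewrite pnatr_eq0.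
  have -> : 1 - x + k%:R = k.+1%:R - x by rewrite -natr1; ring.
  by field.
have main : \forall k \near \oo,
    Gamma_ratio x k.+1 * Gamma_ratio (- x) k.+1 = A * P k.
  near=> k.
  have kx : 0 < x + k.+1%:R.
    apply: (@lt_trans _ _ (x + k%:R)); last by rewrite ltrD2l ltr_nat.
    by rewrite -ltrBlDl sub0r; near: k; exact: nbhs_infty_gtr.
  have kx1 : 0 < 1 - x + k%:R.
    by rewrite -ltrBlDl sub0r; near: k; exact: nbhs_infty_gtr.
  have e2 : 1 - x + k%:R = k.+1%:R - x by rewrite -natr1; ring.
  rewrite /A (GammaE xi kx) (GammaE x1i kx1).
  have q1 : \prod_(i < k.+1) (x + i%:R) != 0 by apply/prodf_neq0 => i _; exact: xi.
  have q2 : \prod_(i < k) (1 - x + i%:R) != 0 by apply/prodf_neq0 => i _; exact: x1i.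
  have f0 : k`!%:R != 0 :> R by rewrite pnatr_eq0 -lt0n fact_gt0.
  have pe := prodE k.
  have Gk : Gamma_integral k.+1%:R = k`!%:R :> R.
    by rewrite Gamma_integralE egamma_nat.
  have n0 : 0 < k.+1%:R :> R by rewrite ltr0n.
  have w0 : k.+1%:R `^ x * k.+1%:R `^ (- x) = 1 :> R.
    by rewrite -gt0_powRD// subrr powRr0.
  rewrite /Gamma_ratio e2 (addrC k.+1%:R x).
  have p1 := powR_gt0 x n0; have p2 := powR_gt0 (- x) n0.
  rewrite Gk; move: (Gamma_integral _) (Gamma_integral _) => a b.
  have Pk : P k = \prod_(i < k.+1) (x + i%:R) * \prod_(i < k) (1 - x + i%:R)
     / (x * k`!%:R ^+ 2) by rewrite pe; field; rewrite f0 x0.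
  rewrite Pk.
  move: (k`!%:R) (\prod_(i < k.+1) _) (\prod_(i < k) _) f0 q1 q2 => f q r f0 q0 r0.
  have w1 : k.+1%:R `^ (- x) = (k.+1%:R `^ x)^-1 by rewrite powRN.
  rewrite w1; field.
  by rewrite f0 q0 r0 x0 gt_eqF.
have L : Gamma_ratio x k.+1 * Gamma_ratio (- x) k.+1 *
    (wallis x k.*2 / wallis 0 k.*2) @[k --> \oo] --> (1 * 1 * 1 : R).
  apply: cvgM; last exact: wallis_ratio_cvg.
  apply: cvgM.
  - by rewrite (cvg_shiftS (Gamma_ratio x)); exact: Gamma_ratio_cvg.
  - by rewrite (cvg_shiftS (Gamma_ratio (- x))); exact: Gamma_ratio_cvg.
rewrite !mulr1 in L.
(* The same expression is constant for large k; uniqueness of the limit then equates this constant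
   with 1. *)
have L2 : Gamma_ratio x k.+1 * Gamma_ratio (- x) k.+1 *
    (wallis x k.*2 / wallis 0 k.*2) @[k --> \oo] -->
    (A * (sin (pi * x) / (pi * x)) : R).
  apply: cvg_near_cst; near=> k.
  have -> : Gamma_ratio x k.+1 * Gamma_ratio (- x) k.+1 = A * P k.
    by near: k; exact: main.
  by rewrite -mulrA /P -wallis_ratio_prod sin_pi_ratio.
have e := cvg_unique (@norm_hausdorff _ _) L L2.
have pi0 : pi != 0 :> R by rewrite gt_eqF ?pi_gt0.
have -> : Gamma x * Gamma (1 - x) * sin (pi * x) = pi * (A * (sin (pi * x) / (pi * x))).
  rewrite /A; move: (Gamma x) (Gamma _) (sin _) => a b c; move: (@pi R) pi0 => p p0.
  by field; rewrite x0 p0.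
by rewrite -e mulr1.
Unshelve. all: by end_near. Qed.

End SineProduct.

(** * Limits of Pochhammer quotients and the multiplication formula *)

Section GammaProducts.
Variable R : realType.
Implicit Types (x a b : R) (n k N : nat).

Definition nonpole x := forall i : nat, x + i%:R != 0.

Definition poch x N : R := \prod_(i < N) (x + i%:R).

Lemma poch_neq0 x N : nonpole x -> poch x N != 0.
Proof. by move=> xi; apply/prodf_neq0 => i _; exact: xi. Qed.

Lemma Gamma_poch x N : nonpole x -> (0 < N)%N -> 0 < x + N%:R ->
  Gamma x * poch x N = Gamma_ratio x N * (Gamma_integral N%:R * N%:R `^ x).
Proof.
move=> xi N0 xN; rewrite (GammaE xi xN) -/(poch x N) /Gamma_ratio addrC.
have n0 : 0 < N%:R :> R by rewrite ltr0n.
have h1 := Gamma_integral_gt0 n0; have h2 := powR_gt0 x n0.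
rewrite divfK ?poch_neq0// divfK// ?addrC//.
by rewrite mulf_neq0// gt_eqF.
Qed.

Lemma cvg_prod_seq (I : Type) (s : seq I) (f : I -> nat -> R) :
  (forall i, f i N @[N --> \oo] --> (1 : R)) ->
  \prod_(i <- s) f i N @[N --> \oo] --> (1 : R).
Proof.
move=> fi; elim: s => [|i s IH].
  by under eq_fun do rewrite big_nil; exact: cvg_cst.
under eq_fun do rewrite big_cons.
have h : f i N * \prod_(i <- s) f i N @[N --> \oo] --> (1 * 1 : R) by exact: cvgM.
by rewrite mulr1 in h.
Qed.

Lemma prod_powR (y : R) (s : seq R) : 0 < y ->
  \prod_(x <- s) y `^ x = y `^ (\sum_(x <- s) x).
Proof.
move=> y0; elim: s => [|x s IH]; first by rewrite !big_nil powRr0.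
by rewrite !big_cons IH gt0_powRD.
Qed.

Lemma near_nat_gt x : \forall N \near \oo, 0 < x + N%:R.
Proof.
by near=> N; rewrite -ltrBlDl sub0r; near: N; exact: nbhs_infty_gtr.
Unshelve. all: by end_near. Qed.

Lemma near_nat_gt_seq (s : seq R) :
  \forall N \near \oo, forall x, x \in s -> 0 < x + N%:R.
Proof.
elim: s => [|y s IH]; first exact: nearW.
near=> N; move=> x; rewrite inE => /orP[/eqP ->|].
  by near: N; exact: near_nat_gt.
by move: x; near: N; exact: IH.
Unshelve. all: by end_near. Qed.

Lemma prod_Gamma_poch (s : seq R) N : {in s, forall x, nonpole x} ->
  (0 < N)%N -> (forall x, x \in s -> 0 < x + N%:R) ->
  \prod_(x <- s) Gamma x * \prod_(x <- s) poch x N =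
  \prod_(x <- s) Gamma_ratio x N *
    (Gamma_integral N%:R ^+ size s * N%:R `^ (\sum_(x <- s) x)).
Proof.
move=> sn N0 sN; rewrite -prod_powR ?ltr0n//.
elim: s sn sN => [|x s IH] sn sN; first by rewrite !big_nil expr0 !mulr1.
rewrite !big_cons mulrACA Gamma_poch//; last first.
- by apply: sN; rewrite mem_head.
- by apply: sn; rewrite mem_head.
rewrite IH; last first.
- by move=> y ys; apply: sN; rewrite inE ys orbT.
- by move=> y ys; apply: sn; rewrite inE ys orbT.
by rewrite /= exprS; ring.
Qed.

Lemma prod_Gamma_neq0 (s : seq R) : {in s, forall x, nonpole x} ->
  \prod_(x <- s) Gamma x != 0.
Proof.
move=> sn; rewrite prodf_seq_neq0; apply/allP => x xs /=.
exact/Gamma_neq0/sn.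
Qed.

Lemma prod_poch_neq0 (s : seq R) N : {in s, forall x, nonpole x} ->
  \prod_(x <- s) poch x N != 0.
Proof.
move=> sn; rewrite prodf_seq_neq0; apply/allP => x xs /=.
exact/poch_neq0/sn.
Qed.

(** Each rising factorial is asymptotic to Gamma(N) N^x / Gamma(x): equal lengths cancel the powers
    of Gamma(N), equal sums the powers of N. *)
Lemma poch_quotient_cvg (s t : seq R) : size s = size t ->
  \sum_(x <- s) x = \sum_(x <- t) x ->
  {in s, forall x, nonpole x} -> {in t, forall x, nonpole x} ->
  \prod_(x <- s) poch x N / \prod_(x <- t) poch x N @[N --> \oo] -->
  (\prod_(x <- t) Gamma x / \prod_(x <- s) Gamma x : R).
Proof.
move=> st sumst sn tn.
set G := \prod_(x <- t) _ / _.
have L : G * (\prod_(x <- s) Gamma_ratio x N / \prod_(x <- t) Gamma_ratio x N)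
    @[N --> \oo] --> (G * (1 / 1) : R).
  apply: cvgMr; apply: cvgM; first by apply: cvg_prod_seq => i; exact: Gamma_ratio_cvg.
  apply: cvgV; first by rewrite oner_eq0.
  by apply: cvg_prod_seq => i; exact: Gamma_ratio_cvg.
rewrite divr1 mulr1 in L; apply: cvg_trans L; apply: near_eq_cvg; near=> N.
have N0 : (0 < N)%N by near: N; exact: nbhs_infty_gt.
have n0 : 0 < N%:R :> R by rewrite ltr0n.
have e1 : \prod_(x <- s) Gamma x * \prod_(x <- s) poch x N =
    \prod_(x <- s) Gamma_ratio x N *
    (Gamma_integral N%:R ^+ size s * N%:R `^ (\sum_(x <- s) x)).
  by apply: prod_Gamma_poch => //; near: N; exact: near_nat_gt_seq.
have e2 : \prod_(x <- t) Gamma x * \prod_(x <- t) poch x N =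
    \prod_(x <- t) Gamma_ratio x N *
    (Gamma_integral N%:R ^+ size t * N%:R `^ (\sum_(x <- t) x)).
  by apply: prod_Gamma_poch => //; near: N; exact: near_nat_gt_seq.
have c0 : Gamma_integral N%:R ^+ size s * N%:R `^ (\sum_(x <- s) x) != 0.
  apply: mulf_neq0; last by rewrite gt_eqF// powR_gt0.
  by apply: expf_neq0; rewrite gt_eqF// Gamma_integral_gt0.
rewrite -st -sumst in e2.
have g1 := prod_Gamma_neq0 sn; have g2 := prod_Gamma_neq0 tn.
have p1 := prod_poch_neq0 N sn; have p2 := prod_poch_neq0 N tn.
rewrite /G; move: c0 e1 e2 g1 g2 p1 p2.
move: (_ * _ `^ _) (\prod_(x <- s) Gamma x) (\prod_(x <- t) Gamma x)
  (\prod_(x <- s) poch x N) (\prod_(x <- t) poch x N)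
  (\prod_(x <- s) Gamma_ratio x N) (\prod_(x <- t) Gamma_ratio x N)
  => c gs gt ps pt rs rt c0 e1 e2 gs0 gt0 ps0 pt0.
have rt0 : rt != 0.
  by apply/eqP => rt0; move: (mulf_neq0 gt0 pt0); rewrite e2 rt0 mul0r eqxx.
have -> : rs = gs * ps / c by rewrite e1 mulfK.
have -> : rt = gt * pt / c by rewrite e2 mulfK.
by field; rewrite c0 gs0 gt0 pt0.
Unshelve. all: by end_near. Qed.

Section Multiplication.
Variable n : nat.
Hypothesis n_gt0 : (0 < n)%N.

Definition mult_args a : seq R := [seq a + k%:R / n%:R | k <- iota 0 n].

Lemma prod_mult_args (F : R -> R) a :
  \prod_(x <- mult_args a) F x = \prod_(k < n) F (a + k%:R / n%:R).
Proof.
rewrite big_map (_ : iota 0 n = index_iota 0 n) ?big_mkord//.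
by rewrite /index_iota subn0.
Qed.

Lemma prod_mult_args_sum (F : R -> R) a :
  \sum_(x <- mult_args a) F x = \sum_(k < n) F (a + k%:R / n%:R).
Proof.
rewrite big_map (_ : iota 0 n = index_iota 0 n) ?big_mkord//.
by rewrite /index_iota subn0.
Qed.

Lemma sum_mult_args a :
  \sum_(x <- mult_args a) x = n%:R * a + \sum_(k < n) k%:R / n%:R.
Proof.
rewrite (prod_mult_args_sum id) big_split/=.
by rewrite sumr_const card_ord mulr_natl.
Qed.

(** Sorted by residue modulo n, the nN factors on the left form the rising factorials at a + k/n,
    with n taken out of each factor. *)
Lemma poch_mult a N :
  poch (n%:R * a) (n * N) = n%:R ^+ (n * N) * \prod_(x <- mult_args a) poch x N.
Proof.
have n0 : n%:R != 0 :> R by rewrite pnatr_eq0 -lt0n.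
rewrite prod_mult_args.
elim: N => [|N IH].
  rewrite muln0 /poch big_ord0 expr0 mul1r big1// => k _.
  by rewrite big_ord0.
have -> : poch (n%:R * a) (n * N.+1) =
    poch (n%:R * a) (n * N) * \prod_(k < n) (n%:R * a + (n * N + k)%:R).
  by rewrite /poch mulnS addnC big_split_ord.
rewrite IH mulnS addnC exprD -!mulrA; congr (_ * _).
have -> : \prod_(k < n) poch (a + k%:R / n%:R) N.+1 =
  \prod_(k < n) poch (a + k%:R / n%:R) N * \prod_(k < n) (a + k%:R / n%:R + N%:R).
  by rewrite -big_split/=; apply: eq_bigr => k _; rewrite /poch big_ord_recr.
rewrite mulrCA; congr (_ * _).
have -> : n%:R ^+ n = \prod_(k < n) (n%:R : R) by rewrite prodr_const card_ord.
rewrite -big_split/=; apply: eq_bigr => k _.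
by rewrite natrD natrM; field.
Qed.

Lemma nonpole_mult a : nonpole (n%:R * a) ->
  {in mult_args a, forall x, nonpole x}.
Proof.
have n0 : n%:R != 0 :> R by rewrite pnatr_eq0 -lt0n.
move=> na x /mapP[k _ ->] i; have := na (k + n * i)%N; apply: contra_neq => h.
rewrite natrD natrM [RHS](_ : _ = n%:R * 0); last by rewrite mulr0.
by rewrite -h; field.
Qed.

(** For large N the expression [Q c] factors as [C N * S c N], where [C] does not involve c and
    [S c N] tends to 1. Hence Q a * S b N = Q b * S a N, and the limit gives the claim. *)
Lemma Gamma_mult_const a b : nonpole (n%:R * a) -> nonpole (n%:R * b) ->
  \prod_(x <- mult_args a) Gamma x / Gamma (n%:R * a) * n%:R `^ (n%:R * a) =
  \prod_(x <- mult_args b) Gamma x / Gamma (n%:R * b) * n%:R `^ (n%:R * b).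
Proof.
move=> na nb.
have n0 : 0 < n%:R :> R by rewrite ltr0n.
pose Q a := \prod_(x <- mult_args a) Gamma x / Gamma (n%:R * a) * n%:R `^ (n%:R * a).
pose S a N := \prod_(x <- mult_args a) Gamma_ratio x N / Gamma_ratio (n%:R * a) (n * N).
have S1 c : S c N @[N --> \oo] --> (1 : R).
  have h : S c N @[N --> \oo] --> (1 / 1 : R).
    apply: cvgM; first by apply: cvg_prod_seq => i; exact: Gamma_ratio_cvg.
    apply: cvgV; first by rewrite oner_eq0.
    apply: (cvg_comp (muln n) (Gamma_ratio (n%:R * c))); last exact: Gamma_ratio_cvg.
    apply/cvgnyPge => A; near=> N.
    apply: (@leq_trans N); last by rewrite leq_pmull.
    by near: N; exact: nbhs_infty_ge.
  by rewrite divr1 in h.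
pose C N : R := n%:R ^+ (n * N) * (Gamma_integral N%:R ^+ n *
   N%:R `^ (\sum_(k < n) k%:R / n%:R)) / Gamma_integral (n * N)%:R.
have QS c : nonpole (n%:R * c) -> \forall N \near \oo, Q c = C N * S c N /\ C N != 0.
  move=> nc; near=> N.
  have N0 : (0 < N)%N by near: N; exact: nbhs_infty_gt.
  have nN0 : 0 < N%:R :> R by rewrite ltr0n.
  have nnN0 : 0 < (n * N)%:R :> R by rewrite ltr0n muln_gt0 n_gt0.
  have mN : forall x, x \in mult_args c -> 0 < x + N%:R.
    by near: N; exact: near_nat_gt_seq.
  have e1 := prod_Gamma_poch (nonpole_mult nc) N0 mN.
  have cN : 0 < n%:R * c + (n * N)%:R.
    apply: (@lt_le_trans _ _ (n%:R * c + N%:R)); last first.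
      by rewrite lerD2l ler_nat leq_pmull.
    by near: N; exact: near_nat_gt.
  have nNgt0 : (0 < n * N)%N by rewrite muln_gt0 n_gt0.
  have e2 := Gamma_poch nc nNgt0 cN.
  rewrite poch_mult in e2.
  rewrite sum_mult_args size_map size_iota gt0_powRD// in e1.
  rewrite natrM powRM ?ler0n// in e2; rewrite -natrM in e2.
  have g0 : Gamma_integral N%:R != 0 :> R by rewrite gt_eqF// Gamma_integral_gt0.
  have g1 : Gamma_integral (n * N)%:R != 0 :> R by rewrite gt_eqF// Gamma_integral_gt0.
  have w0 : N%:R `^ (n%:R * c) != 0 :> R by rewrite gt_eqF// powR_gt0.
  have w1 : n%:R `^ (n%:R * c) != 0 :> R by rewrite gt_eqF// powR_gt0.
  have w2 : N%:R `^ (\sum_(k < n) k%:R / n%:R) != 0 :> R by rewrite gt_eqF// powR_gt0.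
  have w3 : n%:R ^+ (n * N) != 0 :> R by rewrite expf_neq0// gt_eqF.
  have g2 := Gamma_neq0 nc.
  have p0 := prod_poch_neq0 N (nonpole_mult nc).
  have gN := expf_neq0 n g0.
  have r0 : Gamma_ratio (n%:R * c) (n * N) != 0.
    apply/eqP => r0; have := mulf_neq0 g2 (mulf_neq0 w3 p0).
    by rewrite e2 r0 mul0r eqxx.
  split; last by rewrite /C !mulf_neq0// invr_eq0.
  rewrite /Q /C /S; move: e1 e2 gN g1 w0 w1 w2 w3 g2 p0 r0.
  move: (Gamma_integral N%:R ^+ n) (Gamma_integral (n * N)%:R) (N%:R `^ (n%:R * c))
    (n%:R `^ _) (N%:R `^ (\sum_(k < n) _)) (n%:R ^+ _) (Gamma (n%:R * c)) (\prod_(x <- _) poch x N)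
    (Gamma_ratio (n%:R * c) (n * N)) (\prod_(x <- _) Gamma x)
    (\prod_(x <- _) Gamma_ratio x N)
    => g h w v u p G P r GG rr e1 e2 g'0 h0 w0 v0 u0 p0 G0 P0 r0.
  have -> : GG = rr * (g * (w * u)) / P by rewrite -e1 mulfK.
  have -> : G = r * (h * (v * w)) / (p * P) by rewrite -e2 mulfK// mulf_neq0.
  by field; rewrite h0 w0 v0 p0 P0 r0.
have L1 : Q a * S b N @[N --> \oo] --> (Q a * 1 : R) by apply: cvgMr; exact: S1.
have L2 : Q b * S a N @[N --> \oo] --> (Q b * 1 : R) by apply: cvgMr; exact: S1.
rewrite !mulr1 in L1 L2.
apply: (cvg_unique (@norm_hausdorff _ _) L1 _) => //.
apply: cvg_trans L2; apply: near_eq_cvg; near=> N.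
have [e1 C0] : Q a = C N * S a N /\ C N != 0 by near: N; exact: QS.
have [e2 _] : Q b = C N * S b N /\ C N != 0 by near: N; exact: QS.
by rewrite e1 e2 mulrAC.
Unshelve. all: by end_near. Qed.

(** The constant is read off at a = 1/n, where Gamma(na) = 1. Left as a product of Gamma values, and
    not evaluated to (2 pi)^((n-1)/2) / sqrt n, it keeps the relation free of pi. *)
Lemma Gamma_multiplication a : nonpole (n%:R * a) ->
  \prod_(k < n) Gamma (a + k%:R / n%:R) =
  n%:R `^ (1 - n%:R * a) * (Gamma (n%:R * a) * \prod_(k < n) Gamma (k.+1%:R / n%:R : R)).
Proof.
move=> na.
have n0 : 0 < n%:R :> R by rewrite ltr0n.
have n1 : n%:R * n%:R^-1 = 1 :> R by rewrite divff// gt_eqF.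
have np1 : nonpole (n%:R * n%:R^-1).
  by move=> i; rewrite n1 nat1r pnatr_eq0.
have := Gamma_mult_const na np1; rewrite n1 Gamma1 divr1 powRr1 ?ltW//.
rewrite !prod_mult_args => h.
have -> : \prod_(k < n) Gamma (k.+1%:R / n%:R : R) = \prod_(k < n) Gamma (n%:R^-1 + k%:R / n%:R).
  by apply: eq_bigr => k _; rewrite -nat1r mulrDl mul1r.
rewrite gt0_powRB// powRr1 ?ltW//.
have g2 := Gamma_neq0 na.
have w1 : n%:R `^ (n%:R * a) != 0 :> R by rewrite gt_eqF// powR_gt0.
move: h; move: (\prod_(k < n) Gamma (a + _)) => X h.
rewrite mulrACA -mulrA [X in _ = X](_ : _ = (\prod_(k < n) Gamma (n%:R^-1 + k%:R / n%:R) * n%:R)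
   * (Gamma (n%:R * a) / n%:R `^ (n%:R * a))); last by ring.
by rewrite -h; field; rewrite g2 w1.
Qed.

End Multiplication.
End GammaProducts.

(** * Consequences of the standard relations *)

Section GammaRelations.
Implicit Types (a x : rat) (n : nat) (b : int) (m : rat -> int).

Definition nonpole_rat x := forall i : nat, x + i%:R != 0.

Lemma nonpole_ratP x : reflect (nonpole_rat x) (~~ gamma_pole x).
Proof.
apply: (iffP idP) => [xp i|xi].
  apply: contra xp => /eqP h; have -> : x = - i%:R by apply/eqP; rewrite -addr_eq0 h.
  by rewrite /gamma_pole rpredN natr_int/= oppr_le0.
apply/negP => /andP[/intrP[z xz] x0].
have z0 : z <= 0 by rewrite -(ler_int rat) -xz.
have := xi `|z|%N; rewrite -[_%:R]/(`|z|%N%:Z%:~R) -[X in X%:~R]/(Posz _).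
by rewrite lez0_abs// xz -intrD subrr eqxx.
Qed.

(* A generator ((kind, n), a): kind 0 is translation at a, kind 1 reflection at
   a, kind 2 the quotient of the multiplication relations of order n at a and
   at 1/n, in which the constant (2 pi)^((n-1)/2) cancels; any other kind is
   Gamma(1) = 1. *)
Definition generator : Type := ((nat * nat) * rat)%type.

Definition gen_num (g : generator) : seq rat :=
  let: (k, n, a) := g in
  if k == 0%N then [:: a + 1] else
  if k == 1%N then [:: a; 1 - a] else
  if k == 2%N then 1 :: [seq a + i%:R / n%:R | i <- iota 0 n] else [:: 1].

Definition gen_den (g : generator) : seq rat :=
  let: (k, n, a) := g in
  if k == 0%N then [:: a] else
  if k == 1%N then [::] else
  if k == 2%N then n%:R * a :: [seq i.+1%:R / n%:R | i <- iota 0 n] else [::].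

Definition gen_refl (g : generator) : bool := g.1.1 == 1%N.

Definition gen_valid (g : generator) : Prop :=
  (0 < g.1.2)%N /\ {in gen_num g ++ gen_den g, forall x, nonpole_rat x}.

Definition gen_mult (g : generator) (x : rat) : int :=
  (count_mem x (gen_num g))%:Z - (count_mem x (gen_den g))%:Z.

(** [P] holds the generators taken with positive exponent, [Q] those with negative exponent. Only
    reflections affect the exponent of pi, by -2 each as b counts half powers. *)
Definition gen_span (b : int) (m : rat -> int) : Prop :=
  exists P Q : seq generator,
  [/\ (forall g, g \in P ++ Q -> gen_valid g),
      b = ((count gen_refl Q)%:Z - (count gen_refl P)%:Z) *+ 2 &
      forall x, m x = \sum_(g <- P) gen_mult g x - \sum_(g <- Q) gen_mult g x].

Lemma gen_spanD b b' m m' : gen_span b m -> gen_span b' m' ->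
  gen_span (b + b') (m + m').
Proof.
move=> [P [Q [v -> e]]] [P' [Q' [v' -> e']]].
exists (P ++ P'), (Q ++ Q'); split=> [g||x].
- rewrite !mem_cat => /orP[/orP[h|h]|/orP[h|h]].
  + by apply: v; rewrite mem_cat h.
  + by apply: v'; rewrite mem_cat h.
  + by apply: v; rewrite mem_cat h orbT.
  + by apply: v'; rewrite mem_cat h orbT.
- by rewrite !count_cat !PoszD; ring.
- by rewrite !big_cat/= -[LHS]/(m x + m' x) e e'; ring.
Qed.

Lemma gen_spanN b m : gen_span b m -> gen_span (- b) (- m).
Proof.
move=> [P [Q [v -> e]]]; exists Q, P; split=> [g||x].
- by rewrite mem_cat orbC -mem_cat; exact: v.
- by rewrite -mulNrn opprB.
- by rewrite -[LHS]/(- m x) e opprB.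
Qed.

Lemma gen_span0 : gen_span 0 0.
Proof. by exists [::], [::]; split=> // x; rewrite !big_nil subrr. Qed.

Lemma gen_spanMn b m n : gen_span b m -> gen_span (b *+ n) (m *+ n).
Proof.
move=> h; elim: n => [|n IH]; first by rewrite !mulr0n; exact: gen_span0.
by rewrite !mulrS; exact: gen_spanD.
Qed.

Lemma gen_span1 (g : generator) : gen_valid g ->
  gen_span (- 2 * (gen_refl g : nat)%:Z) (gen_mult g).
Proof.
move=> v; exists [:: g], [::]; split=> [g'||x].
- by rewrite mem_seq1 => /eqP ->.
- by rewrite /= addn0; ring.
- by rewrite big_seq1 big_nil subr0.
Qed.

Lemma gen_span_sum (s : seq generator) : (forall g, g \in s -> gen_valid g) ->
  gen_span (- 2 * (count gen_refl s)%:Z) (\sum_(g <- s) gen_mult g).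
Proof.
elim: s => [|g s IH] v; first by rewrite big_nil mulr0; exact: gen_span0.
rewrite big_cons /= PoszD mulrDr; apply: gen_spanD.
  by apply: gen_span1; apply: v; rewrite mem_head.
by apply: IH => g' g's; apply: v; rewrite inE g's orbT.
Qed.

Lemma gen_span_eq b b' m m' : b = b' -> m =1 m' -> gen_span b m -> gen_span b' m'.
Proof. by move=> -> /funext ->. Qed.

Lemma deltaE a x : delta a x = (a == x : nat)%:Z.
Proof. by rewrite /delta eq_sym natz. Qed.

Lemma fct_mulrn m n x : (m *+ n) x = m x *+ n.
Proof. by elim: n => // n IH; rewrite !mulrS -IH. Qed.

Lemma fct_sumE (I : Type) (s : seq I) (F : I -> rat -> int) x :
  (\sum_(i <- s) F i) x = \sum_(i <- s) F i x.
Proof. by elim: s => [|i s IH]; rewrite ?big_nil// !big_cons -IH. Qed.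

Lemma count_map_iota n (f : nat -> rat) x :
  (count_mem x [seq f i | i <- iota 0 n])%:Z = \sum_(i < n) delta (f i) x.
Proof.
elim: n => [|n IH]; first by rewrite big_ord0.
rewrite -[n.+1]addn1 iotaD map_cat count_cat PoszD IH addn1 big_ord_recr/=.
by rewrite addn0 deltaE.
Qed.

(** The exponent K absorbs [gc_root], and a factor 2 for multiplication: the square of the product
    of Gamma(i/n) over 0 < i < n is a product of reflections, which restores the constant divided
    out in a generator of kind 2. *)
Lemma gamma_consequence_gen_span b m : gamma_consequence b m ->
  exists2 K : nat, (0 < K)%N & gen_span (b *+ K) (m *+ K).
Proof.
elim=> {b m} [a /nonpole_ratP ap|a az|n a n0 /nonpole_ratP nap||b b' m m' _ [K K0 h] _ [K' K0' h']
  |b m _ [K K0 h]|n b m n0 _ [K K0 h]].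
- exists 1%N => //; have v : gen_valid (0%N, 1%N, a).
    split=> // x; rewrite !inE => /orP[|] /eqP -> // i.
    by rewrite -addrA nat1r; exact: ap.
  apply: gen_span_eq (gen_span1 v) => [|x]; first by rewrite /= mulr0 mul0rn.
  rewrite /gen_mult /= !addn0 mulr1n.
  rewrite -[RHS]/(delta (a + 1) x - delta a x) !deltaE.
  by [].
- exists 1%N => //; have ai (z : int) : a != z%:~R.
    by apply: contra az => /eqP ->; exact: intr_int.
  have v : gen_valid (1%N, 1%N, a).
    split=> // x; rewrite !inE => /orP[|] /eqP -> // i; last first.
      apply: contra (ai i.+1%:Z) => /eqP h.
      by rewrite -[_%:~R]/(i.+1%:R) -nat1r; apply/eqP; lra.
    apply: contra (ai (- i%:Z)) => /eqP h.
    by rewrite intrN -[_%:~R]/(i%:R); apply/eqP; lra.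
  apply: gen_span_eq (gen_span1 v) => [|x]; first by rewrite /= mulr1.
  rewrite /gen_mult /= !addn0 mulr1n subr0 PoszD.
  rewrite -[RHS]/(delta a x + delta (1 - a) x) !deltaE.
  by [].
- exists 2%N => //.
  have nn0 : n%:R != 0 :> rat by rewrite pnatr_eq0 -lt0n.
  have v2 : gen_valid (2%N, n, a).
    split=> // x; rewrite mem_cat !inE => /orP[/orP[/eqP ->|/mapP[k _ ->]]|
      /orP[/eqP ->//|/mapP[k _ ->]]] i.
    + by rewrite nat1r pnatr_eq0.
    + have := nap (k + n * i)%N; apply: contra => /eqP h.
      apply/eqP; rewrite natrD natrM [RHS](_ : _ = n%:R * 0); last by rewrite mulr0.
      by rewrite -h; field.
    + by rewrite gt_eqF// ltr_pwDl// divr_gt0// ltr0n.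
  (* Reflections at i/n for 0 < i < n: each Gamma(i/n) occurs twice in them, from i/n itself and as
     1 - (n-i)/n. *)
  pose s := [seq (1%N, 1%N, i.+1%:R / n%:R) : generator | i <- iota 0 n.-1].
  have vs g : g \in s -> gen_valid g.
    move=> /mapP[k]; rewrite mem_iota add0n => /andP[_ kn] ->.
    have k1 : k.+1%:R / n%:R < 1 :> rat.
      by rewrite ltr_pdivrMr ?ltr0n// mul1r ltr_nat -ltn_predRL.
    have k0 : 0 < k.+1%:R / n%:R :> rat by rewrite divr_gt0// ltr0n.
    split=> // x; rewrite !inE => /orP[|] /eqP -> i; rewrite gt_eqF// ltr_pwDl//.
    by rewrite subr_gt0.
  have cs : count gen_refl s = n.-1.
    by rewrite /s count_map (eq_count (a2 := predT)) ?count_predT ?size_iota.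
  have := gen_spanD (gen_spanMn 2 (gen_span1 v2)) (gen_span_sum vs).
  apply: gen_span_eq => [|x].
    rewrite cs /= mulr0 mul0rn add0r -[in RHS](prednK n0) -natr1 /=.
    by rewrite -[n.-1.+1]addn1 PoszD; ring.
  rewrite -[LHS]/((gen_mult (2%N, n, a) *+ 2) x + (\sum_(g <- s) gen_mult g) x).
  rewrite !fct_mulrn fct_sumE.
  rewrite -[(_ - _ : rat -> int) x]/((\sum_(k < n) delta (a + k%:R / n%:R)) x
     - delta (n%:R * a) x) fct_sumE.
  have -> : gen_mult (2%N, n, a) x =
      delta 1 x + \sum_(k < n) delta (a + k%:R / n%:R) x -
      (delta (n%:R * a) x + \sum_(k < n) delta (k.+1%:R / n%:R) x).
    by rewrite /gen_mult /= !PoszD !count_map_iota !deltaE.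
  have -> : \sum_(g <- s) gen_mult g x = (\sum_(i < n.-1) delta (i.+1%:R / n%:R) x) *+ 2.
    rewrite mulr2n.
    transitivity (\sum_(i < n.-1) (delta (i.+1%:R / n%:R) x + delta (1 - i.+1%:R / n%:R) x)).
      rewrite big_map (_ : iota 0 n.-1 = index_iota 0 n.-1); last first.
        by rewrite /index_iota subn0.
      rewrite big_mkord; apply: eq_bigr => i _.
      by rewrite /gen_mult /= addn0 PoszD subr0 !deltaE.
    rewrite big_split/=; congr (_ + _).
    rewrite (reindex_inj rev_ord_inj)/=; apply: eq_bigr => i _.
    congr (delta _ x); rewrite subnSK// natrB; last by rewrite ltnW.
    rewrite -[i.+1%:R]natr1.
    have -> : n.-1%:R = n%:R - 1 :> rat by rewrite -[in RHS](prednK n0) -natr1 addrK.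
    by field.
  have -> : \sum_(i < n) delta (i.+1%:R / n%:R) x =
      \sum_(i < n.-1) delta (i.+1%:R / n%:R) x + delta 1 x.
    rewrite -[in LHS](prednK n0) big_ord_recr/= prednK// divff//.
  by ring.
- exists 1%N => //; have v : gen_valid (3%N, 1%N, 0).
    split=> // x; rewrite !inE => /eqP -> i.
    by rewrite nat1r pnatr_eq0.
  apply: gen_span_eq (gen_span1 v) => [|x]; first by rewrite /= mulr0.
  by rewrite /gen_mult /= addn0 subr0 mulr1n deltaE.
- exists (K * K')%N; first by rewrite muln_gt0 K0.
  apply: gen_span_eq (gen_spanD (gen_spanMn K' h) (gen_spanMn K h')) => [|x].
    by rewrite -!mulrnA mulrnDl (mulnC K' K).
  by rewrite -!mulrnA mulrnDl (mulnC K' K).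
- exists K => //; apply: gen_span_eq (gen_spanN h) => [|x]; by rewrite mulNrn.
- exists (n * K)%N; first by rewrite muln_gt0 n0.
  by rewrite !mulrnA.
Qed.

Lemma count_flatten_nseq (T : eqType) (x : T) n (s : seq T) :
  count_mem x (flatten (nseq n s)) = (n * count_mem x s)%N.
Proof. by elim: n => //= n IH; rewrite count_cat IH mulSn. Qed.

Lemma count_flatten_map (T : eqType) (f : T -> seq rat) x (s : seq T) :
  (count_mem x (flatten [seq f g | g <- s]))%:Z =
  \sum_(g <- s) (count_mem x (f g))%:Z.
Proof.
by elim: s => [|g s IH] /=; rewrite ?big_nil// big_cons count_cat PoszD IH.
Qed.

(** Moving negative exponents to the other side turns the identity into an equality of multisets,
    testable by [perm_eq]; the exponent 0 of pi becomes equality of the numbers of reflections. *)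
Lemma gamma_consequence_lists (s t : seq rat) :
  gamma_consequence 0 (fun x => (count_mem x s)%:Z - (count_mem x t)%:Z) ->
  exists K P Q, [/\ (0 < K)%N, (forall g, g \in P ++ Q -> gen_valid g),
    count gen_refl P = count gen_refl Q &
    perm_eq (flatten (nseq K s) ++ flatten (map gen_den P) ++ flatten (map gen_num Q))
            (flatten (nseq K t) ++ flatten (map gen_num P) ++ flatten (map gen_den Q))].
Proof.
move=> /gamma_consequence_gen_span[K K0 [P [Q [v b e]]]]; exists K, P, Q; split=> //.
  move: b => /esym/eqP; rewrite mul0rn mulrn_eq0/= subr_eq0 => /eqP [].
  by move=> ->.
rewrite /perm_eq; apply/allP => x _ /=; apply/eqP.
rewrite !count_cat !count_flatten_nseq; apply/eqP; rewrite -eqz_nat !PoszD.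
rewrite !count_flatten_map !PoszM; apply/eqP.
have := e x; rewrite fct_mulrn /gen_mult !sumrB.
rewrite -mulr_natl natz.
move: (\sum_(g <- P) (count_mem x (gen_num g))%:Z)
  (\sum_(g <- P) (count_mem x (gen_den g))%:Z)
  (\sum_(g <- Q) (count_mem x (gen_num g))%:Z)
  (\sum_(g <- Q) (count_mem x (gen_den g))%:Z) => p1 p2 q1 q2 h.
by lia.
Qed.

End GammaRelations.

(** * Vanishing at roots of unity *)

Section CyclotomicCheck.
Variable N : nat.
Hypothesis N_gt0 : (0 < N)%N.

Definition PhiQ : {poly rat} := map_poly intr 'Phi_N.

(* [proper_factors] is a multiple of every 'Phi_d with d < N and is coprime to
   'Phi_N, so that [cyclotomic_check p W] says that 'Phi_N divides [p] without
   computing 'Phi_N. *)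
Definition proper_factors (K : nzRingType) : {poly K} :=
  \prod_(d <- iota 1 N.-1) ('X^d - 1).

Definition cyclotomic_check (p W : {poly rat}) : bool :=
  proper_factors rat * p == ('X^N - 1) * W.

(** Each ['Phi_d] for a proper divisor d of N divides its own factor X^d - 1. Since X^N - 1 is
    ['Phi_N] times the product on the right, it divides [proper_factors] times ['Phi_N]. *)
Lemma prod_Phi_lt : exists B : {poly int},
  proper_factors int = B * \prod_(d <- divisors N | d != N) 'Phi_d.
Proof.
have Xd d : (0 < d)%N -> exists c : {poly int}, 'X^d - 1 = c * 'Phi_d.
  move=> d0; exists (\prod_(e <- divisors d | e != d) 'Phi_e).
  rewrite -prod_Cyclotomic// (bigD1_seq d) ?divisors_id ?divisors_uniq//=.
  by rewrite mulrC.
have h (s : seq nat) : all (leq 1) s -> exists B : {poly int},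
    \prod_(d <- s) ('X^d - 1) = B * \prod_(d <- s) 'Phi_d.
  elim: s => [|d s IH] /=; first by exists 1; rewrite !big_nil mulr1.
  move=> /andP[d0 /IH[B eB]]; have [c ec] := Xd d d0.
  by exists (c * B); rewrite !big_cons eB ec; ring.
pose s := [seq d <- divisors N | d != N].
have perm : perm_eq (iota 1 N.-1) (s ++ [seq d <- iota 1 N.-1 | d \notin s]).
  apply: uniq_perm; first exact: iota_uniq.
    rewrite cat_uniq !filter_uniq ?divisors_uniq ?iota_uniq//= andbT.
    by apply/hasPn => d; rewrite mem_filter => /andP[].
  move=> d; rewrite mem_cat [X in _ || X]mem_filter.
  case ds : (d \in s) => //=.
  move: ds; rewrite mem_filter -dvdn_divisors// mem_iota => /andP[dN ddN].
  have := dvdn_leq N_gt0 ddN; have d0 := dvdn_gt0 N_gt0 ddN.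
  by rewrite leq_eqVlt (negbTE dN)/= add1n prednK// d0 => ->.
rewrite /proper_factors (perm_big _ perm)/= big_cat/=.
have [|B eB] := h s.
  apply/allP => d; rewrite mem_filter -dvdn_divisors// => /andP[_ dN].
  exact: dvdn_gt0 dN.
exists (B * \prod_(d <- [seq d <- iota 1 N.-1 | d \notin s]) ('X^d - 1)).
by rewrite eB mulrAC; congr (_ * _); rewrite /s big_filter.
Qed.

Lemma map_proper_factors (K : nzRingType) :
  map_poly intr (proper_factors int) = proper_factors K.
Proof.
rewrite rmorph_prod/=; apply: eq_bigr => d _.
by rewrite rmorphB/= map_polyXn rmorph1.
Qed.

Section PrimitiveRoot.
Variable (C : numFieldType) (z : C).
Hypothesis z_prim : N.-primitive_root z.

Definition ev (p : {poly rat}) : C := (map_poly ratr p).[z].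

Lemma evM p q : ev (p * q) = ev p * ev q.
Proof. by rewrite /ev rmorphM/= hornerM. Qed.

Lemma proper_factors_neq0 : (proper_factors C).[z] != 0.
Proof.
rewrite /proper_factors horner_prod prodf_seq_neq0; apply/allP => d /=.
rewrite mem_iota add1n prednK// => /andP[d0 dN].
rewrite hornerD hornerXn hornerN hornerC subr_eq0 -(prim_order_dvd z_prim).
by apply/negP => /(dvdn_leq d0); rewrite leqNgt dN.
Qed.

Lemma ev_intr (p : {poly int}) : ev (map_poly intr p) = (map_poly intr p).[z].
Proof.
rewrite /ev -map_poly_comp; congr (_.[z]); apply: eq_map_poly => k /=.
exact: ratr_int.
Qed.

Lemma ev_proper_factors : ev (proper_factors rat) != 0.
Proof. by rewrite -map_proper_factors ev_intr map_proper_factors proper_factors_neq0. Qed.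

Lemma ev_PhiQ : ev PhiQ = 0.
Proof.
have h : (map_poly intr ('X^N - 1) : {poly C}).[z] = 0.
  rewrite rmorphB/= map_polyXn rmorph1 hornerD hornerXn hornerN hornerC.
  by rewrite (prim_expr_order z_prim) subrr.
have [B eB] := prod_Phi_lt.
rewrite -prod_Cyclotomic// (bigD1_seq N) ?divisors_id ?divisors_uniq//= in h.
rewrite rmorphM/= hornerM in h; move/eqP: h; rewrite mulf_eq0 => /orP[/eqP h|/eqP h].
  by rewrite /PhiQ ev_intr.
have := proper_factors_neq0; rewrite -map_proper_factors eB rmorphM/= hornerM h.
by rewrite mulr0 eqxx.
Qed.

(** A Bezout identity evaluated at z shows that the gcd of p and Phi_N is not constant. A root of it
    in [algC] is a primitive N-th root of unity, with minimal polynomial Phi_N, so Phi_N divides the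
    gcd. Passing through a gcd over Q makes the argument valid for z in any numeric field. *)
Lemma PhiQ_dvd p : ev p = 0 -> PhiQ %| p.
Proof.
move=> p0; pose g := gcdp p PhiQ.
have PhiQ0 : PhiQ != 0.
  by rewrite /PhiQ map_poly_eq0_id0 ?monic_neq0 ?Cyclotomic_monic//
    (monicP (Cyclotomic_monic N)) oner_eq0.
have g0 : g != 0 by rewrite gcdp_eq0 negb_and PhiQ0 orbT.
have sg : (1 < size g)%N.
  rewrite ltn_neqAle lt0n size_poly_eq0 g0 andbT eq_sym; apply/negP => /eqP s1.
  have /Bezout_eq1_coprimepP[[u v]/= e] : coprimep p PhiQ by rewrite /coprimep -/g s1.
  have := oner_neq0 C; have <- : ev 1 = 1 by rewrite /ev rmorph1 hornerC.
  rewrite -e /ev rmorphD/= hornerD -!/(ev _) !evM p0 ev_PhiQ !mulr0 addr0.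
  by rewrite eqxx.
have [y yg] : exists y : algC, root (map_poly ratr g) y.
  apply: closed_rootP; rewrite size_map_poly.
  by rewrite neq_ltn sg orbT.
have gPhi : g %| PhiQ by exact: dvdp_gcdr.
have yPhi : root (map_poly ratr PhiQ) y.
  by case/dvdpP: gPhi => c ->; rewrite rmorphM/= rootM yg orbT.
have [w w_prim] := C_prim_root_exists N_gt0.
have PhiC : map_poly ratr PhiQ = cyclotomic w N.
  rewrite -(Cintr_Cyclotomic w_prim) /PhiQ -map_poly_comp.
  by apply: eq_map_poly => k /=; rewrite ratr_int.
have y_prim : N.-primitive_root y by rewrite -(root_cyclotomic w_prim) -PhiC.
have [q [e1 q_monic] qP] := minCpolyP y.
rewrite (minCpoly_cyclotomic y_prim) -(Cintr_Cyclotomic y_prim) in e1.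
have qE : q = PhiQ.
  apply: (map_poly_inj (ratr : rat -> algC)); rewrite -e1 /PhiQ -map_poly_comp.
  by apply: eq_map_poly => k /=; rewrite ratr_int.
have : PhiQ %| g by rewrite -qE -qP.
by move/dvdp_trans; apply; exact: dvdp_gcdl.
Qed.

(** Write S for the product of the Phi_d over proper divisors d of N. From [proper_factors] = B S,
    X^N - 1 = Phi_N S and p = q Phi_N one gets W = B q. Conversely, at z the right side of the check
    vanishes while [proper_factors] does not. *)
Lemma cyclotomic_checkP p : ev p = 0 <-> exists W, cyclotomic_check p W.
Proof.
split=> [/PhiQ_dvd/dvdpP[q ->]|[W /eqP e]].
  have [B eB] := prod_Phi_lt.
  exists (map_poly intr B * q); apply/eqP.
  have <- : map_poly intr ('X^N - 1 : {poly int}) = 'X^N - 1 :> {poly rat}.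
    by rewrite rmorphB/= map_polyXn rmorph1.
  rewrite -map_proper_factors eB -prod_Cyclotomic//.
  rewrite [in RHS](bigD1_seq N) ?divisors_id ?divisors_uniq//= !rmorphM/=.
  by rewrite -/PhiQ; ring.
have /eqP : ev (proper_factors rat) * ev p = 0.
  rewrite -evM e evM /ev rmorphB/= map_polyXn rmorph1 hornerD hornerXn hornerN.
  by rewrite hornerC (prim_expr_order z_prim) subrr mul0r.
by rewrite mulf_eq0 (negbTE ev_proper_factors) => /eqP.
Qed.

End PrimitiveRoot.
End CyclotomicCheck.

(** * A primitive root of unity in R[i] *)

Section ComplexRoot.
Variable R : realType.
Local Open Scope complex_scope.

Definition cis (t : R) : R[i] := cos t +i* sin t.

Lemma cis0 : cis 0 = 1.
Proof. by rewrite /cis cos0 sin0. Qed.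

Lemma cisD s t : cis (s + t) = cis s * cis t.
Proof.
rewrite /cis cosD sinD; apply/eqP; rewrite eq_complex /=.
by apply/andP; split; apply/eqP; ring.
Qed.

Lemma cisX t n : cis t ^+ n = cis (n%:R * t).
Proof.
elim: n => [|n IH]; first by rewrite mul0r cis0.
by rewrite exprS IH -nat1r mulrDl mul1r cisD.
Qed.

Lemma cis2pi n : cis (2 * pi * n%:R) = 1.
Proof.
rewrite mulrC -cisX (_ : cis (2 * pi) = 1) ?expr1n//.
by rewrite /cis mulr_natl cos2pi sin2pi.
Qed.

Definition zeta N : R[i] := cis (2 * pi / N%:R).

Lemma zetaX N k : zeta N ^+ k = cis (2 * pi * (k%:R / N%:R)).
Proof. by rewrite /zeta cisX; congr cis; ring. Qed.

(** An order m < N would give cos(2 pi m/N) = 1, hence sin(pi m/N) = 0 although 0 < m/N < 1. *)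
Lemma zeta_prim N : (0 < N)%N -> N.-primitive_root (zeta N).
Proof.
move=> N0; have n0 : N%:R != 0 :> R by rewrite pnatr_eq0 -lt0n.
have zN : zeta N ^+ N = 1.
  by rewrite zetaX divff// -[1]/(1%:R) cis2pi.
have [m m_prim mN] := prim_order_exists N0 zN.
suff e : N = m by rewrite {1}e.
apply/eqP; rewrite eqn_leq (dvdn_leq N0 mN) andbT leqNgt; apply/negP => mlt.
have m0 := prim_order_gt0 m_prim.
have /eqP := prim_expr_order m_prim; rewrite zetaX /cis eq_complex/= => /andP[/eqP c1 _].
have p0 := @pi_gt0 R.
have t0 : 0 < m%:R / N%:R :> R by rewrite divr_gt0// ltr0n.
have t1 : m%:R / N%:R < 1 :> R by rewrite ltr_pdivrMr ?ltr0n// mul1r ltr_nat.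
have : 0 < sin (pi * (m%:R / N%:R)) :> R.
  by apply: sin_gt0_pi; rewrite mulr_gt0//= -[X in _ < X]mulr1 ltr_pM2l.
have e2 : 2 * pi * (m%:R / N%:R) = (pi * (m%:R / N%:R)) *+ 2 :> R by ring.
move: c1; rewrite e2 cos_mulr2n cos2sin2 => c1 s0.
have : sin (pi * (m%:R / N%:R)) ^+ 2 = 0 :> R by clear -c1; lra.
by move/eqP; rewrite sqrf_eq0 => /eqP s00; rewrite s00 ltxx in s0.
Qed.

(** The squared length of a chord of the unit circle: the second factor is the conjugate of the
    first, since zeta^(N-1) is the inverse of zeta. *)
Lemma zeta_sqr_dist N j j' : (0 < N)%N ->
  (zeta N ^+ j - zeta N ^+ j') * (zeta N ^+ (N.-1 * j) - zeta N ^+ (N.-1 * j')) =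
  (4 * sin (pi * ((j%:R - j'%:R) / N%:R)) ^+ 2)%:C.
Proof.
move=> N0; have n0 : N%:R != 0 :> R by rewrite pnatr_eq0 -lt0n.
have conj k : zeta N ^+ (N.-1 * k) = cis (- (2 * pi * (k%:R / N%:R))).
  rewrite zetaX -[RHS]mul1r -(cis2pi k) -cisD; congr cis.
  rewrite natrM; have -> : N.-1%:R = N%:R - 1 :> R.
    by rewrite -[in RHS](prednK N0) -natr1 addrK.
  by field.
rewrite !conj !zetaX.
set s := 2 * pi * (j%:R / N%:R); set t := 2 * pi * (j'%:R / N%:R).
have -> : sin (pi * ((j%:R - j'%:R) / N%:R)) ^+ 2 = (1 - cos (s - t)) / 2.
  have -> : s - t = (pi * ((j%:R - j'%:R) / N%:R)) *+ 2 by rewrite /s /t; ring.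
  by rewrite cos_mulr2n cos2sin2; field.
rewrite cosB /cis !cosN !sinN; apply/eqP; rewrite eq_complex /=.
have := cos2Dsin2 s; have := cos2Dsin2 t.
move: (cos s) (sin s) (cos t) (sin t) => a b c d h1 h2.
apply/andP; split; apply/eqP; last by ring.
have -> : 4 * ((1 - (a * c + b * d)) / 2) = (c ^+ 2 + d ^+ 2) + (a ^+ 2 + b ^+ 2) - 2 * (a * c + b * d).
  by rewrite h1 h2; field.
by ring.
Qed.

End ComplexRoot.

(* A generator whose argument is (j - j') / N is stored with the pair (j, j'), so
   that powers of a primitive N-th root of unity z have natural exponents: the
   value sin^2 (pi (j - j') / N) of a reflection is
   (z^j - z^j') (z^-j - z^-j') / 4, where z^-1 = z^(N-1). *)
Definition cgen : Type := ((nat * nat) * (nat * nat))%type.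

Definition cgen_arg (N : nat) (g : cgen) : rat := (g.2.1%:R - g.2.2%:R) / N%:R.

Definition gen_of (N : nat) (g : cgen) : generator := (g.1, cgen_arg N g).

(** Numerator, with [value_den] as denominator, of the algebraic value of the 2N-th power of the
    relation of g; for a reflection (2 pi)^(2N) is left out. For multiplication, 2N(1 - na) = 2N +
    2nj' - 2nj when a = (j - j')/N; for reflection, (2 sin(pi a))^(2N) is the N-th power of a
    squared chord. *)
Definition value_num (N : nat) (g : cgen) : {poly rat} :=
  if g.1.1 == 0%N then (cgen_arg N g ^+ (2 * N))%:P else
  if g.1.1 == 2%N then (g.1.2%:R ^+ (2 * N + 2 * (g.1.2 * g.2.2)))%:P else 1.

Definition value_den (N : nat) (g : cgen) : {poly rat} :=
  if g.1.1 == 1%N then (('X ^+ g.2.1 - 'X ^+ g.2.2) *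
    ('X ^+ (N.-1 * g.2.1) - 'X ^+ (N.-1 * g.2.2))) ^+ N else
  if g.1.1 == 2%N then (g.1.2%:R ^+ (2 * (g.1.2 * g.2.1)))%:P else 1.

(** Vanishing at zeta_N says, with denominators cleared, that t^(2KN) is u^(2KN) times the value
    that the derivation gives to the 2KN-th power of the Gamma quotient. *)
Definition value_poly (N K : nat) (u t : rat) (P Q : seq cgen) : {poly rat} :=
  (t ^+ (2 * (K * N)))%:P *
    (\prod_(g <- P) value_den N g * \prod_(g <- Q) value_num N g) -
  (u ^+ (2 * (K * N)))%:P *
    (\prod_(g <- P) value_num N g * \prod_(g <- Q) value_den N g).

(** * Values of derivations at a root of unity *)

Section Values.
Variable R : realType.
Local Open Scope complex_scope.
Implicit Types (g : cgen) (P Q : seq cgen) (s t : seq rat) (N K : nat).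

Definition Gprod s : R := \prod_(x <- s) Gamma (ratr x : R).

Lemma Gprod_cat s t : Gprod (s ++ t) = Gprod s * Gprod t.
Proof. exact: big_cat. Qed.

Lemma nonpole_ratr x : nonpole_rat x -> nonpole (ratr x : R).
Proof. by move=> xp i; rewrite -ratr_nat -rmorphD/= fmorph_eq0; exact: xp. Qed.

Lemma ratr_natdiv (i n : nat) : ratr (i%:R / n%:R : rat) = i%:R / n%:R :> R.
Proof.
rewrite -[in RHS](ratr_nat R i) -[in RHS](ratr_nat R n).
exact: (fmorph_div (ratr : rat -> R)).
Qed.

Lemma Gprod_neq0 s : {in s, forall x, nonpole_rat x} -> Gprod s != 0.
Proof.
move=> sp; rewrite prodf_seq_neq0; apply/allP => x xs /=.
exact/Gamma_neq0/nonpole_ratr/sp.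
Qed.

Lemma evC N (c : rat) : ev (zeta R N) c%:P = (ratr c : R)%:C.
Proof.
rewrite /ev map_polyC hornerC.
by symmetry; exact: (fmorph_eq_rat (real_complex R \o (ratr : rat -> R)) c).
Qed.

Lemma evXn N k : ev (zeta R N) 'X^k = zeta R N ^+ k.
Proof. by rewrite /ev map_polyXn hornerXn. Qed.

Lemma evB (z : R[i]) (p q : {poly rat}) : ev z (p - q) = ev z p - ev z q.
Proof. by rewrite /ev rmorphB/= hornerD hornerN. Qed.

Lemma ev1 (z : R[i]) : ev z 1 = 1.
Proof. by rewrite /ev rmorph1 hornerC. Qed.

Lemma ev_exp (z : R[i]) (p : {poly rat}) n : ev z (p ^+ n) = ev z p ^+ n.
Proof. by elim: n => [|n IH]; rewrite ?expr0 ?ev1// !exprS evM IH. Qed.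

Lemma real_complexX (x : R) n : (x ^+ n)%:C = x%:C ^+ n.
Proof. exact: (rmorphXn (real_complex R)). Qed.

Lemma real_complexB (x y : R) : (x - y)%:C = x%:C - y%:C.
Proof. exact: (rmorphB (real_complex R)). Qed.

Lemma real_complexM (x y : R) : (x * y)%:C = x%:C * y%:C.
Proof. exact: (rmorphM (real_complex R)). Qed.

Lemma real_complex_eq0 (x : R) : x%:C = 0 <-> x = 0.
Proof. by split=> [[]|->]. Qed.

Lemma real_complex_value (x x' y y' z z' : R) n :
  (x ^+ n * (y * z) - x' ^+ n * (y' * z'))%:C =
  x%:C ^+ n * (y%:C * z%:C) - x'%:C ^+ n * (y'%:C * z'%:C).
Proof.
rewrite (real_complexB (_ * _)) (real_complexM (x ^+ n)) (real_complexM (x' ^+ n)).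
by rewrite (real_complexM y) (real_complexM y') !real_complexX.
Qed.

Lemma sin_pi_neq0 (x : R) : (forall z : int, x != z%:~R) -> sin (pi * x) != 0.
Proof.
move=> xz; apply/eqP => s0; have := Gamma_reflection xz.
by rewrite s0 mulr0 => /esym/eqP; rewrite gt_eqF// pi_gt0.
Qed.

Lemma gen_value N g : (0 < N)%N -> gen_valid (gen_of N g) ->
  exists V D : R, [/\ V != 0 /\ D != 0,
    ev (zeta R N) (value_num N g) = V%:C, ev (zeta R N) (value_den N g) = D%:C &
    Gprod (gen_num (gen_of N g)) ^+ (2 * N) * D =
    ((2 * pi) ^+ (2 * N)) ^+ gen_refl (gen_of N g) * V *
      Gprod (gen_den (gen_of N g)) ^+ (2 * N)].
Proof.
case: g => [[k n] [j j']] N0; set a := cgen_arg N (k, n, (j, j')).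
have NR0 : N%:R != 0 :> R by rewrite pnatr_eq0 -lt0n.
have NQ0 : N%:R != 0 :> rat by rewrite pnatr_eq0 -lt0n.
have aR : ratr a = (j%:R - j'%:R) / N%:R :> R.
  by rewrite /a /cgen_arg/= rmorph_div ?unitfE//= rmorphB/= !ratr_nat.
rewrite /gen_of -/a /gen_valid /value_num /value_den /gen_refl /=.
case: (altP (k =P 0%N)) => [k0 [_ v]|k0].
  have ap : nonpole_rat a by apply: v; rewrite mem_head orbT || rewrite !inE eqxx orbT.
  have aR0 : ratr a != 0 :> R by rewrite -[ratr a]addr0; exact: (nonpole_ratr ap 0%N).
  exists (ratr a ^+ (2 * N)), 1; rewrite k0/=; split=> //.
  - by split; [exact: expf_neq0|exact: oner_neq0].
  - by rewrite evC rmorphXn.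
  - exact: ev1.
  - rewrite mulr1 mul1r /Gprod !big_seq1 rmorphD rmorph1/= GammaD1.
      by rewrite exprMn.
    exact: nonpole_ratr.
case: (altP (k =P 1%N)) => [k1 [_ v]|k1].
  (* Since neither a nor 1 - a is a pole, a is not an integer. *)
  have az (z : int) : (ratr a : R) != z%:~R.
    have /nonpole_ratr h1 : nonpole_rat a by apply: v; rewrite mem_head.
    have /nonpole_ratr h2 : nonpole_rat (1 - a) by apply: v; rewrite !inE eqxx orbT.
    rewrite rmorphB rmorph1/= in h2.
    case: z => z; last first.
      apply: contra (h1 z.+1) => /eqP ->.
      by rewrite NegzE intrN -[X in - X]/(z.+1%:R) addNr.
    case: z => [|z]; first by have := h1 0%N; rewrite addr0.
    apply: contra (h2 z) => /eqP ->.
    by rewrite -[X in 1 - X]/(z.+1%:R) -nat1r; apply/eqP; ring.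
  have s0 := sin_pi_neq0 az; have refl := Gamma_reflection az.
  exists 1, ((4 * sin (pi * ratr a) ^+ 2) ^+ N); rewrite k1/=; split=> //.
  - split; first exact: oner_neq0.
    by rewrite !expf_neq0// mulf_neq0// ?pnatr_eq0// expf_neq0.
  - exact: ev1.
  - by rewrite ev_exp evM !evB !evXn zeta_sqr_dist// -aR real_complexX.
  - rewrite /Gprod big_cons big_seq1 big_nil expr1n expr1 !mulr1 rmorphB rmorph1/=.
    have -> : 4 * sin (pi * ratr a) ^+ 2 = (2 * sin (pi * (ratr a : R))) ^+ 2 by ring.
    rewrite -[in RHS]refl !exprM -exprMn; congr (_ ^+ N).
    by move: (Gamma _) (Gamma _) (sin _) => x y z; ring.
case: (altP (k =P 2%N)) => [k2 [n0 v]|k2 [_ v]]; last first.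
  exists 1, 1; split=> //.
  - exact: ev1.
  - exact: ev1.
  - by rewrite /Gprod big_seq1 big_nil rmorph1 Gamma1 /= expr0 !expr1n !mulr1.
have nap : nonpole_rat (n%:R * a).
  by apply: v; rewrite mem_cat; apply/orP; right; exact: mem_head.
have nR : 0 < n%:R :> R by rewrite ltr0n.
have nR0 : n%:R != 0 :> R by rewrite gt_eqF.
exists (n%:R ^+ (2 * N + 2 * (n * j'))), (n%:R ^+ (2 * (n * j))); split=> //.
- by split; exact: expf_neq0.
- by rewrite evC rmorphXn/= ratr_nat.
- by rewrite evC rmorphXn/= ratr_nat.
have napR := nonpole_ratr nap; rewrite rmorphM/= ratr_nat in napR.
have mul := Gamma_multiplication n0 napR.
have iotaE (F : nat -> R) : \prod_(i <- iota 0 n) F i = \prod_(i < n) F i.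
  rewrite (_ : iota 0 n = index_iota 0 n) ?big_mkord//.
  by rewrite /index_iota subn0.
have -> : Gprod (1 :: [seq a + i%:R / n%:R | i <- iota 0 n]) =
    \prod_(i < n) Gamma (ratr a + i%:R / n%:R).
  rewrite /Gprod big_cons rmorph1 Gamma1 mul1r big_map iotaE.
  by apply: eq_bigr => i _; rewrite rmorphD/= ratr_natdiv.
have -> : Gprod (n%:R * a :: [seq i.+1%:R / n%:R | i <- iota 0 n]) =
    Gamma (n%:R * ratr a) * \prod_(i < n) Gamma (i.+1%:R / n%:R).
  rewrite /Gprod big_cons rmorphM/= ratr_nat big_map iotaE; congr (_ * _).
  by apply: eq_bigr => i _; rewrite ratr_natdiv.
rewrite mul expr0 mul1r exprMn mulrAC; congr (_ * _).
rewrite -!powR_mulrn ?powR_ge0 ?ler0n// -powRrM -gt0_powRD//; congr powR.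
rewrite aR !natrD !natrM; field.
exact: NR0.
Qed.

Lemma gens_value N P : (0 < N)%N ->
  (forall g, g \in P -> gen_valid (gen_of N g)) ->
  exists V D : R, [/\ V != 0 /\ D != 0,
    ev (zeta R N) (\prod_(g <- P) value_num N g) = V%:C,
    ev (zeta R N) (\prod_(g <- P) value_den N g) = D%:C &
    Gprod (flatten (map (gen_num \o gen_of N) P)) ^+ (2 * N) * D =
    ((2 * pi) ^+ (2 * N)) ^+ count (gen_refl \o gen_of N) P * V *
      Gprod (flatten (map (gen_den \o gen_of N) P)) ^+ (2 * N)].
Proof.
move=> N0; elim: P => [|g P IH] v.
  exists 1, 1; rewrite !big_nil /Gprod !big_nil !expr1n !mulr1; split=> //.
  - exact: ev1.
  - exact: ev1.
have [|V1 [D1 [[v1 d1] ev1 ed1 e1]]] := @gen_value N g N0.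
  by apply: v; rewrite mem_head.
have [|V2 [D2 [[v2 d2] ev2 ed2 e2]]] := IH.
  by move=> h hP; apply: v; rewrite inE hP orbT.
exists (V1 * V2), (D1 * D2); rewrite !big_cons; split.
- by split; exact: mulf_neq0.
- by rewrite evM ev1 ev2 real_complexM.
- by rewrite evM ed1 ed2 real_complexM.
have mapE (f : cgen -> seq rat) : flatten (map f (g :: P)) = f g ++ flatten (map f P) by [].
rewrite !mapE !Gprod_cat -[count _ (g :: P)]/(gen_refl (gen_of N g) + count _ P)%N.
set T := (2 * pi) ^+ (2 * N) in e1 e2 *.
rewrite !exprMn exprD mulrACA e1 e2.
by ring.
Qed.

Lemma Gprod_nseq K s : Gprod (flatten (nseq K s)) = Gprod s ^+ K.
Proof.
elim: K => [|K IH]; first by rewrite /Gprod big_nil expr0.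
by rewrite /= Gprod_cat IH exprS.
Qed.

(** Taking Gamma products along the multiset equality writes the K-th power of the quotient through
    generators; its 2N-th power is V1 D2 / (V2 D1), the factors (2 pi)^(2N) cancelling because the
    reflection counts agree. Equality of KN-th powers descends to the squares, which are
    nonnegative. *)
Lemma value_polyP N K (u t : rat) P Q (A B : seq rat) :
  (0 < N)%N -> (0 < K)%N ->
  (forall g, g \in P ++ Q -> gen_valid (gen_of N g)) ->
  count (gen_refl \o gen_of N) P = count (gen_refl \o gen_of N) Q ->
  {in A, forall x, nonpole_rat x} -> {in B, forall x, nonpole_rat x} ->
  perm_eq (flatten (nseq K B) ++ flatten (map (gen_den \o gen_of N) P) ++
             flatten (map (gen_num \o gen_of N) Q))
          (flatten (nseq K A) ++ flatten (map (gen_num \o gen_of N) P) ++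
             flatten (map (gen_den \o gen_of N) Q)) ->
  ev (zeta R N) (value_poly N K u t P Q) = 0 <->
  (ratr t ^+ 2 = ratr u ^+ 2 * (Gprod B / Gprod A) ^+ 2 :> R).
Proof.
move=> N0 K0 v cPQ A0 B0 perm.
have [|V1 [D1 [[v1 d1] ev1 ed1 e1]]] := @gens_value N P N0.
  by move=> g gP; apply: v; rewrite mem_cat gP.
have [|V2 [D2 [[v2 d2] ev2 ed2 e2]]] := @gens_value N Q N0.
  by move=> g gQ; apply: v; rewrite mem_cat gQ orbT.
have pos S : (forall g, g \in S -> gen_valid (gen_of N g)) ->
    Gprod (flatten (map (gen_num \o gen_of N) S)) != 0 /\
    Gprod (flatten (map (gen_den \o gen_of N) S)) != 0.
  by move=> vS; split; apply: Gprod_neq0 => x /flatten_mapP[g gS xg];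
    apply: (vS g gS).2; rewrite mem_cat xg ?orbT.
have [|pP1 pP2] := pos P; first by move=> g gP; apply: v; rewrite mem_cat gP.
have [|pQ1 pQ2] := pos Q; first by move=> g gQ; apply: v; rewrite mem_cat gQ orbT.
have := perm_big _ perm : Gprod _ = Gprod _.
rewrite !Gprod_cat !Gprod_nseq => e.
set pn := Gprod (flatten (map (gen_num \o gen_of N) P)) in e e1 pP1 *.
set pd := Gprod (flatten (map (gen_den \o gen_of N) P)) in e e1 pP2 *.
set qn := Gprod (flatten (map (gen_num \o gen_of N) Q)) in e e2 pQ1 *.
set qd := Gprod (flatten (map (gen_den \o gen_of N) Q)) in e e2 pQ2 *.
have gA := Gprod_neq0 A0; have gB := Gprod_neq0 B0.
have T0 : ((2 * pi) ^+ (2 * N)) ^+ count (gen_refl \o gen_of N) Q != 0 :> R.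
  by rewrite !expf_neq0// mulf_neq0 ?pnatr_eq0// gt_eqF// pi_gt0.
rewrite cPQ in e1.
have main : (Gprod B / Gprod A) ^+ (2 * (K * N)) = V1 * D2 / (V2 * D1).
  have E : (Gprod B / Gprod A) ^+ K = pn / pd / (qn / qd).
    rewrite expr_div_n.
    have Ak0 := expf_neq0 K gA.
    have -> : Gprod B ^+ K = Gprod A ^+ K * (pn * qd) / (pd * qn).
      by rewrite -e mulfK// mulf_neq0.
    by field; rewrite Ak0 pP2 pQ1 pQ2.
  rewrite mulnCA exprM E !expr_div_n.
  have w1 := expf_neq0 (2 * N) pP1; have w2 := expf_neq0 (2 * N) pP2.
  have w3 := expf_neq0 (2 * N) pQ1; have w4 := expf_neq0 (2 * N) pQ2.
  have -> : pn ^+ (2 * N) = ((2 * pi) ^+ (2 * N)) ^+ count (gen_refl \o gen_of N) Q *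
    V1 * pd ^+ (2 * N) / D1 by rewrite -e1 mulfK.
  have -> : qn ^+ (2 * N) = ((2 * pi) ^+ (2 * N)) ^+ count (gen_refl \o gen_of N) Q *
    V2 * qd ^+ (2 * N) / D2 by rewrite -e2 mulfK.
  move: (_ ^+ count _ _) (pd ^+ _) (qd ^+ _) T0 w2 w4 => T x z T0 x0 z0.
  by field; rewrite T0 d1 d2 v2 x0 z0.
have -> : ev (zeta R N) (value_poly N K u t P Q) =
    ((ratr t) ^+ (2 * (K * N)) * (D1 * V2) - (ratr u) ^+ (2 * (K * N)) * (V1 * D2) : R)%:C.
  rewrite /value_poly evB !evM !evC ev1 ev2 ed1 ed2 !rmorphXn/=.
  exact/esym/real_complex_value.
have KN0 : (0 < K * N)%N by rewrite muln_gt0 K0.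
transitivity ((ratr t : R) ^+ (2 * (K * N)) =
    ratr u ^+ (2 * (K * N)) * (Gprod B / Gprod A) ^+ (2 * (K * N))).
  rewrite main (real_complex_eq0 _); split=> [/eqP|h].
    rewrite subr_eq0 => /eqP h.
    apply: (mulIf (mulf_neq0 d1 v2)); rewrite h; field.
    by rewrite d1 v2.
  apply/eqP; rewrite subr_eq0 h; apply/eqP; field.
  by rewrite d1 v2.
move: (ratr t) (ratr u) (Gprod B / Gprod A) => a b c.
rewrite -!exprMn (exprM a 2) (exprM (b * c) 2); split=> [h|->//].
by apply: (pexpIrn KN0 _ _ h); rewrite nnegrE sqr_ge0.
Qed.

End Values.

(** * Squares of hypergeometric sequences *)

Section EventualSign.
Implicit Types (f g p q : {poly rat}) (N n m : nat).

(* Beyond [N] the leading term of [f] dominates the sum of the others. *)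
Definition pos_from f N : bool := (0 < N)%N &&
  (\sum_(i <- iota 0 (size f).-1) `|f`_i| < f`_(size f).-1 * N%:R).

Lemma pos_fromP f N : pos_from f N -> forall n, (N <= n)%N -> 0 < f.[n%:R].
Proof.
move=> /andP[N0 h] n Nn; set d := (size f).-1 in h.
have n0 : (0 < n)%N by exact: leq_trans Nn.
have s0 : 0 <= \sum_(i <- iota 0 d) `|f`_i| by exact: sumr_ge0.
have fd : 0 < f`_d.
  have : 0 < f`_d * N%:R by exact: le_lt_trans h.
  by rewrite pmulr_lgt0// ltr0n.
have sf : size f = d.+1.
  rewrite /d prednK// lt0n size_poly_eq0; apply: contraTneq fd => ->.
  by rewrite coef0 ltxx.
rewrite horner_coef sf big_ord_recr/=.
rewrite (_ : iota 0 d = index_iota 0 d) ?big_mkord in s0 h; last first.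
  by rewrite /index_iota subn0.
have x1 : 1 <= n%:R :> rat by rewrite ler1n.
rewrite addrC -ltrBlDr sub0r.
(* As n >= 1, each lower term is at most |f_i| n^(d-1), which leaves one factor n for the leading
   term. *)
apply: (@le_lt_trans _ _ (\sum_(i < d) `|f`_i| * n%:R ^+ d.-1)).
  rewrite -sumrN; apply: ler_sum => i _; rewrite -mulNr.
  apply: (@le_trans _ _ (`|f`_i| * n%:R ^+ i)).
    apply: ler_wpM2r; first by rewrite exprn_ge0// ler0n.
    by rewrite -normrN ler_norm.
  apply: ler_wpM2l => //; apply: ler_weXn2l => //.
  by rewrite -ltnS prednK// (leq_ltn_trans _ (ltn_ord i)).
case: d h s0 fd {sf} => [|d] h s0 fd /=; first by rewrite big_ord0 expr0 mulr1.
rewrite -mulr_suml exprS mulrA ltr_pM2r ?exprn_gt0 ?ltr0n//.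
apply: (lt_le_trans h); rewrite ler_pM2l// ler_nat.
exact: Nn.
Qed.

Lemma pos_from_eventually f : 0 < lead_coef f ->
  exists N0, forall N, (N0 <= N)%N -> pos_from f N.
Proof.
move=> f0; set S := \sum_(i <- iota 0 (size f).-1) `|f`_i|.
exists (Num.truncn (S / lead_coef f)).+1 => N hN.
rewrite /pos_from (leq_trans _ hN)//= -/S -lead_coefE mulrC -ltr_pdivrMr//.
by apply: (lt_le_trans (truncnS_gt _)); rewrite ler_nat.
Qed.

Lemma lead_coef_eq f d : (size f <= d.+1)%N -> f`_d != 0 -> lead_coef f = f`_d.
Proof.
move=> sf fd; have h : (d < size f)%N by apply: contraR fd; rewrite -leqNgt => h; rewrite nth_default.
by rewrite lead_coefE; congr (_`__); lia.
Qed.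

End EventualSign.

(** * Certified bounds on the tail of the squares *)

Section Sequences.
Implicit Types (p q : {poly rat}) (u t : rat) (N n m K : nat).

Definition useq p q u n : rat :=
  u * \prod_(i <- iota 0 n) (q.[i.+1%:R] / p.[i.+1%:R]).

Lemma useq0 p q u : useq p q u 0 = u.
Proof. by rewrite /useq big_nil mulr1. Qed.

Lemma useqS p q u n :
  useq p q u n.+1 = useq p q u n * (q.[n.+1%:R] / p.[n.+1%:R]).
Proof.
rewrite /useq (_ : iota 0 n.+1 = iota 0 n ++ [:: n]); last first.
  by rewrite -[n.+1]addn1 iotaD.
by rewrite big_cat big_seq1/= -!mulrA.
Qed.

Lemma useq_inv p q u n : useq q p u^-1 n = (useq p q u n)^-1.
Proof.
elim: n => [|n IH]; first by rewrite !useq0.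
have e (a b c : rat) : a^-1 * (c / b) = (a * (b / c))^-1.
  by rewrite -[c / b]invf_div -invfM mulrC.
by rewrite !useqS IH e.
Qed.

Definition regular p q u := u != 0 /\
  forall n, p.[n.+1%:R] != 0 /\ q.[n.+1%:R] != 0.

Lemma regular_inv p q u : regular p q u -> regular q p u^-1.
Proof. by move=> [u0 h]; split=> [|n]; rewrite ?invr_eq0//; have [] := h n. Qed.

Lemma useq_neq0 p q u n : regular p q u -> useq p q u n != 0.
Proof.
move=> [u0 h]; elim: n => [|n IH]; first by rewrite useq0.
by have [pn qn] := h n; rewrite useqS mulf_neq0// mulf_neq0// invr_eq0.
Qed.

Lemma useq_gt0 p q u n : regular p q u -> 0 < useq p q u n ^+ 2.
Proof. by move=> h; rewrite exprn_even_gt0//= useq_neq0. Qed.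

Lemma useq_sqS p q u n : useq p q u n.+1 ^+ 2 =
  useq p q u n ^+ 2 * ((q ^+ 2).[n.+1%:R] / (p ^+ 2).[n.+1%:R]).
Proof. by rewrite useqS exprMn expr_div_n !horner_exp. Qed.

Definition decr_from p q N := pos_from (p ^+ 2 - q ^+ 2) N.

Definition below_from p q u t N :=
  decr_from p q N && (useq p q u N ^+ 2 < t ^+ 2).

(* Let y n = useq p q u n ^ 2.  The second test says that
   y (n+1) >= y n (1 - K / (n+1)^2) for n >= N; as K / (n+1)^2 <= K/n - K/(n+1),
   this telescopes to y n >= y N (1 - K/N). *)
Definition above_from p q u t N K :=
  [&& decr_from p q N,
    pos_from (K%:R *: p ^+ 2 - 'X ^+ 2 * (p ^+ 2 - q ^+ 2)) N &
    t ^+ 2 < useq p q u N ^+ 2 * (1 - K%:R / N%:R)].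

Lemma decr_fromP p q u N : regular p q u -> decr_from p q N ->
  forall n, (N <= n)%N -> useq p q u n.+1 ^+ 2 < useq p q u n ^+ 2.
Proof.
move=> reg /pos_fromP h n Nn; have := h n.+1 (leqW Nn).
rewrite hornerD hornerN subr_gt0 => lt.
have [_ /(_ n)[pn qn]] := reg.
have p2 : 0 < (p ^+ 2).[n.+1%:R] by rewrite horner_exp exprn_even_gt0.
by rewrite useq_sqS gtr_pMr ?useq_gt0// ltr_pdivrMr// mul1r.
Qed.

Lemma decr_from_le p q u N : regular p q u -> decr_from p q N ->
  forall n m, (N <= n)%N -> (n <= m)%N -> useq p q u m ^+ 2 <= useq p q u n ^+ 2.
Proof.
move=> reg dec n m Nn /subnKC <-; elim: (m - n)%N => [|k IH]; first by rewrite addn0.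
rewrite addnS; apply: le_trans IH; apply: ltW; apply: (decr_fromP reg dec).
exact: leq_trans Nn (leq_addr _ _).
Qed.

Lemma below_fromP p q u t N : regular p q u -> below_from p q u t N ->
  forall n, (N <= n)%N -> useq p q u n ^+ 2 < t ^+ 2.
Proof.
move=> reg /andP[dec lt] n Nn; apply: le_lt_trans lt.
exact: (decr_from_le reg dec).
Qed.

Lemma above_fromP p q u t N K : regular p q u -> above_from p q u t N K ->
  forall n, (N <= n)%N -> t ^+ 2 < useq p q u n ^+ 2.
Proof.
move=> reg /and3P[dec posK lt] n Nn; apply: (lt_le_trans lt).
have N0 : (0 < N)%N by case/andP: dec.
set y := fun n => useq p q u n ^+ 2; rewrite -/(y N) -/(y n).
have y0 k : 0 < y k by exact: useq_gt0.
(* The extra summand K/n is what lets the induction on n close. *)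
suff h : y N * (1 - K%:R / N%:R + K%:R / n%:R) <= y n.
  apply: le_trans h; rewrite ler_pM2l// lerDl divr_ge0 ?ler0n//.
rewrite -(subnKC Nn); elim: (n - N)%N => [|k IH]; first by rewrite addn0 subrK mulr1.
rewrite addnS; set m := (N + k)%N in IH *.
have m0 : (0 < m)%N by rewrite /m addn_gt0 N0.
have [_ /(_ m)[pm qm]] := reg.
have p2 : 0 < (p ^+ 2).[m.+1%:R] by rewrite horner_exp exprn_even_gt0.
have := pos_fromP posK (leqW (leq_addr k N) : (N <= m.+1)%N).
rewrite hornerD hornerZ hornerN (hornerM ('X ^+ 2)) hornerXn hornerD hornerN => hK.
have mr : 0 < m.+1%:R :> rat by rewrite ltr0n.
have mr0 : 0 < m%:R :> rat by rewrite ltr0n.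
have step : y m * (1 - K%:R / m.+1%:R ^+ 2) <= y m.+1.
  rewrite /y useq_sqS ler_pM2l ?useq_gt0// ler_pdivlMr//.
  rewrite mulrBl mul1r lerBlDr -lerBlDl mulrAC ler_pdivlMr ?exprn_gt0//.
  by rewrite mulrC; lra.
have yNm : y m <= y N by apply: (decr_from_le reg dec); rewrite ?leq_addr.
apply: le_trans step; rewrite mulrBr mulr1.
apply: (@le_trans _ _ (y N * (1 - K%:R / N%:R + K%:R / m%:R) - y N * (K%:R / m.+1%:R ^+ 2))); last first.
  by apply: lerB => //; apply: ler_wpM2r => //; rewrite divr_ge0 ?ler0n// exprn_ge0// ltW.
rewrite -mulrBr ler_pM2l// -!addrA lerD2l lerD2l lerBrDr.
rewrite -mulrDr; apply: ler_wpM2l; first exact: ler0n.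
rewrite -natr1 in mr *; set x := m%:R in mr mr0 *.
rewrite -subr_ge0 (_ : _ - _ = (x * (x + 1) ^+ 2)^-1); last first.
  by field; rewrite !gt_eqF.
by rewrite invr_ge0 mulr_ge0 ?exprn_ge0 ?ltW.
Qed.

(* If p^2 - q^2 has degree deg p^2 or deg p^2 - 1, then
   y (n+1) <= y n (1 - e / (n+1)) eventually, and the divergence of the harmonic
   series drives y below any positive bound. *)
Lemma size_sub_sqr p q u t N0 : regular p q u -> t != 0 ->
  0 < lead_coef (p ^+ 2 - q ^+ 2) ->
  (forall n, (N0 <= n)%N -> t ^+ 2 <= useq p q u n ^+ 2) ->
  ((size (p ^+ 2 - q ^+ 2)%R).+2 <= size (p ^+ 2)%R)%N.
Proof.
move=> reg t0 lc ht; rewrite leqNgt; apply/negP => sz.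
set D := p ^+ 2 - q ^+ 2 in lc sz *.
have D0 : D != 0 by rewrite -lead_coef_eq0 gt_eqF.
have p0 : p != 0.
  by have [_ /(_ 0%N)[+ _]] := reg; apply: contraNneq => ->; rewrite horner0.
have E0 : p ^+ 2 != 0 by rewrite expf_neq0.
have lE : 0 < lead_coef (p ^+ 2) by rewrite lead_coef_exp exprn_even_gt0//= lead_coef_eq0.
have t2 : 0 < t ^+ 2 by rewrite exprn_even_gt0.
(* Half the quotient of the leading coefficients: X D - e p^2 keeps a positive leading coefficient
   even when X D and p^2 have the same degree. *)
pose e : rat := lead_coef D / lead_coef (p ^+ 2) / 2.
have e0 : 0 < e by rewrite !divr_gt0.
have lc2 : 0 < lead_coef ('X * D - e *: p ^+ 2).
  have sX : size ('X * D) = (size D).+1 by rewrite mulrC size_mulX.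
  have lX : ('X * D)`_(size D) = lead_coef D.
    by rewrite coefXM size_poly_eq0 (negbTE D0) lead_coefE.
  have c : 0 < ('X * D - e *: p ^+ 2)`_(size D).
    rewrite coefB lX coefZ; move: sz; rewrite ltnS leq_eqVlt => /orP[/eqP sz|sz].
      rewrite [size D](_ : _ = (size (p ^+ 2)).-1); last by rewrite sz.
      rewrite -lead_coefE /e.
      have -> : lead_coef D - lead_coef D / lead_coef (p ^+ 2) / 2 * lead_coef (p ^+ 2) = lead_coef D / 2.
        by field; rewrite gt_eqF.
      by rewrite divr_gt0.
    by rewrite nth_default// mulr0 subr0.
  rewrite (@lead_coef_eq _ (size D))// ?gt_eqF//.
  rewrite (leq_trans (size_polyD _ _))// geq_max sX leqnn/= size_polyN.
  by rewrite (leq_trans (size_scale_leq _ _)).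
have [N1 hN1] := pos_from_eventually lc2.
have [N2 hN2] := pos_from_eventually lc.
pose N := (maxn 1 (maxn N0 (maxn N1 N2))).
have NN0 : (N0 <= N)%N by rewrite /N; lia.
have NN1 : (N1 <= N)%N by rewrite /N; lia.
have NN2 : (N2 <= N)%N by rewrite /N; lia.
have Npos : (0 < N)%N by rewrite /N; lia.
set y := fun n => useq p q u n ^+ 2 in ht.
have y0 k : 0 < y k by exact: useq_gt0.
have step m : (N <= m)%N -> y m.+1 <= y m - e * t ^+ 2 / m.+1%:R.
  move=> Nm; have [_ /(_ m)[pm qm]] := reg.
  have := pos_fromP (hN1 N NN1) (leqW Nm).
  rewrite hornerD (hornerM 'X) hornerX hornerN hornerZ /D hornerD hornerN => h.
  have p2 : 0 < (p ^+ 2).[m.+1%:R] by rewrite horner_exp exprn_even_gt0.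
  have mr : 0 < m.+1%:R :> rat by rewrite ltr0n.
  have q1 : (q ^+ 2).[m.+1%:R] / (p ^+ 2).[m.+1%:R] <= 1 - e / m.+1%:R.
    rewrite ler_pdivrMr// mulrBl mul1r lerBrDr -lerBrDl mulrAC ler_pdivrMr//.
    by rewrite [leRHS]mulrC; lra.
  rewrite /y useq_sqS -/(y m).
  apply: (@le_trans _ _ (y m * (1 - e / m.+1%:R))); first by rewrite ler_pM2l.
  rewrite mulrBr mulr1 lerD2l lerN2 mulrAC mulrC.
  apply: ler_wpM2r; first by rewrite divr_ge0 ?ltW.
  by apply: ht; rewrite (leq_trans NN0).
(* Doubling, as for the harmonic series: each of the m steps from m to 2m lowers y by at least e
   t^2/(2m). *)
have dbl m : (N <= m)%N -> y (m + m)%N <= y m - e * t ^+ 2 / 2.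
  move=> Nm; have m0 : (0 < m)%N by exact: leq_trans Nm.
  have mr : 0 < m%:R :> rat by rewrite ltr0n.
  have gen j : (j <= m)%N -> y (m + j)%N <= y m - j%:R * (e * t ^+ 2 / (2 * m%:R)).
    elim: j => [|j IH] jm; first by rewrite addn0 mul0r subr0.
    rewrite addnS; apply: (le_trans (step _ _)); first by rewrite (leq_trans Nm)// leq_addr.
    have := IH (ltnW jm) => {}IH.
    apply: (@le_trans _ _ (y m - j%:R * (e * t ^+ 2 / (2 * m%:R)) - e * t ^+ 2 / (2 * m%:R))); last first.
      by rewrite -natr1; lra.
    apply: lerB => //; apply: ler_wpM2l; first by rewrite mulr_ge0 ?ltW.
    rewrite lef_pV2 ?posrE ?mulr_gt0// ?ltr0n// -natrM ler_nat mul2n -addnn.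
    by rewrite -addnS leq_add2l.
  apply: (le_trans (gen m (leqnn m))); rewrite le_eqVlt; apply/orP; left; apply/eqP.
  by field; rewrite gt_eqF.
have iter k : y (2 ^ k * N)%N <= y N - k%:R * (e * t ^+ 2 / 2).
  elim: k => [|k IH]; first by rewrite expn0 mul1n mul0r subr0.
  have : (N <= 2 ^ k * N)%N by rewrite leq_pmull// expn_gt0.
  move=> /dbl; rewrite addnn -mul2n mulnA -expnS => h.
  by rewrite -natr1; lra.
have c0 : 0 < e * t ^+ 2 / 2 by rewrite divr_gt0// mulr_gt0.
have := iter (Num.truncn (y N / (e * t ^+ 2 / 2))).+1.
have := truncnS_gt (y N / (e * t ^+ 2 / 2)); rewrite ltr_pdivrMr// => h1 h2.
by have := y0 (2 ^ (Num.truncn (y N / (e * t ^+ 2 / 2))).+1 * N)%N; lra.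
Qed.

(** Either some late square falls below t^2, or all late squares stay above t^2 + d for a fixed d,
    or they tend to t^2. The last case comes with the degree gap from which the conditions of the
    limit formula are extracted. *)
Lemma complete_decreasing p q u t : regular p q u -> t != 0 ->
  0 < lead_coef (p ^+ 2 - q ^+ 2) ->
  [\/ exists N0, forall N, (N0 <= N)%N -> below_from p q u t N,
      exists K N0, forall N, (N0 <= N)%N -> above_from p q u t N K |
      ((size (p ^+ 2 - q ^+ 2)%R).+2 <= size (p ^+ 2)%R)%N /\
      forall d, 0 < d -> exists N0, forall N, (N0 <= N)%N ->
        t ^+ 2 <= useq p q u N ^+ 2 < t ^+ 2 + d].
Proof.
move=> reg t0 lc.
have [N2 hN2] := pos_from_eventually lc.
have dec : decr_from p q N2 by exact: hN2.
set y := fun n => useq p q u n ^+ 2.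
have [[N1 N12 lt]|nbelow] := pselect (exists2 N1, (N2 <= N1)%N & y N1 < t ^+ 2).
  constructor 1; exists N1 => N N1N; apply/andP; split.
    by apply: hN2; exact: leq_trans N1N.
  by apply: le_lt_trans lt; exact: (decr_from_le reg dec).
have ge n : (N2 <= n)%N -> t ^+ 2 <= y n.
  by move=> Nn; rewrite leNgt; apply/negP => lt; apply: nbelow; exists n.
have sz := size_sub_sqr reg t0 lc ge.
have t2 : 0 < t ^+ 2 by rewrite exprn_even_gt0.
have [[d d0 hd]|nd] := pselect (exists2 d : rat, 0 < d & forall n, (N2 <= n)%N -> t ^+ 2 + d <= y n).
  constructor 2.
  set D := p ^+ 2 - q ^+ 2 in lc sz *.
  have p0 : p != 0.
    by have [_ /(_ 0%N)[+ _]] := reg; apply: contraNneq => ->; rewrite horner0.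
  have lE : 0 < lead_coef (p ^+ 2) by rewrite lead_coef_exp exprn_even_gt0//= lead_coef_eq0.
  have D0 : D != 0 by rewrite -lead_coef_eq0 gt_eqF.
  set e := (size (p ^+ 2)).-1.
  have sE : size (p ^+ 2) = e.+1.
    by rewrite /e prednK// lt0n size_poly_eq0 expf_neq0.
  (* The degree gap gives deg(X^2 D) <= e = deg p^2, so a K above the ratio of the coefficients at
     degree e makes K p^2 - X^2 D eventually positive. *)
  pose K := (Num.truncn (('X ^+ 2 * D)`_e / lead_coef (p ^+ 2))).+1.
  have lK : 0 < lead_coef (K%:R *: p ^+ 2 - 'X ^+ 2 * D).
    have c : 0 < (K%:R *: p ^+ 2 - 'X ^+ 2 * D)`_e.
      rewrite coefB coefZ -lead_coefE subr_gt0 -ltr_pdivrMr//.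
      exact: truncnS_gt.
    rewrite (@lead_coef_eq _ e)// ?gt_eqF//.
    rewrite (leq_trans (size_polyD _ _))// geq_max size_polyN -sE.
    rewrite (leq_trans (size_scale_leq _ _))//= mulrC size_mulXn//.
  have [N3 hN3] := pos_from_eventually lK.
  (* Large enough for (t^2 + d)(1 - K/N) > t^2. *)
  pose N4 := (Num.truncn ((t ^+ 2 + d) * K%:R / d)).+1.
  exists K, (maxn (maxn N2 N3) N4) => N.
  rewrite !geq_max => /andP[/andP[h2 h3] h4].
  apply/and3P; split; [exact: hN2|exact: hN3|].
  have N0 : 0 < N%:R :> rat by rewrite ltr0n (leq_trans _ h4).
  have h5 : (t ^+ 2 + d) * K%:R / d < N%:R.
    by apply: (lt_le_trans (truncnS_gt _)); rewrite ler_nat.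
  have K1 : 0 <= 1 - K%:R / N%:R :> rat.
    rewrite subr_ge0 ler_pdivrMr// mul1r; apply: ltW; apply: le_lt_trans h5.
    rewrite ler_pdivlMr// mulrC; apply: ler_wpM2r; first exact: ler0n.
    by rewrite lerDr ltW.
  apply: (@lt_le_trans _ _ ((t ^+ 2 + d) * (1 - K%:R / N%:R))); last first.
    by apply: ler_wpM2r => //; exact: hd.
  rewrite mulrBr mulr1 ltrBrDr -ltrBrDl addrAC subrr add0r mulrA.
  rewrite ltr_pdivrMr// mulrC; move: h5; rewrite ltr_pdivrMr//.
  by rewrite [N%:R * _]mulrC [_ * K%:R]mulrC.
constructor 3; split=> // d d0.
have [n Nn lt] : exists2 n, (N2 <= n)%N & y n < t ^+ 2 + d.
  have [h|h] := pselect (exists2 n, (N2 <= n)%N & y n < t ^+ 2 + d) => //.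
  exfalso; apply: nd; exists d => // n Nn; rewrite leNgt; apply/negP => lt.
  by apply: h; exists n.
exists n => N nN; apply/andP; split; first by apply: ge; exact: leq_trans nN.
by apply: le_lt_trans lt; exact: (decr_from_le reg dec).
Qed.

End Sequences.

(** * Recognizing the limit *)

(** A root a contributes the factors n + 1 - a = (1 - a) + n, that is, a rising factorial at 1 -
    a. *)
Definition reflect1 (s : seq rat) : seq rat := [seq 1 - x | x <- s].

Definition poly_of_roots (c : rat) (s : seq rat) : {poly rat} :=
  c *: \prod_(a <- s) ('X - a%:P).

Section Limits.
Variable R : realType.
Implicit Types (p q : {poly rat}) (u t : rat) (A B : seq rat).

Lemma horner_poly_of_roots c A n :
  (poly_of_roots c A).[n.+1%:R] = c * \prod_(x <- reflect1 A) (x + n%:R).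
Proof.
rewrite /poly_of_roots hornerZ horner_prod big_map; congr (_ * _).
by apply: eq_bigr => a _; rewrite hornerXsubC -natr1; ring.
Qed.

Lemma nonpole_reflect1 c A : (forall n : nat, (poly_of_roots c A).[n.+1%:R] != 0) ->
  {in reflect1 A, forall x, nonpole_rat x}.
Proof.
move=> h x xA i; have := h i; rewrite horner_poly_of_roots mulf_eq0 negb_or.
by move=> /andP[_]; rewrite prodf_seq_neq0 => /allP /(_ x xA).
Qed.

Lemma nonpole_map_ratr A : {in A, forall x, nonpole_rat x} ->
  {in [seq ratr x : R | x <- A], forall x, nonpole x}.
Proof. by move=> h _ /mapP[x xA ->]; apply/nonpole_ratr/h. Qed.

Lemma ratr_useq cp cq A B u n :
  ratr (useq (poly_of_roots cp B) (poly_of_roots cq A) u n) =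
  ratr u * ratr (cq / cp) ^+ n *
  (\prod_(x <- [seq ratr x : R | x <- reflect1 A]) poch x n /
   \prod_(x <- [seq ratr x : R | x <- reflect1 B]) poch x n).
Proof.
have prodS C k : \prod_(x <- [seq ratr x : R | x <- C]) poch x k.+1 =
    \prod_(x <- [seq ratr x : R | x <- C]) poch x k *
    ratr (\prod_(x <- C) (x + k%:R)).
  rewrite -[ratr _]/((ratr : {rmorphism rat -> R}) _) rmorph_prod/=.
  rewrite !big_map -big_split/=; apply: eq_bigr => x _.
  by rewrite /poch big_ord_recr/= rmorphD/= ratr_nat.
elim: n => [|n IH].
  rewrite useq0 expr0 mulr1 !big1 ?divr1 ?mulr1// => x _; by rewrite /poch big_ord0.
rewrite useqS rmorphM/= IH !horner_poly_of_roots !prodS exprS.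
rewrite !(fmorph_div, rmorphM)/=.
set a := ratr (\prod_(x <- reflect1 A) _); set b := ratr (\prod_(x <- reflect1 B) _).
by rewrite !invfM; ring.
Qed.

(** Equal numbers and equal sums of roots are what [poch_quotient_cvg] asks for; the ratio of the
    leading coefficients is 1 or -1, and squaring removes it. *)
Lemma useq_limit cp cq A B u : size A = size B ->
  \sum_(a <- A) a = \sum_(b <- B) b -> cp ^+ 2 = cq ^+ 2 ->
  regular (poly_of_roots cp B) (poly_of_roots cq A) u ->
  (ratr (useq (poly_of_roots cp B) (poly_of_roots cq A) u n ^+ 2) : R)
    @[n --> \oo] -->
  ratr u ^+ 2 * (Gprod R (reflect1 B) / Gprod R (reflect1 A)) ^+ 2.
Proof.
move=> sAB sumAB c2 [u0 reg].
have pB := nonpole_reflect1 (fun n => (reg n).1).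
have pA := nonpole_reflect1 (fun n => (reg n).2).
have cp0 : cp != 0.
  have [+ _] := reg 0%N; apply: contraNneq => ->.
  by rewrite horner_poly_of_roots mul0r.
have sum_map C : \sum_(x <- [seq ratr x : R | x <- reflect1 C]) x =
    (size C)%:R - ratr (\sum_(c <- C) c).
  rewrite -[ratr _]/((ratr : {rmorphism rat -> R}) _) rmorph_sum/= !big_map.
  rewrite -sum1_size natr_sum -sumrB; apply: eq_bigr => x _.
  by rewrite rmorphB rmorph1.
set s := [seq ratr x : R | x <- reflect1 A].
set s' := [seq ratr x : R | x <- reflect1 B].
have cvgs : \prod_(x <- s) poch x n / \prod_(x <- s') poch x n @[n --> \oo] -->
    (\prod_(x <- s') Gamma x / \prod_(x <- s) Gamma x : R).
  apply: poch_quotient_cvg; rewrite ?size_map ?sum_map ?sAB ?sumAB//;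
    exact: nonpole_map_ratr.
have -> : Gprod R (reflect1 B) / Gprod R (reflect1 A) =
    \prod_(x <- s') Gamma x / \prod_(x <- s) Gamma x by rewrite !(big_map ratr).
rewrite [X in X @ _ --> _](_ : _ = (fun n => ratr u ^+ 2 *
    ((\prod_(x <- s) poch x n / \prod_(x <- s') poch x n) *
    (\prod_(x <- s) poch x n / \prod_(x <- s') poch x n)) : R)); last first.
  have c1 : ratr (cq / cp) ^+ 2 = 1 :> R.
    by rewrite -(rmorphXn (ratr : {rmorphism rat -> R})) expr_div_n -c2 divff ?rmorph1 ?expf_neq0.
  apply/funext => n; rewrite rmorphXn/= ratr_useq -/s -/s'.
  move: (ratr (cq / cp)) c1 => c c1; move: (_ / _) => z.
  rewrite !exprMn; by rewrite -exprM mulnC exprM c1 expr1n mulr1 -expr2.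
rewrite [in X in _ --> X]expr2; apply: cvgM; first exact: cvg_cst.
by apply: cvgM.
Qed.

(** If y_n <= t^2, then y_(n+1) < t^2 by strict decrease, and this bound passes to the limit. *)
Lemma useq_gt_limit p q u t N : regular p q u -> decr_from p q N ->
  (ratr (useq p q u n ^+ 2) : R) @[n --> \oo] --> (ratr (t ^+ 2) : R) ->
  forall n, (N <= n)%N -> t ^+ 2 < useq p q u n ^+ 2.
Proof.
move=> reg dec lim n Nn; rewrite ltNge; apply/negP => h.
have lt := lt_le_trans (decr_fromP reg dec Nn) h.
have : ratr (t ^+ 2) <= ratr (useq p q u n.+1 ^+ 2) :> R.
  apply: (cvgr_to_le lim); near=> m; rewrite ler_rat.
  apply: (decr_from_le reg dec); first exact: leqW.
  by near: m; exact: nbhs_infty_ge.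
by rewrite ler_rat leNgt lt.
Unshelve. all: by end_near.
Qed.

(** Links the product over all rationals in the conjecture to finite lists; splitting an exponent
    into a difference uses that Gamma does not vanish at the arguments. *)
Lemma gamma_monomial_counts (s t : seq rat) :
  {in s, forall x, nonpole_rat x} -> {in t, forall x, nonpole_rat x} ->
  gamma_monomial R 0 (fun x => (count_mem x s)%:Z - (count_mem x t)%:Z) =
  Gprod R s / Gprod R t.
Proof.
move=> sp tp; rewrite /gamma_monomial mul0r powRr0 mul1r.
have prod_count r C : uniq r -> {subset C <= r} -> forall F : rat -> R,
    \prod_(x <- r) F x ^+ count_mem x C = \prod_(x <- C) F x.
  move=> ur; elim: C => [|c C IH] Cr F.
    by rewrite big_nil big1// => x _; rewrite expr0.
  rewrite big_cons -IH => [|x xC]; last by apply: Cr; rewrite in_cons xC orbT.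
  rewrite /=; under eq_bigr do rewrite exprD; rewrite big_split/=; congr (_ * _).
  rewrite (bigD1_seq c)//=; last by apply: Cr; rewrite in_cons eqxx.
  by rewrite eqxx expr1 big1 ?mulr1// => x /negbTE xc; rewrite eq_sym xc expr0.
pose r := undup (s ++ t).
have nonpole_r x : x \in r -> nonpole_rat x.
  by rewrite mem_undup mem_cat => /orP[/sp|/tp].
rewrite fsbig_supp (fsbig_fwiden r); first last.
- move=> x [xr nx] /=; apply: contrapT => h; apply: nx; split=> //.
- exact: undup_uniq.
- move=> x [_ /=]; rewrite mem_undup mem_cat; apply: contra_notT.
  rewrite negb_or => /andP[xs xt].
  by rewrite (count_memPn xs) (count_memPn xt) subrr expr0z.
rewrite /Gprod -(prod_count r s)//; last 2 first.
- exact: undup_uniq.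
- by move=> x xs; rewrite mem_undup mem_cat xs.
rewrite -(prod_count r t)//; last 2 first.
- exact: undup_uniq.
- by move=> x xt; rewrite mem_undup mem_cat xt orbT.
rewrite -prodfV -big_split/= !big_seq; apply: eq_bigr => x xr.
rewrite expfzDr ?Gamma_neq0//; last exact/nonpole_ratr/nonpole_r.
by rewrite exprnP exprnN.
Qed.

End Limits.

(** * Certificates for the value of the limit *)

Section Certificate.
Variable R : realType.
Implicit Types (p q : {poly rat}) (u t : rat) (A B : seq rat).

(** A finite test for an infinite condition: from M on, x + i is positive. A suitable M is part of
    the certificate. *)
Definition nonpole_check (M : nat) (x : rat) : bool :=
  (0 < x + M%:R) && all (fun i => x + i%:R != 0) (iota 0 M).

Lemma nonpole_checkP M x : nonpole_check M x -> nonpole_rat x.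
Proof.
move=> /andP[xM /allP h] i; have [iM|Mi] := ltnP i M.
  by apply: h; rewrite mem_iota.
by rewrite gt_eqF// (lt_le_trans xM)// lerD2l ler_nat.
Qed.

Lemma nonpole_check_bound (s : seq rat) : {in s, forall x, nonpole_rat x} ->
  exists M, all (nonpole_check M) s.
Proof.
move=> sp; exists (\max_(x <- s) (Num.truncn `|x|).+1)%N; apply/allP => x xs.
apply/andP; split; last by apply/allP => i _; exact: sp.
rewrite -ltrBlDr sub0r ltrNl; apply: (@lt_le_trans _ _ (Num.truncn `|x|).+1%:R).
  by apply: le_lt_trans (truncnS_gt _); rewrite -normrN ler_norm.
by rewrite ler_nat; exact: (leq_bigmax_seq (F := fun x => (Num.truncn `|x|).+1) x xs).
Qed.

Definition gen_check (N M : nat) (g : cgen) : bool :=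
  (0 < g.1.2)%N &&
  all (nonpole_check M) (gen_num (gen_of N g) ++ gen_den (gen_of N g)).

Definition refl_count (P : seq cgen) : nat :=
  (\sum_(g <- P) (if g.1.1 == 1 then 1 else 0))%N.

Lemma refl_countE N P : refl_count P = count (gen_refl \o gen_of N) P.
Proof. by rewrite -sum1_count big_mkcond. Qed.

(** In order: the roots A of q and B of p; N, K and the bound M of [nonpole_check]; the generators P
    and Q; the cofactor W. *)
Definition certificate : Type :=
  ((seq rat * seq rat) * ((nat * nat) * nat)) *
  ((seq cgen * seq cgen) * {poly rat}).

(* [t ^ 2] is the limit of [useq p q u n ^ 2]: by [useq_limit] this limit is a
   quotient of Gamma values, and the certificate derives the value of a power
   of it from the standard relations at arguments with denominator [N]. *)
Definition limit_check (x : input) (c : certificate) : bool :=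
  let p := x.1.1 in let q := x.1.2 in let u := x.2.1 in let t := x.2.2 in
  let A := c.1.1.1 in let B := c.1.1.2 in
  let N := c.1.2.1.1 in let K := c.1.2.1.2 in let M := c.1.2.2 in
  let P := c.2.1.1 in let Q := c.2.1.2 in let W := c.2.2 in
  [&& p == poly_of_roots (lead_coef p) B, q == poly_of_roots (lead_coef q) A,
      size A == size B, \sum_(a <- A) a == \sum_(b <- B) b,
      lead_coef p ^+ 2 == lead_coef q ^+ 2, (0 < N)%N, (0 < K)%N,
      all (gen_check N M) (P ++ Q), refl_count P == refl_count Q,
      perm_eq
        (flatten (nseq K (reflect1 B)) ++
          flatten [seq gen_den (gen_of N g) | g <- P] ++
          flatten [seq gen_num (gen_of N g) | g <- Q])
        (flatten (nseq K (reflect1 A)) ++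
          flatten [seq gen_num (gen_of N g) | g <- P] ++
          flatten [seq gen_den (gen_of N g) | g <- Q]) &
      cyclotomic_check N (value_poly N K u t P Q) W].

Lemma limit_check_sound p q u t c : regular p q u ->
  limit_check (p, q, (u, t)) c ->
  (ratr (useq p q u n ^+ 2) : R) @[n --> \oo] --> (ratr (t ^+ 2) : R).
Proof.
case: c => [[[A B] [[N K] M]] [[P Q] W]] reg; rewrite /limit_check/=.
case/and5P => /eqP pB /eqP qA /eqP sAB /eqP sumAB.
case/and5P => /eqP c2 N0 K0 /allP gens /andP[/eqP cPQ /andP[perm cyc]].
rewrite pB qA in reg *.
have pole_B := nonpole_reflect1 (fun n => (reg.2 n).1).
have pole_A := nonpole_reflect1 (fun n => (reg.2 n).2).
rewrite (_ : ratr (t ^+ 2) = ratr u ^+ 2 *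
  (Gprod R (reflect1 B) / Gprod R (reflect1 A)) ^+ 2); first exact: useq_limit.
rewrite rmorphXn/=; apply/(@value_polyP R N K u t P Q) => //.
- move=> g /gens /andP[g0 /allP h]; split=> // x xg; exact: nonpole_checkP (h x xg).
- by rewrite -!refl_countE.
- by apply/(cyclotomic_checkP N0 (zeta_prim R N0)); exists W.
Qed.

(** N is the product of the denominators; a negative numerator over N goes to the second entry of
    the pair. *)
Lemma common_denominator (S : seq generator) :
  exists N (S' : seq cgen), (0 < N)%N /\ map (gen_of N) S' = S.
Proof.
pose N := (\prod_(g <- S) `|denq g.2|)%N.
have N0 : (0 < N)%N.
  by rewrite prodn_gt0// => g; rewrite absz_gt0 denq_neq0.
pose code_arg (x : rat) : nat * nat :=
  match numq (x * N%:R) with Posz j => (j, 0%N) | Negz j => (0%N, j.+1) end.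
exists N, [seq (g.1, code_arg g.2) | g <- S]; split=> //.
rewrite -map_comp; apply: map_id_in => -[[k n] a] gS /=; congr (_, _).
have aN : a * N%:R = (numq (a * N%:R))%:~R.
  have /dvdnP[d e] : (`|denq a| %| N)%N.
    by rewrite /N (big_rem _ gS)/= dvdn_mulr.
  rewrite e natrM mulrCA mulrC.
  have -> : `|denq a|%N%:R = (denq a)%:~R :> rat by rewrite natr_absz ger0_norm// denq_ge0.
  have -> : a * (denq a)%:~R = (numq a)%:~R.
    by rewrite -[X in X * _]divq_num_den divfK// intr_eq0 denq_neq0.
  by rewrite -[d%:R]/(d%:Z%:~R) -intrM numq_int.
rewrite /cgen_arg/= /code_arg.
have n0 : N%:R != 0 :> rat by rewrite pnatr_eq0 -lt0n.
rewrite -[RHS](mulfK n0); move: (numq _) aN => z ->; congr (_ / _).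
by case: z => j /=; rewrite ?subr0 ?sub0r// NegzE mulrNz.
Qed.

(** By the degree gap p^2 and q^2 agree in their two top coefficients, which gives equal degrees,
    equal squared leading coefficients and equal sums of roots, as [useq_limit] requires. The Gamma
    quotient is then t/u or -t/u, hence algebraic, and the conjecture supplies a derivation. *)
Lemma limit_check_complete p q u t : rohrlich_conjecture R ->
  splits p -> splits q -> regular p q u ->
  ((size (p ^+ 2 - q ^+ 2)%R).+2 <= size (p ^+ 2)%R)%N ->
  (ratr (useq p q u n ^+ 2) : R) @[n --> \oo] --> (ratr (t ^+ 2) : R) ->
  exists c, limit_check (p, q, (u, t)) c.
Proof.
move=> rohrlich [B pB] [A qA] reg sz lim.
rewrite -/(poly_of_roots _ _) in pB; rewrite -/(poly_of_roots _ _) in qA.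
have p0 : p != 0.
  by have [_ /(_ 0%N)[+ _]] := reg; apply: contraNneq => ->; rewrite horner0.
have q0 : q != 0.
  by have [_ /(_ 0%N)[_ +]] := reg; apply: contraNneq => ->; rewrite horner0.
have sq f C : f != 0 -> f = poly_of_roots (lead_coef f) C ->
    f ^+ 2 = lead_coef f ^+ 2 *: \prod_(c <- C ++ C) ('X - c%:P).
  by move=> f0 fC; rewrite [in LHS]fC /poly_of_roots exprZn expr2 big_cat.
have sizeE f C : f != 0 -> f = poly_of_roots (lead_coef f) C ->
    size (f ^+ 2) = (size (C ++ C)).+1.
  move=> f0 fC; rewrite (sq f C)// size_scale ?size_prod_XsubC//.
  by rewrite expf_neq0// lead_coef_eq0.
have sp := sizeE p B p0 pB; have sq' := sizeE q A q0 qA.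
have sAB : size (A ++ A) = size (B ++ B).
  have [lt|lt|//] := ltngtP (size (A ++ A)) (size (B ++ B)); exfalso.
    by move: sz; rewrite size_polyDl ?size_polyN ?sp ?sq'// ltnNge ltnW.
  move: sz; rewrite addrC size_polyDl ?size_polyN ?sp ?sq'//.
  by move: lt; move: (size (A ++ A)) (size (B ++ B)) => a b; lia.
(* As deg p^2 is the size of [B ++ B], this is agreement from degree deg p^2 - 1 on. *)
have coef0 i : (size (B ++ B) <= i.+1)%N -> (p ^+ 2)`_i = (q ^+ 2)`_i.
  move=> hi; apply/eqP; rewrite -subr_eq0 -coefB nth_default//.
  by move: sz; rewrite sp ltnS => {}sz; rewrite -ltnS (leq_trans sz).
have c2 : lead_coef p ^+ 2 = lead_coef q ^+ 2.
  by rewrite -!lead_coef_exp !lead_coefE sp sq' sAB /= coef0.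
have sAB' : size A = size B by move: sAB; rewrite !size_cat !addnn => /double_inj.
have sumAB : \sum_(a <- A) a = \sum_(b <- B) b.
  have [B0|B0] := eqVneq (size B) 0%N.
    by rewrite (size0nil B0) (size0nil (etrans sAB' B0)).
  have := coef0 (size (B ++ B)).-1 (leqSpred _).
  rewrite (sq p B)// (sq q A)// !coefZ -c2.
  move/mulfI => /(_ (expf_neq0 _ _)); rewrite lead_coef_eq0 => /(_ p0).
  (* The subleading coefficient of a product of X - a is minus the sum of the roots; here each root
     counts twice. *)
  rewrite -[in X in _ = X -> _]sAB !coefPn_prod_XsubC ?size_cat ?sAB' ?addn_eq0 ?negb_and ?B0//.
  move/oppr_inj; rewrite !big_cat/= -!mulr2n => /eqP.
  by rewrite -subr_eq0 -mulrnBl mulrn_eq0/= subr_eq0 => /eqP.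
rewrite pB qA in reg lim.
have pole_B := nonpole_reflect1 (fun n => (reg.2 n).1).
have pole_A := nonpole_reflect1 (fun n => (reg.2 n).2).
have tg : ratr t ^+ 2 = ratr u ^+ 2 *
    (Gprod R (reflect1 B) / Gprod R (reflect1 A)) ^+ 2 :> R.
  rewrite -rmorphXn/=; apply: (cvg_unique _ lim); first exact: Rhausdorff.
  exact: useq_limit.
have u0 : ratr u != 0 :> R by rewrite fmorph_eq0; case: reg.
have alg : algebraicOver (ratr : rat -> R)
    (Gprod R (reflect1 B) / Gprod R (reflect1 A)).
  have : (Gprod R (reflect1 B) / Gprod R (reflect1 A)) ^+ 2 = (ratr (t / u)) ^+ 2 :> R.
    apply: (mulfI (expf_neq0 2 u0)); rewrite -tg -exprMn.
    by rewrite (_ : ratr u * _ = ratr t)// -rmorphM/= mulrC divfK//; case: reg.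
  move/eqP; rewrite eqf_sqr => /orP[]/eqP ->; first exact: algebraic_id.
  by rewrite -rmorphN; exact: algebraic_id.
rewrite -gamma_monomial_counts// in alg.
have [||K [P [Q [K0 vPQ cPQ perm]]]] := gamma_consequence_lists (rohrlich _ _ _ _ alg).
- apply: (@sub_finite_set _ _ [set` reflect1 B ++ reflect1 A]); last exact: finite_seq.
  move=> x /=; apply: contra_neqT; rewrite mem_cat negb_or => /andP[xB xA].
  by rewrite (count_memPn xB) (count_memPn xA) subrr.
- move=> x xp; have np C : {in C, forall x, nonpole_rat x} -> count_mem x C = 0%N.
    by move=> h; apply/count_memPn; apply: contraTN xp => /h/nonpole_ratP.
  by rewrite !np.
have [N [S [N0 SPQ]]] := common_denominator (P ++ Q).
pose P' := take (size P) S; pose Q' := drop (size P) S.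
have eP : map (gen_of N) P' = P by rewrite map_take SPQ take_size_cat.
have eQ : map (gen_of N) Q' = Q by rewrite map_drop SPQ drop_size_cat.
have [|M /allP hM] := @nonpole_check_bound
    (flatten [seq gen_num (gen_of N g) ++ gen_den (gen_of N g) | g <- P' ++ Q']).
  move=> x /flatten_mapP[g gPQ]; apply: (vPQ (gen_of N g) _).2.
  by rewrite -eP -eQ -map_cat map_f.
have v' g : g \in P' ++ Q' -> gen_valid (gen_of N g).
  by move=> gPQ; apply: vPQ; rewrite -eP -eQ -map_cat map_f.
have cPQ' : count (gen_refl \o gen_of N) P' = count (gen_refl \o gen_of N) Q'.
  by rewrite -!count_map eP eQ.
have perm' : perm_eq
    (flatten (nseq K (reflect1 B)) ++ flatten (map (gen_den \o gen_of N) P') ++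
       flatten (map (gen_num \o gen_of N) Q'))
    (flatten (nseq K (reflect1 A)) ++ flatten (map (gen_num \o gen_of N) P') ++
       flatten (map (gen_den \o gen_of N) Q')).
  by rewrite !map_comp eP eQ.
have /(cyclotomic_checkP N0 (zeta_prim R N0))[W cyc] :
    ev (zeta R N) (value_poly N K u t P' Q') = 0.
  exact: (@value_polyP R N K u t P' Q' _ _ N0 K0 v' cPQ' pole_A pole_B perm').2.
exists ((A, B, (N, K, M)), ((P', Q'), W)); rewrite /limit_check/=.
rewrite -pB -qA !eqxx sAB' sumAB c2 !eqxx N0 K0 perm' cyc (refl_countE N P') cPQ' -refl_countE eqxx /= !andbT.
apply/allP => g gPQ; apply/andP; split; first by have [] := v' g gPQ.
by apply/allP => x xg; apply: hM; apply/flatten_mapP; exists g.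
Qed.

End Certificate.

(** * Computability of the checks *)

Section ComputableChecks.
Context {X : Type} {cX : code X}.

Lemma computable_ext (A : Type) {cA : code A} (f g : X -> A) :
  f =1 g -> computable f -> computable g.
Proof. by move=> /funext ->. Qed.

Lemma computable_pred (n : X -> nat) : computable n -> computable (fun x => (n x).-1).
Proof.
by move=> cn; apply: (computable_ext (fun x => subn1 (n x))); computable_tac.
Qed.

Lemma computable_iota1 (n : X -> nat) :
  computable n -> computable (fun x => iota 1 (n x)).
Proof.
move=> cn; apply: (@computable_ext _ _ (fun x => map succn (iota 0 (n x)))).
  by move=> x; rewrite (iotaDl 1 0).
by computable_tac.
Qed.

Lemma computable_lead_coef (f : X -> {poly rat}) :
  computable f -> computable (fun x => lead_coef (f x)).
Proof.
move=> cf; apply: computable_coef => //; apply: computable_pred; exact: computable_sizep.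
Qed.

Ltac computable_user ::= first
  [ apply: computable_pred | apply: computable_iota1 | apply: computable_lead_coef ].

Lemma computable_pos_from (f : X -> {poly rat}) (N : X -> nat) :
  computable f -> computable N -> computable (fun x => pos_from (f x) (N x)).
Proof. by move=> cf cN; rewrite /pos_from; computable_tac. Qed.

Lemma computable_useq (p q : X -> {poly rat}) (u : X -> rat) (n : X -> nat) :
  computable p -> computable q -> computable u -> computable n ->
  computable (fun x => useq (p x) (q x) (u x) (n x)).
Proof. by move=> cp cq cu cn; rewrite /useq; computable_tac. Qed.

Lemma computable_poly_of_roots (c : X -> rat) (s : X -> seq rat) :
  computable c -> computable s -> computable (fun x => poly_of_roots (c x) (s x)).
Proof. by move=> cc cs; rewrite /poly_of_roots; computable_tac. Qed.

Lemma computable_reflect1 (s : X -> seq rat) :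
  computable s -> computable (fun x => reflect1 (s x)).
Proof. by move=> cs; rewrite /reflect1; computable_tac. Qed.

Lemma computable_gen_num (g : X -> generator) :
  computable g -> computable (fun x => gen_num (g x)).
Proof.
move=> cg; pose a x := (g x).2; pose n x := (g x).1.2.
have ca : computable a by rewrite /a; computable_tac.
have cn : computable n by rewrite /n; computable_tac.
apply: (@computable_ext _ _ (fun x =>
  if (g x).1.1 == 0%N then [:: a x + 1] else
  if (g x).1.1 == 1%N then [:: a x; 1 - a x] else
  if (g x).1.1 == 2%N then 1 :: [seq a x + i%:R / (n x)%:R | i <- iota 0 (n x)]
  else [:: 1])).
  by move=> x; rewrite /a /n; case: (g x) => [[? ?] ?].
by computable_tac.
Qed.

Lemma computable_gen_den (g : X -> generator) :
  computable g -> computable (fun x => gen_den (g x)).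
Proof.
move=> cg; pose a x := (g x).2; pose n x := (g x).1.2.
have ca : computable a by rewrite /a; computable_tac.
have cn : computable n by rewrite /n; computable_tac.
apply: (@computable_ext _ _ (fun x =>
  if (g x).1.1 == 0%N then [:: a x] else
  if (g x).1.1 == 1%N then [::] else
  if (g x).1.1 == 2%N then
    (n x)%:R * a x :: [seq i.+1%:R / (n x)%:R | i <- iota 0 (n x)]
  else [::])).
  by move=> x; rewrite /a /n; case: (g x) => [[? ?] ?].
by computable_tac.
Qed.

Lemma computable_gen_of (N : X -> nat) (g : X -> cgen) :
  computable N -> computable g -> computable (fun x => gen_of (N x) (g x)).
Proof. by move=> cN cg; rewrite /gen_of /cgen_arg; computable_tac. Qed.

Lemma computable_refl_count (P : X -> seq cgen) :
  computable P -> computable (fun x => refl_count (P x)).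
Proof. by move=> cP; rewrite /refl_count; computable_tac. Qed.

Lemma computable_value_num (N : X -> nat) (g : X -> cgen) :
  computable N -> computable g -> computable (fun x => value_num (N x) (g x)).
Proof. by move=> cN cg; rewrite /value_num /cgen_arg; computable_tac. Qed.

Lemma computable_value_den (N : X -> nat) (g : X -> cgen) :
  computable N -> computable g -> computable (fun x => value_den (N x) (g x)).
Proof. by move=> cN cg; rewrite /value_den; computable_tac. Qed.

Lemma computable_cyclotomic_check (N : X -> nat) (p W : X -> {poly rat}) :
  computable N -> computable p -> computable W ->
  computable (fun x => cyclotomic_check (N x) (p x) (W x)).
Proof. by move=> cN cp cW; rewrite /cyclotomic_check /proper_factors; computable_tac. Qed.

End ComputableChecks.

Ltac computable_user ::= first
  [ apply: computable_pred | apply: computable_iota1 | apply: computable_lead_coef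
  | apply: computable_pos_from | apply: computable_useq
  | apply: computable_poly_of_roots | apply: computable_reflect1
  | apply: computable_gen_num | apply: computable_gen_den
  | apply: computable_gen_of | apply: computable_refl_count
  | apply: computable_value_num | apply: computable_value_den
  | apply: computable_cyclotomic_check ].

Lemma computable_limit_check : computable (fun y : input * certificate => limit_check y.1 y.2).
Proof.
rewrite /limit_check /gen_check /nonpole_check /value_poly; cbv zeta.
computable_tac.
Qed.

(** * The decision procedures *)

Section Comparison.
Variable R : realType.
Implicit Types (x : input) (w : (nat * nat) * certificate).

Definition in_p x : {poly rat} := x.1.1.
Definition in_q x : {poly rat} := x.1.2.
Definition in_u0 x : rat := x.2.1.
Definition in_t x : rat := x.2.2.

Definition term x n : rat := useq (in_p x) (in_q x) (in_u0 x) n.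

Definition inverse_input x : input :=
  ((in_q x, in_p x), ((in_u0 x)^-1, (in_t x)^-1)).

Definition in_regular x : Prop := regular (in_p x) (in_q x) (in_u0 x).

Definition below_check x w : bool :=
  below_from (in_p x) (in_q x) (in_u0 x) (in_t x) w.1.1.

Definition above_check x w : bool :=
  above_from (in_p x) (in_q x) (in_u0 x) (in_t x) w.1.1 w.1.2 ||
  (decr_from (in_p x) (in_q x) w.1.1 && limit_check x w.2).

(** For t = 0 there is no inverse input, but then t^2 < y_n holds outright for a sequence without
    zeros. *)
Definition up_check x w : bool :=
  [|| in_t x == 0, above_check x w |
      (in_t x != 0) && below_check (inverse_input x) w].

Definition down_check x w : bool :=
  (in_t x != 0) && (below_check x w || above_check (inverse_input x) w).

Lemma in_regular_inverse x : in_regular x -> in_regular (inverse_input x).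
Proof. exact: regular_inv. Qed.

Lemma term_inverse x n : term (inverse_input x) n = (term x n)^-1.
Proof. exact: useq_inv. Qed.

Lemma below_checkP x w : in_regular x -> below_check x w ->
  forall n, (w.1.1 <= n)%N -> term x n ^+ 2 < in_t x ^+ 2.
Proof. exact: below_fromP. Qed.

Lemma above_checkP x w : in_regular x -> above_check x w ->
  forall n, (w.1.1 <= n)%N -> in_t x ^+ 2 < term x n ^+ 2.
Proof.
move=> reg /orP[|/andP[dec lim]]; first exact: above_fromP.
case: x reg dec lim => [[p q] [u t]] reg dec lim.
exact: (useq_gt_limit reg dec (@limit_check_sound R _ _ _ _ _ reg lim)).
Qed.

Lemma ltr_sqr_inv (a b : rat) : a != 0 -> b != 0 ->
  (a^-1 ^+ 2 < b^-1 ^+ 2) = (b ^+ 2 < a ^+ 2).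
Proof.
by move=> a0 b0; rewrite !exprVn ltf_pV2// posrE exprn_even_gt0.
Qed.

Lemma up_checkP x w : in_regular x -> up_check x w ->
  forall n, (w.1.1 <= n)%N -> in_t x ^+ 2 < term x n ^+ 2.
Proof.
move=> reg /or3P[/eqP->|h|/andP[t0 h]] n wn.
- by rewrite expr0n/=; exact: useq_gt0.
- exact: above_checkP h _ wn.
have := below_checkP (in_regular_inverse reg) h wn.
by rewrite term_inverse ltr_sqr_inv//; exact: useq_neq0.
Qed.

Lemma down_checkP x w : in_regular x -> down_check x w ->
  forall n, (w.1.1 <= n)%N -> term x n ^+ 2 < in_t x ^+ 2.
Proof.
move=> reg /andP[t0 /orP[h|h]] n wn; first exact: below_checkP h _ wn.
have := above_checkP (in_regular_inverse reg) h wn.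
by rewrite term_inverse ltr_sqr_inv//; exact: useq_neq0.
Qed.

Lemma ratr_cvg (y : nat -> rat) (l : rat) :
  (forall d, 0 < d -> exists N0, forall N, (N0 <= N)%N -> l <= y N < l + d) ->
  (ratr (y n) : R) @[n --> \oo] --> (ratr l : R).
Proof.
move=> h; apply/cvgrPdist_lt => e e0.
pose d : rat := (Num.truncn e^-1).+1%:R^-1.
have d0 : 0 < d by rewrite invr_gt0 ltr0n.
have [N0 hN] := h d d0; near=> n.
have /andP[h1 h2] : l <= y n < l + d by apply: hN; near: n; exact: nbhs_infty_ge.
rewrite distrC ger0_norm ?subr_ge0 ?ler_rat// ltrBlDl.
apply: (@lt_le_trans _ _ (ratr (l + d))); first by rewrite ltr_rat.
rewrite rmorphD/= lerD2l /d fmorphV/= ratr_nat.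
by rewrite invf_ple ?posrE ?ltr0n// ltW// truncnS_gt.
Unshelve. all: by end_near.
Qed.

Lemma decreasing_check x : rohrlich_conjecture R -> in_regular x ->
  splits (in_p x) -> splits (in_q x) -> in_t x != 0 ->
  0 < lead_coef (in_p x ^+ 2 - in_q x ^+ 2) ->
  (exists w, below_check x w) \/ (exists w, above_check x w).
Proof.
move=> rohrlich reg sp sq t0 lc.
pose c0 : certificate := (([::], [::], (0, 0, 0)%N), ([::], [::], 0)).
have [[N hN]|[K [N hN]]|[sz lim]] := complete_decreasing reg t0 lc.
- by left; exists (N, 0%N, c0); apply: hN.
- by right; exists (N, K, c0); apply/orP; left; apply: hN.
have [N hN] := pos_from_eventually lc.
have [c hc] := limit_check_complete rohrlich sp sq reg sz (ratr_cvg lim).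
right; exists (N, 0%N, c); apply/orP; right; by rewrite /decr_from hN//=.
Qed.

(** As p^2 - q^2 is not zero, the sign of its leading coefficient tells whether the squares or their
    inverses eventually decrease. *)
Lemma up_or_down_check x : rohrlich_conjecture R -> in_regular x ->
  splits (in_p x) -> splits (in_q x) -> in_p x ^+ 2 != in_q x ^+ 2 ->
  (exists w, up_check x w) \/ (exists w, down_check x w).
Proof.
move=> rohrlich reg sp sq pq.
pose c0 : certificate := (([::], [::], (0, 0, 0)%N), ([::], [::], 0)).
have [t0|t0] := eqVneq (in_t x) 0.
  by left; exists (0, 0, c0)%N; rewrite /up_check t0 eqxx.
have : lead_coef (in_p x ^+ 2 - in_q x ^+ 2) != 0.
  by rewrite lead_coef_eq0 subr_eq0.
case: ltrgt0P => // lc _.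
  have [] := decreasing_check rohrlich reg sp sq t0 lc => -[w hw].
    by right; exists w; rewrite /down_check t0 hw.
  by left; exists w; rewrite /up_check hw orbT.
have lc' : 0 < lead_coef (in_p (inverse_input x) ^+ 2 - in_q (inverse_input x) ^+ 2).
  by rewrite -opprB lead_coefN oppr_gt0.
have t0' : in_t (inverse_input x) != 0 by rewrite invr_eq0.
have [] := decreasing_check rohrlich (in_regular_inverse reg) sq sp t0' lc' => -[w hw].
  by left; exists w; rewrite /up_check t0 hw !orbT.
by right; exists w; rewrite /down_check t0 hw orbT.
Qed.

End Comparison.

(** * Certificates for whole sequences *)

Section Problems.
Variable R : realType.
Implicit Types (x : input) (n N L : nat).

Definition in_domain x : Prop :=
  [/\ splits (in_p x), splits (in_q x) & forall n : nat, (in_p x).[n%:R] != 0].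

Lemma termS x n : term x n.+1 =
  term x n * ((in_q x).[n.+1%:R] / (in_p x).[n.+1%:R]).
Proof. exact: useqS. Qed.

Lemma term_eq0_after x L : term x L = 0 -> forall n, (L <= n)%N -> term x n = 0.
Proof.
move=> z n /subnKC <-; elim: (n - L)%N => [|k IH]; first by rewrite addn0.
by rewrite addnS termS IH mul0r.
Qed.

Lemma regular_of_terms x : in_domain x -> (forall n, term x n != 0) -> in_regular x.
Proof.
move=> [_ _ px] nz; split=> [|n]; first by have := nz 0%N; rewrite /term useq0.
split=> //; have := nz n.+1; rewrite termS mulf_eq0 negb_or => /andP[_].
by rewrite mulf_eq0 negb_or => /andP[].
Qed.

(** Finite evidence of regularity: no q(n) vanishes from N on, and a nonzero term at N excludes an
    earlier zero, which would persist. *)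
Definition nonzero_check x N : bool := pos_from (in_q x ^+ 2) N && (term x N != 0).

Lemma nonzero_checkP x N : in_domain x -> nonzero_check x N -> in_regular x.
Proof.
move=> dx /andP[/pos_fromP pos nz]; apply: regular_of_terms => // n.
have [nN|Nn] := leqP n N.
  by apply: contraNneq nz => z; rewrite (term_eq0_after z).
rewrite -(subnKC (ltnW Nn)); elim: (n - N)%N => [|k IH]; first by rewrite addn0.
have [_ _ px] := dx; rewrite addnS termS mulf_neq0// mulf_neq0 ?invr_eq0//.
have := pos (N + k).+1 (leqW (leq_addr _ _)).
by rewrite horner_exp lt0r sqrf_eq0 => /andP[].
Qed.

Lemma nonzero_check_exists x : in_regular x -> exists N, nonzero_check x N.
Proof.
move=> reg; have q0 : in_q x != 0.
  by have [_ /(_ 0%N)[_ +]] := reg; apply: contraNneq => ->; rewrite horner0.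
have [|N hN] := @pos_from_eventually (in_q x ^+ 2).
  by rewrite lead_coef_exp exprn_even_gt0//= lead_coef_eq0.
by exists N; rewrite /nonzero_check hN//=; exact: useq_neq0.
Qed.

(** Here q is p or -p, so the sequence is constant or alternates in sign. *)
Lemma term_equal_squares x n : in_domain x -> in_p x ^+ 2 = in_q x ^+ 2 ->
  term x n = term x 0 \/ term x n = term x 1.
Proof.
move=> [_ _ px] /eqP; rewrite eqf_sqr => /orP[]/eqP pq.
  left; elim: n => // n IH; rewrite termS IH -pq divff ?mulr1//.
have opp m : term x m.+1 = - term x m.
  by rewrite termS -[in_q x]opprK -pq hornerN mulNr divff ?mulrN1.
elim: n => [|n [IH|IH]]; first by left.
  by right; rewrite !opp IH.
by left; rewrite opp IH opp opprK.
Qed.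

(** The last index of the tested prefix, the index from which the sign is certified, and the
    evidence comparing the squares of the tail with t^2. *)
Definition stage : Type := ((nat * nat) * ((nat * nat) * certificate))%type.

(** Three situations: the sequence reaches 0 and then keeps a value already tested in the prefix;
    p^2 = q^2, where at most two values occur; or no term is zero, and a tested prefix is joined to
    evidence for the tail. *)
Definition check (good : input -> rat -> bool) (tail : input -> stage -> bool)
    x (s : nat * stage) : bool :=
  let prefix := all (fun n => good x (term x n)) (iota 0 s.2.1.1.+1) in
  [|| (term x s.2.1.1 == 0) && prefix,
      [&& in_p x ^+ 2 == in_q x ^+ 2, good x (term x 0) & good x (term x 1)] |
      [&& nonzero_check x s.1, prefix & tail x s.2]].

(** Shared by both problems, which differ only in the test on single values and in the evidence for
    the tail. *)
Lemma check_semidecidable (good : input -> rat -> bool) (tail : input -> stage -> bool) :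
  computable (fun y : input * rat => good y.1 y.2) ->
  computable (fun y : input * stage => tail y.1 y.2) ->
  (forall x s, in_domain x -> in_regular x -> tail x s ->
     forall n, (s.1.1 < n)%N -> good x (term x n)) ->
  (forall x, in_domain x -> in_regular x -> in_p x ^+ 2 != in_q x ^+ 2 ->
     (forall n, good x (term x n)) -> exists s, tail x s) ->
  semidecidable in_domain (fun x => forall n, good x (term x n)).
Proof.
move=> cgood ctail sound complete.
apply: (semidecidable_cert (c := fun y : input * (nat * stage) => check good tail y.1 y.2)).
  rewrite /check /nonzero_check /term /in_p /in_q /in_u0; cbv zeta.
  pose g x n := good x (useq x.1.1 x.1.2 x.2.1 n).
  have cg : computable (fun y : input * nat => g y.1 y.2).
    by apply: (computable_comp (g := fun y : input * rat => good y.1 y.2)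
      (f := fun y : input * nat => (y.1, useq y.1.1.1 y.1.1.2 y.1.2.1 y.2))) => //; computable_tac.
  have cg' (X : Type) (cX : code X) (i : X -> input) (n : X -> nat) :
    computable i -> computable n -> computable (fun z : X => g (i z) (n z)).
    move=> ci cn; apply: (computable_comp (f := fun z : X => (i z, n z)) cg).
    exact: computable_pair.
  have ct : computable (fun y : input * (nat * stage) => tail y.1 y.2.2).
    by apply: (computable_comp (f := fun y : input * (nat * stage) => (y.1, y.2.2)) ctail);
      computable_tac.
  apply: computable_orb; last apply: computable_orb; last apply: computable_andb;
    last apply: computable_andb.
  - apply: computable_andb; first by computable_tac.
    by apply: (computable_all (F := fun (z : input * (nat * stage)) n => g z.1 n)); [apply: cg'|]; computable_tac.
  - apply: computable_andb; first by computable_tac.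
    by apply: computable_andb; apply: cg'; computable_tac.
  - by computable_tac.
  - by apply: (computable_all (F := fun (z : input * (nat * stage)) n => g z.1 n)); [apply: cg'|]; computable_tac.
  - exact: ct.
move=> x dx; split=> [gx|[[N s] /=]]; last first.
  have prefixP : all (fun n => good x (term x n)) (iota 0 s.1.1.+1) ->
      forall n, (n <= s.1.1)%N -> good x (term x n).
    by move=> /allP h n ns; apply: h; rewrite mem_iota.
  move=> /or3P[/andP[/eqP z /prefixP h] n|/and3P[/eqP pq g0 g1] n|/and3P[nz /prefixP h t] n].
  - have [|sn] := leqP n s.1.1; first exact: h.
    by rewrite (term_eq0_after z (ltnW sn)) -z h.
  - by have [->|->] := term_equal_squares n dx pq.
  - have [|sn] := leqP n s.1.1; first exact: h.
    exact: sound (nonzero_checkP dx nz) t n sn.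
have prefix L : all (fun n => good x (term x n)) (iota 0 L.+1).
  by apply/allP => n _; exact: gx.
pose w0 : (nat * nat) * certificate := ((0, 0)%N, (([::], [::], (0, 0, 0)%N), ([::], [::], 0))).
(* Whether a zero occurs is decided classically: only the existence of an accepted certificate is at
   stake here. *)
have [[L z]|nz] := pselect (exists L, term x L = 0).
  by exists (0%N, ((L, 0%N), w0)); apply/orP; left; rewrite z eqxx; exact: prefix.
have [pq|pq] := eqVneq (in_p x ^+ 2) (in_q x ^+ 2).
  by exists (0%N, ((0, 0)%N, w0)); apply/or3P/Or32; rewrite pq eqxx !gx.
have reg : in_regular x.
  by apply: regular_of_terms => // n; apply: contra_notN nz => /eqP z; exists n.
have [N hN] := nonzero_check_exists reg; have [s hs] := complete x dx reg pq gx.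
by exists (N, s); apply/or3P/Or33; rewrite hN hs prefix.
Qed.

Section ComputableComparison.
Context {X : Type} {cX : code X}.
Variables (i : X -> input) (w : X -> (nat * nat) * certificate).
Hypotheses (ci : computable i) (cw : computable w).

Lemma computable_inverse_input : computable (fun z => inverse_input (i z)).
Proof. by rewrite /inverse_input /in_p /in_q /in_u0 /in_t; computable_tac. Qed.

Lemma computable_below_check : computable (fun z => below_check (i z) (w z)).
Proof.
rewrite /below_check /below_from /decr_from /in_p /in_q /in_u0 /in_t.
by computable_tac.
Qed.

Lemma computable_above_check : computable (fun z => above_check (i z) (w z)).
Proof.
have cl : computable (fun z => limit_check (i z) (w z).2).
  apply: (computable_comp (f := fun z => (i z, (w z).2)) computable_limit_check).
  by computable_tac.
rewrite /above_check /above_from /decr_from /in_p /in_q /in_u0 /in_t.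
apply: computable_orb; last apply: computable_andb => //; by computable_tac.
Qed.

End ComputableComparison.

Ltac computable_user ::= first
  [ apply: computable_pred | apply: computable_iota1 | apply: computable_lead_coef
  | apply: computable_pos_from | apply: computable_useq
  | apply: computable_inverse_input | apply: computable_below_check
  | apply: computable_above_check ].

Lemma computable_up_check {X : Type} {cX : code X} (i : X -> input)
  (w : X -> (nat * nat) * certificate) :
  computable i -> computable w -> computable (fun z => up_check (i z) (w z)).
Proof. by move=> ci cw; rewrite /up_check /in_t; computable_tac. Qed.

Lemma computable_down_check {X : Type} {cX : code X} (i : X -> input)
  (w : X -> (nat * nat) * certificate) :
  computable i -> computable w -> computable (fun z => down_check (i z) (w z)).
Proof. by move=> ci cw; rewrite /down_check /in_t; computable_tac. Qed.

Definition good_member x (v : rat) : bool := v != in_t x.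

Definition tail_member x (s : stage) : bool :=
  (s.2.1.1 <= s.1.1)%N && (up_check x s.2 || down_check x s.2).

Definition good_threshold x (v : rat) : bool := in_t x <= v.

(** Where u_n^2 < t^2, the inequality u_n >= t amounts to t < 0. Where u_n^2 > t^2, it follows from
    u_n > 0, and positivity propagates when p q, which has the sign of q/p, is positive. *)
Definition tail_threshold x (s : stage) : bool :=
  [&& (s.2.1.1 <= s.1.1)%N, (s.1.2 <= s.1.1)%N &
      (in_t x < 0) && down_check x s.2 ||
      [&& up_check x s.2, 0 < term x s.1.2 & pos_from (in_p x * in_q x) s.1.2]].

Ltac computable_user ::= first
  [ apply: computable_pred | apply: computable_iota1 | apply: computable_lead_coef
  | apply: computable_pos_from | apply: computable_useq
  | apply: computable_up_check | apply: computable_down_check ].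

Lemma term_pos_after x M : in_domain x -> pos_from (in_p x * in_q x) M ->
  0 < term x M -> forall n, (M <= n)%N -> 0 < term x n.
Proof.
move=> [_ _ px] /pos_fromP pos tM n /subnKC <-.
elim: (n - M)%N => [|k IH]; first by rewrite addn0.
rewrite addnS termS pmulr_rgt0//.
have := pos (M + k).+1 (leqW (leq_addr _ _)); rewrite hornerM => h.
rewrite -(pmulr_lgt0 _ (_ : 0 < (in_p x).[(M + k).+1%:R] ^+ 2)).
  by rewrite expr2 mulrA divfK// mulrC.
by rewrite exprn_even_gt0//= px.
Qed.

Lemma nonmember_semidecidable : rohrlich_conjecture R ->
  semidecidable in_domain (fun x => ~ exists n, term x n = in_t x).
Proof.
move=> rohrlich.
have [c cc cP] : semidecidable in_domain (fun x => forall n, good_member x (term x n)).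
  apply: (@check_semidecidable good_member tail_member).
  - by rewrite /good_member /in_t; computable_tac.
  - by rewrite /tail_member; computable_tac.
  - move=> x s dx reg /andP[sL h] n Ln; have sn := leq_trans sL (ltnW Ln).
    apply/eqP => e; case/orP: h => h.
      by have := up_checkP R reg h sn; rewrite e ltxx.
    by have := down_checkP R reg h sn; rewrite e ltxx.
  move=> x dx reg pq _; have [sp sq _] := dx.
  have [] := up_or_down_check rohrlich reg sp sq pq => -[w hw];
  by exists ((w.1.1, 0%N), w); rewrite /tail_member/= leqnn hw ?orbT.
exists c => // x dx; rewrite -(cP x dx); split=> [h n|h [n e]].
  by apply/eqP => e; apply: h; exists n.
by have := h n; rewrite /good_member e eqxx.
Qed.

Lemma threshold_semidecidable : rohrlich_conjecture R ->
  semidecidable in_domain (fun x => forall n, in_t x <= term x n).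
Proof.
move=> rohrlich.
apply: (@check_semidecidable good_threshold tail_threshold).
- by rewrite /good_threshold /in_t; computable_tac.
- by rewrite /tail_threshold /term /in_t /in_p /in_q /in_u0; computable_tac.
- move=> x s dx reg /and3P[sL ML h] n Ln; have sn := leq_trans sL (ltnW Ln).
  rewrite /good_threshold leNgt; apply/negP => lt.
  case/orP: h => [/andP[t0 h]|/and3P[h tM pos]].
    have := down_checkP R reg h sn; rewrite ltNge -sqrrN -[term x n ^+ 2]sqrrN => /negP; apply.
    by rewrite ler_pXn2r ?nnegrE ?oppr_ge0 ?lerN2 ?ltW// (lt_trans lt).
  have := up_checkP R reg h sn; rewrite ltNge => /negP; apply.
  have tn := term_pos_after dx pos tM (leq_trans ML (ltnW Ln)).
  by rewrite ler_pXn2r ?nnegrE ?ltW// (lt_trans tn).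
move=> x dx reg pq ge; have [sp sq px] := dx.
have [] := up_or_down_check rohrlich reg sp sq pq => -[w hw]; last first.
  exists ((w.1.1, 0%N), w); rewrite /tail_threshold/= leqnn hw andbT/=.
  (* For t >= 0, the hypothesis t <= u_n would give t^2 <= u_n^2. *)
  rewrite ltNge; apply/orP; left; apply/negP => t0.
  have := down_checkP R reg hw (leqnn _); rewrite ltNge => /negP; apply.
  by rewrite ler_pXn2r ?nnegrE ?(le_trans t0)//; exact: ge.
(* A term with t <= u_n <= 0 would satisfy u_n^2 <= t^2. *)
have pos n : (w.1.1 <= n)%N -> 0 < term x n.
  move=> wn; rewrite ltNge; apply/negP => t0.
  have := up_checkP R reg hw wn; rewrite ltNge -sqrrN -[in_t x ^+ 2]sqrrN => /negP; apply.
  have tn := ge n.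
  by rewrite ler_pXn2r ?nnegrE ?oppr_ge0 ?lerN2// (le_trans tn).
have : lead_coef (in_p x * in_q x) != 0.
  rewrite lead_coef_eq0 mulf_neq0//.
    by apply: contraTneq isT => p0; have := px 0%N; rewrite p0 horner0 eqxx.
  by have [_ /(_ 0%N)[_ +]] := reg; apply: contraNneq => ->; rewrite horner0.
(* A negative leading coefficient of p q would make late consecutive terms differ in sign, against
   [pos]. *)
case: ltrgt0P => // lc _; last first.
  have [N hN] : exists N0, forall N, (N0 <= N)%N -> pos_from (- (in_p x * in_q x)) N.
    by apply: pos_from_eventually; rewrite lead_coefN oppr_gt0.
  pose n := maxn w.1.1 N.
  have := pos_fromP (hN N (leqnn N)) (leqW (leq_maxr w.1.1 N) : (N <= n.+1)%N).
  have := pos n.+1 (leqW (leq_maxl _ _)).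
  rewrite termS pmulr_rgt0 ?pos ?leq_maxl// hornerN hornerM oppr_gt0 => h1 h2.
  have p2 : 0 < (in_p x).[n.+1%:R] ^+ 2 by rewrite exprn_even_gt0//=.
  have := mulr_gt0 h1 p2; rewrite expr2 mulrA divfK// mulrC => h3.
  by have := lt_trans h2 h3; rewrite ltxx.
have [N hN] := pos_from_eventually lc.
exists ((maxn w.1.1 N, maxn w.1.1 N), w).
by rewrite /tail_threshold/= leq_maxl leqnn hw pos ?leq_maxl// hN ?leq_maxr// orbT.
Qed.

Lemma in_domain_input_of y : in_domain (input_of y).
Proof. by case: y => [[p q u sp sq pn] t]; split. Qed.

Lemma is_sequence_of_term y : is_sequence_of y.1 (term (input_of y)).
Proof.
split=> [|[//|n] _]; first exact: useq0.
have pn := hg_p_neq0 y.1 n.+1.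
by rewrite termS -[in_p _]/(hg_p y.1) -[in_q _]/(hg_q y.1)/=; field.
Qed.

Lemma sequence_eq_term y u : is_sequence_of y.1 u -> u = term (input_of y).
Proof.
move=> hu; have [v [_ uniq]] := is_sequence_of_unique y.1.
by rewrite -(uniq _ hu) -(uniq _ (is_sequence_of_term y)).
Qed.

Lemma exists_term_semidecidable (b : input -> rat -> bool) :
  computable (fun y : input * rat => b y.1 y.2) ->
  semidecidable in_domain (fun x => exists n, b x (term x n)).
Proof.
move=> cb; apply: (semidecidable_cert (c := fun y : input * nat => b y.1 (term y.1 y.2))) => //.
apply: (computable_comp (f := fun y : input * nat => (y.1, term y.1 y.2)) cb).
by rewrite /term /in_p /in_q /in_u0; computable_tac.
Qed.

End Problems.

Theorem theorem3p5 (R : realType) :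
  rohrlich_conjecture R ->
  decidable_problem membership_problem /\ decidable_problem threshold_problem.
Proof.
move=> rohrlich; split.
  apply: (@decidable_of_semidecidable _ _ membership_problem decode_input input_of
    in_domain (fun x => exists n, term x n = in_t x)).
  - exact: computable_decode_input.
  - exact: decode_inputK.
  - exact: in_domain_input_of.
  - move=> y; split=> [[u /sequence_eq_term ->]|h] //.
    by exists (term (input_of y)) => //; exact: is_sequence_of_term.
  - have [|c cc cP] := exists_term_semidecidable (b := fun x v => v == in_t x).
      by rewrite /in_t; computable_tac.
    exists c => // x dx; rewrite -(cP x dx).
    by split=> -[n e]; exists n; exact/eqP.
  - exact: (nonmember_semidecidable rohrlich).
apply: (@decidable_of_semidecidable _ _ threshold_problem decode_input input_of
  in_domain (fun x => forall n, in_t x <= term x n)).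
- exact: computable_decode_input.
- exact: decode_inputK.
- exact: in_domain_input_of.
- move=> y; split=> [[u /sequence_eq_term ->]|h] //.
  by exists (term (input_of y)) => //; exact: is_sequence_of_term.
- exact: (threshold_semidecidable rohrlich).
have [|c cc cP] := exists_term_semidecidable (b := fun x v => v < in_t x).
  by rewrite /in_t; computable_tac.
exists c => // x dx; rewrite -(cP x dx); split=> [h|[n lt] /(_ n)].
  apply: contrapT => nlt; apply: h => n; rewrite leNgt; apply/negP => lt.
  by apply: nlt; exists n.
by rewrite leNgt lt.
Qed.
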